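(* Let $d\ge1$, $s>\frac d2+1$, let $\{\xi_k\}_{k\in\mathbb N}$ be $d$-dimensional vector fields on $\mathbb T^d=(\mathbb R/2\pi\mathbb Z)^d$ with $\sum_{k\in\mathbb N}\|\xi_k\|_{H^\sigma}<\infty$ for every $\sigma\ge0$, and let $\mathcal P\in\mathrm{OPS}^s_{1,0}$. For a scalar function $f$ define $$\mathcal L_{\xi_k}f=\xi_k\cdot\nabla f+(\mathrm{div}\,\xi_k)f.$$ Then there is a constant $C>0$ independent of $f$ such that for all scalar functions $f\in H^{s+2}(\mathbb T^d;\mathbb R)$, $$\mathrm{Re}\Big(\mathcal P\sum_{k=1}^\infty\mathcal L_{\xi_k}^2f,\ \mathcal Pf\Big)_{L^2}+\sum_{k=1}^\infty\big(\mathcal P\mathcal L_{\xi_k}f,\ \mathcal P\mathcal L_{\xi_k}f\big)_{L^2}\le C\|f\|_{H^s}^2 .$$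
   Context: $\mathcal L_{\xi_k}^2f=\mathcal L_{\xi_k}(\mathcal L_{\xi_k}f)$; $(f,g)_{L^2}=\int_{\mathbb T^d}f\,\overline g\,dx$. $H^\sigma$ is the Sobolev space on $\mathbb T^d$ with $\|f\|_{H^\sigma}^2=\sum_{k\in\mathbb Z^d}(1+|k|^2)^\sigma|\widehat f(k)|^2$ (componentwise for vector fields). For $\rho,\delta\in[0,1]$, $s\in\mathbb R$, the symbol class $S^s_{\rho,\delta}$ is the set of $a:\mathbb T^d\times\mathbb Z^d\to\mathbb C$ with $a(\cdot,k)\in C^\infty(\mathbb T^d)$ for all $k$ and such that for all $\alpha,\beta\in\mathbb N^d$ (multi-indices) there is $C=C(\alpha,\beta)>0$ with $|\Delta_k^\alpha\partial_x^\beta a(x,k)|\le C\langle k\rangle^{s-\rho|\alpha|+\delta|\beta|}$, where $\langle k\rangle=(1+|k|^2)^{1/2}$ and $\Delta_k^\alpha g(k)=\sum_{\gamma\le\alpha}(-1)^{|\alpha-\gamma|}\binom\alpha\gamma g(k+\gamma)$. $\mathrm{OPS}^s_{\rho,\delta}$ is the class of operators $p(x,D)f(x)=\frac1{(2\pi)^d}\sum_{k\in\mathbb Z^d}a(x,k)e^{ix\cdot k}\widehat f(k)$ with $a\in S^s_{\rho,\delta}$, where $\widehat f(k)=\int_{\mathbb T^d}f(x)e^{-ix\cdot k}dx$. *)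

(* Defs.v *)
From HB Require Import structures.
From mathcomp Require Import all_boot all_order all_algebra.
From mathcomp Require Import finmap.
From mathcomp Require Import all_classical all_reals all_analysis.
From mathcomp Require Import complex.

Set Implicit Arguments.
Unset Strict Implicit.
Unset Printing Implicit Defensive.

Import Order.TTheory GRing.Theory Num.Theory.
Import numFieldNormedType.Exports.

Local Open Scope classical_set_scope.
Local Open Scope ring_scope.
Local Open Scope complex_scope.

(* Functions on the torus T^d = (R / 2 pi Z)^d are 2 pi-periodic functions on
   'rV[R]_d.  They are integrated over the fundamental domain [0, 2 pi[^d:
   [torus_measure d] is Lebesgue measure restricted to this cube, carried by
   the measurable type of d-tuples and built as an iterated product measure. *)

Section torus_measure.
Context {R : realType}.
Local Notation mR := (measurableTypeR R).

Lemma lebesgue_circle_lty :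
  (lebesgue_measure `[0%R : R, (2 * pi)%R[%classic < +oo)%E.
Proof. by rewrite lebesgue_measure_itv /=; case: ifP => _; rewrite ltry. Qed.

Definition circle_measure : {finite_measure set mR -> \bar R} :=
  @mfrestr _ mR R `[0%R, (2 * pi)%R[%classic lebesgue_measure
    (measurable_itv _) lebesgue_circle_lty.

Definition tuple_cons n (p : mR * n.-tuple mR) : n.+1.-tuple mR :=
  [tuple of p.1 :: p.2].

Lemma measurable_tuple_cons n : measurable_fun setT (@tuple_cons n).
Proof. exact: measurable_cons. Qed.

Section torus_measureS.
Context n (m : {finite_measure set (n.-tuple mR) -> \bar R}).

Definition torus_measureS : set (n.+1.-tuple mR) -> \bar R :=
  pushforward (circle_measure \x m)%E (@tuple_cons n).

Let torus_measureS0 : torus_measureS set0 = 0%E.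
Proof. by rewrite /torus_measureS /pushforward preimage_set0 measure0. Qed.

Let torus_measureS_ge0 A : (0 <= torus_measureS A)%E.
Proof. by rewrite /torus_measureS /pushforward; exact: measure_ge0. Qed.

Let torus_measureS_sigma_additive : semi_sigma_additive torus_measureS.
Proof.
move=> F mF tF mUF; rewrite /torus_measureS /pushforward preimage_bigcup.
apply: measure_semi_sigma_additive.
- by move=> i; rewrite -[X in measurable X]setTI; exact: measurable_tuple_cons.
- apply/trivIsetP => /= i j _ _ ij; rewrite -preimage_setI.
  by move/trivIsetP : tF => /(_ _ _ _ _ ij) ->//; rewrite preimage_set0.
- rewrite -preimage_bigcup -[X in measurable X]setTI.
  exact: measurable_tuple_cons.
Qed.

HB.instance Definition _ := isMeasure.Build _ _ _ torus_measureS
  torus_measureS0 torus_measureS_ge0 torus_measureS_sigma_additive.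

Let torus_measureS_fin : fin_num_fun torus_measureS.
Proof.
apply: lty_fin_num_fun => /=.
rewrite /torus_measureS /pushforward preimage_setT -setXTT product_measure1E//.
by rewrite lte_mul_pinfty// ?fin_num_measure// -ge0_fin_numE// fin_num_measure.
Qed.

HB.instance Definition _ :=
  Measure_isFinite.Build _ _ _ torus_measureS torus_measureS_fin.

End torus_measureS.

Fixpoint torus_measure n : {finite_measure set (n.-tuple mR) -> \bar R} :=
  if n is n'.+1 then torus_measureS (torus_measure n')
  else \d_ ([tuple] : 0.-tuple mR).

End torus_measure.
Arguments torus_measure R n : clear implicits.

Section torus_functions.
Context {R : realType} {d : nat}.
Local Notation mu := (torus_measure R d).
Local Notation point := 'rV[R]_d.
Local Notation freq := 'rV[int]_d.
Local Notation normc := ComplexField.Normc.normc.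
Implicit Types (f g : point -> R) (u v : point -> R[i]).

Definition torus_point (t : d.-tuple (measurableTypeR R)) : point :=
  \row_j tnth t j.

Definition torus_periodic {T : Type} (h : point -> T) :=
  forall x j, h (x + (2 * pi) *: delta_mx 0 j) = h x.

Definition re u : point -> R := fun x => complex.Re (u x).
Definition im u : point -> R := fun x => complex.Im (u x).

Definition torus_int f : R := \int[mu]_t f (torus_point t).

Definition torus_intC u : R[i] :=
  torus_int (re u) +i* torus_int (im u).

Definition toC f : point -> R[i] := fun x => (f x)%:C.

(* Functions of [L2] are not quotiented by equality almost everywhere. *)
Definition L2 : set (point -> R[i]) := [set u |
  [/\ torus_periodic u,
      measurable_fun setT (re u \o torus_point),
      measurable_fun setT (im u \o torus_point) &
      (\int[mu]_t (normc (u (torus_point t)) ^+ 2)%:E < +oo)%E]].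

Definition innerL2 u v : R[i] := torus_intC (fun x => u x * (v x)^*).

Definition is_L2lim {I : Type} (F : set_system I) (w : I -> point -> R[i]) v :=
  L2 v /\
  (fun i => \int[mu]_t
      (normc (w i (torus_point t) - v (torus_point t)) ^+ 2)%:E)%E @ F --> 0%E.

(* L2lim, like [weak_partial] below, is a representative of a class of
   functions modulo equality almost everywhere (and 0 if there is none). *)
Definition L2lim {I : Type} (F : set_system I) (w : I -> point -> R[i]) :
    point -> R[i] :=
  xget (fun=> 0) [set v | is_L2lim F w v].

Definition L2series (w : nat -> point -> R[i]) : point -> R[i] :=
  L2lim \oo (fun n x => \sum_(0 <= k < n) w k x).

(* Sum of a family indexed by Z^d, as the limit over its finite subsets. *)
Definition L2sum (w : freq -> point -> R[i]) : point -> R[i] :=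
  L2lim (filter_from [set: {fset freq}] (fun A => [set B | (A `<=` B)%fset]))
    (fun A x => \sum_(k <- A) w k x).

Definition dotk (k : freq) (x : point) : R := \sum_j (k 0 j)%:~R * x 0 j.

Definition sqnormk (k : freq) : R := \sum_j (k 0 j)%:~R ^+ 2.

Definition bracket (k : freq) : R := Num.sqrt (1 + sqnormk k).

Definition expi (t : R) : R[i] := cos t +i* sin t.

Definition fourier u (k : freq) : R[i] :=
  torus_intC (fun x => u x * expi (- dotk k x)).

Definition sobolev_norm (sigma : R) u : \bar R :=
  sqrte (\esum_(k in [set: freq])
    ((1 + sqnormk k) `^ sigma * normc (fourier u k) ^+ 2)%:E).

(* For sigma >= 0 only, where every element of H^sigma is a function in L2. *)
Definition sobolev (sigma : R) : set (point -> R[i]) :=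
  [set u | L2 u /\ (sobolev_norm sigma u < +oo)%E].

Definition vcomp (X : point -> point) (j : 'I_d) : point -> R :=
  fun x => X x 0 j.

Definition vsobolev_norm (sigma : R) (X : point -> point) : \bar R :=
  sqrte (\sum_(j < d) (sobolev_norm sigma (toC (vcomp X j)) ^+ 2))%E.

Definition vsobolev (sigma : R) (X : point -> point) :=
  forall j, sobolev sigma (toC (vcomp X j)).

Definition partial (j : 'I_d) f : point -> R :=
  fun x => 'D_(delta_mx 0 j) f x.

Definition partials (js : seq 'I_d) f : point -> R := foldr partial f js.

Definition smooth f := forall js : seq 'I_d,
  continuous (partials js f) /\
  forall j x, derivable (partials js f) x (delta_mx 0 j).

Definition is_weak_partial (j : 'I_d) f g :=
  L2 (toC g) /\
  forall phi, torus_periodic phi -> smooth phi ->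
    torus_int (fun x => f x * partial j phi x) =
    - torus_int (fun x => g x * phi x).

Definition weak_partial (j : 'I_d) f : point -> R :=
  xget (fun=> 0) [set g | is_weak_partial j f g].

Definition divergence (X : point -> point) : point -> R :=
  fun x => \sum_j weak_partial j (vcomp X j) x.

Definition lie (X : point -> point) f : point -> R :=
  fun x => (\sum_j vcomp X j x * weak_partial j f x) + divergence X x * f x.

Definition multi := {ffun 'I_d -> nat}.

Definition abs_multi (alpha : multi) : nat := (\sum_j alpha j)%N.

Definition mpartial (beta : multi) u : point -> R[i] :=
  let js := flatten [seq nseq (beta j) j | j <- enum 'I_d] in
  fun x => partials js (re u) x +i* partials js (im u) x.

(* The index [gamma] ranges over the multi-indices gamma <= alpha. *)
Definition mdiff (alpha : multi) (h : freq -> R[i]) (k : freq) : R[i] :=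
  \sum_(gamma : {dffun forall j : 'I_d, 'I_(alpha j).+1})
    (-1) ^+ (\sum_j (alpha j - gamma j))%N
    * (\prod_j 'C(alpha j, gamma j))%:R
    * h (k + \row_j (gamma j : nat)%:Z).

Definition symbol_class (s rho delta : R) : set (point -> freq -> R[i]) :=
  [set a |
    (forall k, [/\ torus_periodic (a^~ k),
                   smooth (re (a^~ k)) &
                   smooth (im (a^~ k))]) /\
    forall alpha beta : multi, exists2 C : R, 0 < C & forall x k,
      normc (mdiff alpha (fun l => mpartial beta (a^~ l) x) k) <=
      C * bracket k `^
        (s - rho * (abs_multi alpha)%:R + delta * (abs_multi beta)%:R)].

(* The series does not converge pointwise for general u in H^s; it converges
   in L2, which is how p(x, D) maps H^s to L2. *)
Definition pdo (a : point -> freq -> R[i]) (u : point -> R[i]) :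
    point -> R[i] :=
  L2sum (fun k x =>
    (((2 * pi) ^+ d)^-1)%:C * (a x k * expi (dotk k x) * fourier u k)).

Definition OPS (s rho delta : R) : set ((point -> R[i]) -> point -> R[i]) :=
  [set P | exists2 a, symbol_class s rho delta a & P = pdo a].

End torus_functions.

(* Main.v *)
(** On the Fourier side [lie X], that is f |-> div (f X), becomes the operator L
sending frequency l to l + p with coefficient i (l + p).X^(p), and P sends l to
l + q with coefficient a^(q, l), which decays rapidly in q and loses one order
at each difference in l.  Hence T = [P, L] and D = [T, L] have order s, while
L* = m - L and E = [L, m] = X.grad (div X), where m is the multiplication by
div X.  Moving the factors L around gives
  Re (PLLf, Pf) + |PLf|^2
    = |Tf|^2 + Re (Df, Pf) + 2 Re (Tf, mPf) + (|mPf|^2 - Re (Pf, EPf)) / 2,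
where no operator on the right has order more than s.  The identity holds when f
and the operators are truncated in frequency, and its consequence
<= C |X|^2 |f|_(H^s)^2 passes to the limit by Plancherel.  The sum over k
converges because sum |xi_k|^2 <= (sum |xi_k|)^2. *)

Require Import Defs.
From HB Require Import structures.
From mathcomp Require Import all_boot all_order all_algebra.
From mathcomp Require Import finmap.
From mathcomp Require Import all_classical all_reals all_analysis.
From mathcomp Require Import measurable_realfun complex.
From mathcomp Require Import ring lra zify.

Set Implicit Arguments.
Unset Strict Implicit.
Unset Printing Implicit Defensive.

Import Order.TTheory GRing.Theory Num.Theory.
Import numFieldNormedType.Exports.

Local Open Scope classical_set_scope.
Local Open Scope ring_scope.

(** [L2series], [pdo] and [weak_partial] are representatives chosen by [xget]: what can be known of
    them is their Fourier coefficients, once a limit or a derivative is shown to exist. Existence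
    comes from Riesz-Fischer, and Parseval turns the inner products into sums over coefficients,
    which are all that the energy estimate sees. On coefficients an operator is a sum over shifts
    [q]. Peetre's inequality prices a shift at a power of 1 + |q|, so an l^1 sum of weighted bounds
    controls the operator, and truncating the shifts only drops terms of that sum: the bounds are
    uniform in the truncation. Adjoints and commutators of truncated operators are finite algebra
    and exact; the constant 14 adds up 4, 5, 4 and 1 from the four groups of terms of the identity.
    For each field the estimate bounds a sum of two terms of which only the second has a sign.
    Continuity of [P] from H^s to L2 identifies the sum of the first terms, and this bounds the
    partial sums of the nonnegative ones. *)

Local Notation nc := ComplexField.Normc.normc.

(** * Null sequences and square summable families *)

Section null_sequences.
Context {R : realType}.
Implicit Types (e : nat -> R).

(* One-sided: [e] may take negative values. *)
Definition to0 e := forall eps, 0 < eps -> exists N, forall n, (N <= n)%N -> e n <= eps.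

Lemma to0D e e' : to0 e -> to0 e' -> to0 (fun n => e n + e' n).
Proof.
move=> h h' eps eps0; have [N hN] := h _ (divr_gt0 eps0 (ltr0n R 2)).
have [N' hN'] := h' _ (divr_gt0 eps0 (ltr0n R 2)).
exists (maxn N N') => n; rewrite geq_max => /andP[a b].
by have := hN _ a; have := hN' _ b; lra.
Qed.

Lemma to0Z (c : R) e : 0 <= c -> to0 e -> to0 (fun n => c * e n).
Proof.
move=> c0 h eps eps0; have c1 : 0 < c + 1 by lra.
have [N hN] := h _ (divr_gt0 eps0 c1).
exists N => n /hN; rewrite ler_pdivlMr// => hn.
have [h0|h0] := leP 0 (e n); nra.
Qed.

Lemma to0_le e e' : (forall n, e n <= e' n) -> to0 e' -> to0 e.
Proof.
move=> h h' eps /h'[N hN]; exists N => n /hN; exact: le_trans.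
Qed.

Lemma to0_cst : to0 (fun=> 0).
Proof. by move=> eps e0; exists 0%N => n _; exact: ltW. Qed.

Lemma to0_eventually e e' N : (forall n, (N <= n)%N -> e n <= e' n) -> to0 e' -> to0 e.
Proof.
move=> h h' eps /h'[N' hN]; exists (maxn N N') => n.
by rewrite geq_max => /andP[a b]; exact: le_trans (h _ a) (hN _ b).
Qed.

Lemma to0_sum (I : Type) (r : seq I) (F : I -> nat -> R) :
  (forall i, to0 (F i)) -> to0 (fun n => \sum_(i <- r) F i n).
Proof.
move=> h; elim: r => [|i r ih].
  by apply: to0_le to0_cst => n; rewrite big_nil.
by apply: to0_le (to0D (h i) ih) => n; rewrite big_cons.
Qed.

Lemma to0_const (x : R) : to0 (fun=> x) -> x <= 0.
Proof.
move=> h; apply/ler_addgt0Pr => e e0; rewrite add0r.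
by have [N /(_ _ (leqnn _))] := h e e0.
Qed.

Lemma to0_comp e (phi : nat -> nat) : (forall n, (n <= phi n)%N) -> to0 e -> to0 (e \o phi).
Proof.
move=> h h' eps /h'[N hN]; exists N => n Nn; apply: hN.
exact: leq_trans (h n).
Qed.

Lemma to0_sqr e : (forall n, 0 <= e n) -> to0 e -> to0 (fun n => e n ^+ 2).
Proof.
move=> e0 h eps eps0.
have m0 : 0 < Num.min 1 eps by rewrite lt_min ltr01.
have [N hN] := h _ m0.
exists N => n /hN; rewrite le_min => /andP[a b]; have := e0 n; nra.
Qed.

Lemma to0_sqrP e : (forall n, 0 <= e n) -> to0 (fun n => e n ^+ 2) -> to0 e.
Proof.
move=> e0 h eps eps0; have [N hN] := h _ (exprn_gt0 2 eps0).
by exists N => n /hN; rewrite ler_sqr ?nnegrE ?(ltW eps0) ?e0.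
Qed.

Lemma cvg_to0 e (l : R) : e @ \oo --> l -> to0 (fun n => `|e n - l|).
Proof.
move=> /cvgrPdist_le h eps eps0; have [N _ hN] := h _ eps0.
by exists N => n Nn; have := hN n Nn; rewrite distrC.
Qed.

Lemma to0_cvgP e (l : R) : to0 (fun n => `|e n - l|) -> e @ \oo --> l.
Proof.
move=> h; apply/cvgrPdist_le => eps eps0; have [N hN] := h _ eps0.
by exists N => // n /= /hN; rewrite distrC.
Qed.

End null_sequences.

(** * Modulus and completeness of the complex numbers *)

Section complex_norm.
Context {R : realType}.
Implicit Types x y z : R[i].

Lemma nc_ge0 x : 0 <= nc x. Proof. by case: x => a b; exact: sqrtr_ge0. Qed.

Lemma nc_def x : nc x = Num.sqrt (complex.Re x ^+ 2 + complex.Im x ^+ 2).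
Proof. by case: x. Qed.

Lemma nc_sqr x : nc x ^+ 2 = complex.Re x ^+ 2 + complex.Im x ^+ 2.
Proof. by rewrite nc_def sqr_sqrtr ?addr_ge0 ?sqr_ge0. Qed.

Lemma ncM x y : nc (x * y) = nc x * nc y.
Proof. exact: ComplexField.Normc.normcM. Qed.

Lemma ncD x y : nc (x + y) <= nc x + nc y.
Proof. exact: le_normcD. Qed.

Lemma ncN x : nc (- x) = nc x.
Proof. by case: x => a b; rewrite /= !sqrrN. Qed.

Lemma ncB x y : nc (x - y) <= nc x + nc y.
Proof. by rewrite (le_trans (ncD _ _))// ncN. Qed.

Lemma nc_distC x y : nc (x - y) = nc (y - x).
Proof. by rewrite -opprB ncN. Qed.

Lemma nc0 : nc (0 : R[i]) = 0. Proof. exact: ComplexField.Normc.normc0. Qed.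

Lemma nc_eq0 x : nc x = 0 -> x = 0.
Proof. exact: ComplexField.Normc.eq0_normc. Qed.

Lemma nc_real (a : R) : nc (a%:C)%C = `|a|.
Proof. by rewrite nc_def /= expr0n addr0 sqrtr_sqr. Qed.

Lemma nc_nat n : nc (n%:R : R[i]) = n%:R.
Proof.
have -> : (n%:R : R[i]) = ((n%:R)%:C)%C by rewrite rmorph_nat.
by rewrite nc_real normr_nat.
Qed.

Lemma nc_i : nc ('i)%C = 1 :> R.
Proof. by rewrite nc_def /= expr0n expr1n add0r sqrtr1. Qed.

Lemma nc_conj x : nc (x^*)%C = nc x.
Proof. by case: x => a b; rewrite /= sqrrN. Qed.

Lemma nc_sum (I : Type) (r : seq I) (F : I -> R[i]) :
  nc (\sum_(i <- r) F i) <= \sum_(i <- r) nc (F i).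
Proof.
elim: r => [|i r ih]; first by rewrite !big_nil nc0.
by rewrite !big_cons (le_trans (ncD _ _))// lerD.
Qed.

Lemma nc_ge_Re x : `|complex.Re x| <= nc x.
Proof. by rewrite nc_def -sqrtr_sqr ler_wsqrtr// lerDl sqr_ge0. Qed.

Lemma nc_ge_Im x : `|complex.Im x| <= nc x.
Proof. by rewrite nc_def -sqrtr_sqr ler_wsqrtr// lerDr sqr_ge0. Qed.

Lemma nc_le_ReIm x : nc x <= `|complex.Re x| + `|complex.Im x|.
Proof.
rewrite -ler_sqr ?nnegrE ?nc_ge0 ?addr_ge0// nc_sqr.
rewrite -(real_normK (num_real (complex.Re x))) -(real_normK (num_real (complex.Im x))).
have := normr_ge0 (complex.Re x); have := normr_ge0 (complex.Im x); nra.
Qed.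

Lemma nc_tri_sub x y : `|nc x - nc y| <= nc (x - y).
Proof.
rewrite ler_norml; apply/andP; split.
  have := ncD (y - x) x; rewrite subrK (nc_distC x); lra.
have := ncD (x - y) y; rewrite subrK; lra.
Qed.

Lemma Re_mulconj x : complex.Re (x * (x^*)%C) = nc x ^+ 2.
Proof. by case: x => a b; rewrite nc_sqr /=; ring. Qed.

Lemma to0_complete_real (x : nat -> R) (e : nat -> R) : to0 e ->
  (forall m n, (m <= n)%N -> `|x n - x m| <= e m) ->
  exists y : R, to0 (fun n => `|x n - y|).
Proof.
move=> e0 h; suff /cvg_ex[l hl] : cvgn x by exists l; exact: cvg_to0.
apply/cauchy_cvgP/cauchyP => eps eps0.
have [N hN] := e0 _ (divr_gt0 eps0 (ltr0n R 2)).
exists (x N); exists N => // n /= Nn; rewrite /ball /= distrC.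
rewrite (le_lt_trans (h _ _ Nn))// (le_lt_trans (hN _ (leqnn _)))//; lra.
Qed.

(** The Cauchy rate [e] survives in the limit, so estimates of tails come with the limit itself. *)
Lemma to0_complete (x : nat -> R[i]) (e : nat -> R) : to0 e ->
  (forall m n, (m <= n)%N -> nc (x n - x m) <= e m) ->
  exists y, forall m, nc (x m - y) <= e m.
Proof.
move=> e0 h.
have [|a ha] := @to0_complete_real (fun n => complex.Re (x n)) e e0.
  move=> m n mn; apply: le_trans (h _ _ mn); apply: le_trans (nc_ge_Re _).
  by rewrite raddfB.
have [|b hb] := @to0_complete_real (fun n => complex.Im (x n)) e e0.
  move=> m n mn; apply: le_trans (h _ _ mn); apply: le_trans (nc_ge_Im _).
  by rewrite raddfB.
exists (a +i* b)%C => m; rewrite -subr_le0; apply: to0_const.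
apply: (@to0_eventually _ _ _ m) (to0D ha hb) => n mn; rewrite lerBlDr.
have -> : x m - (a +i* b)%C = (x m - x n) + (x n - (a +i* b)%C) by rewrite addrA subrK.
apply: (le_trans (ncD _ _)); rewrite addrC lerD// -?(nc_distC (x n)) ?h//.
by apply: (le_trans (nc_le_ReIm _)); rewrite !raddfB.
Qed.

Lemma nc_lim_unique (x : nat -> R[i]) y y' : to0 (fun n => nc (x n - y)) ->
  to0 (fun n => nc (x n - y')) -> y = y'.
Proof.
move=> h h'; apply/eqP; rewrite -subr_eq0; apply/eqP/nc_eq0/eqP.
rewrite eq_le nc_ge0 andbT; apply: to0_const.
apply: to0_le (to0D h h') => n.
have -> : y - y' = - (x n - y) + (x n - y') by rewrite opprB addrA subrK.
by rewrite (le_trans (ncD _ _))// ncN.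
Qed.

End complex_norm.

Section l2_bounds.
Context {R : realType} {T : choiceType}.
Implicit Types (x y : T -> R) (A : seq T).

Lemma sum_cauchy_schwarz (I : Type) (A : seq I) (x y : I -> R) :
  (\sum_(i <- A) x i * y i) ^+ 2 <=
  (\sum_(i <- A) x i ^+ 2) * (\sum_(i <- A) y i ^+ 2).
Proof.
elim: A => [|i A ih]; first by rewrite !big_nil expr0n mul0r.
rewrite !big_cons; set S := BIG_F in ih *.
move: ih; set s := \sum_(j <- A) _; set X := \sum_(j <- A) _; set Y := \sum_(j <- A) _.
move=> ih.
have X0 : 0 <= X by apply: sumr_ge0 => *; exact: sqr_ge0.
have Y0 : 0 <= Y by apply: sumr_ge0 => *; exact: sqr_ge0.
(* By induction s^2 <= X Y, so the square of the left side is at most 4 (X y^2) (Y x^2), hence at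
   most the square of the right side. *)
have k : 2 * s * (x i * y i) <= X * y i ^+ 2 + Y * x i ^+ 2.
  have p : 0 <= X * y i ^+ 2 + Y * x i ^+ 2.
    by rewrite addr_ge0// mulr_ge0// sqr_ge0.
  suff : (2 * s * (x i * y i)) ^+ 2 <= (X * y i ^+ 2 + Y * x i ^+ 2) ^+ 2 by nra.
  have := ler_wpM2l (sqr_ge0 (x i * y i)) ih.
  have := sqr_ge0 (X * y i ^+ 2 - Y * x i ^+ 2).
  rewrite !exprMn; nra.
nra.
Qed.

(** Square summability stated through finite duplicate-free sums, so that no infinite sum or limit
    is involved; [B] bounds the l^2 norm. *)
Definition l2b x (B : R) := 0 <= B /\
  forall A, uniq A -> \sum_(k <- A) x k ^+ 2 <= B ^+ 2.

Lemma l2b_le x B B' : l2b x B -> B <= B' -> l2b x B'.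
Proof.
move=> [B0 h] BB; split; first exact: le_trans BB.
move=> A uA; apply: le_trans (h _ uA) _; nra.
Qed.

Lemma sum_cs_le (A : seq T) x y B B' : 0 <= B -> 0 <= B' ->
  \sum_(k <- A) x k ^+ 2 <= B ^+ 2 -> \sum_(k <- A) y k ^+ 2 <= B' ^+ 2 ->
  \sum_(k <- A) x k * y k <= B * B'.
Proof.
move=> B0 B0' h h'; have := sum_cauchy_schwarz A x y.
have X0 : 0 <= \sum_(k <- A) x k ^+ 2 by apply: sumr_ge0 => *; exact: sqr_ge0.
have Y0 : 0 <= \sum_(k <- A) y k ^+ 2 by apply: sumr_ge0 => *; exact: sqr_ge0.
move=> /le_trans/(_ (ler_pM X0 Y0 h h')); rewrite -exprMn => k.
by have := mulr_ge0 B0 B0'; nra.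
Qed.

Lemma l2bD x y B B' : l2b x B -> l2b y B' -> l2b (fun k => x k + y k) (B + B').
Proof.
move=> [B0 h] [B0' h']; split; first exact: addr_ge0.
move=> A uA; have := sum_cs_le B0 B0' (h _ uA) (h' _ uA).
have -> : \sum_(k <- A) (x k + y k) ^+ 2 = \sum_(k <- A) x k ^+ 2 +
    2 * (\sum_(k <- A) x k * y k) + \sum_(k <- A) y k ^+ 2.
  by rewrite mulr_sumr -!big_split; apply: eq_bigr => k _ /=; ring.
by have := h _ uA; have := h' _ uA; nra.
Qed.

Lemma l2b_mono x y B : (forall k, `|x k| <= `|y k|) -> l2b y B -> l2b x B.
Proof.
move=> xy [B0 h]; split=> // A uA; apply: le_trans (h _ uA).
apply: ler_sum => k _; rewrite -(real_normK (num_real (x k))).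
by rewrite -(real_normK (num_real (y k))) ler_sqr ?nnegrE.
Qed.

Lemma l2bZ c x B : l2b x B -> l2b (fun k => c * x k) (`|c| * B).
Proof.
move=> [B0 h]; split; first by rewrite mulr_ge0.
move=> A uA; under eq_bigr do rewrite exprMn.
by rewrite -mulr_sumr exprMn real_normK ?num_real// ler_wpM2l ?sqr_ge0 ?h.
Qed.

Lemma l2b0 : l2b (fun=> 0) 0.
Proof. by split=> // A _; rewrite big1// => k _; rewrite expr0n. Qed.

Lemma l2b_inj x B (h : T -> T) : injective h -> l2b x B -> l2b (x \o h) B.
Proof.
move=> ih [B0 hB]; split=> // A uA.
have := hB (map h A); rewrite map_inj_uniq// => /(_ uA).
by rewrite big_map.
Qed.

Lemma l2b_pt x B k : l2b x B -> `|x k| <= B.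
Proof.
move=> [B0 /(_ [:: k] isT)]; rewrite big_seq1 -(real_normK (num_real (x k))).
by rewrite ler_sqr ?nnegrE.
Qed.

Lemma l2b_fatou (xn : nat -> T -> R) x (Bn : nat -> R) B :
  (forall k, to0 (fun n => `|xn n k - x k|)) -> (forall n, l2b (xn n) (Bn n)) ->
  to0 (fun n => Bn n - B) -> 0 <= B -> l2b x B.
Proof.
move=> hx hB hb B0; split=> // A uA.
(* [to0] is one-sided, so only the positive part of [Bn n - B] is controlled. *)
pose e n := Num.max 0 (Bn n - B).
have ge0 n : 0 <= e n by rewrite le_max lexx.
have e0 : to0 e.
  move=> eps eps0; have [N hN] := hb _ eps0; exists N => n /hN h.
  by rewrite ge_max (ltW eps0).
have h2 k : to0 (fun n => `|xn n k ^+ 2 - x k ^+ 2|).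
  by apply: cvg_to0; apply: cvgM; apply: to0_cvgP.
rewrite -subr_le0; apply: to0_const.
apply: to0_le (to0D (to0_sum A h2) (to0D (to0Z B0 e0) (to0D (to0Z B0 e0) (to0_sqr ge0 e0)))) => n.
have [Bn0 /(_ A uA) hn] := hB n.
have h3 : \sum_(k <- A) x k ^+ 2 - \sum_(k <- A) xn n k ^+ 2 <= \sum_(k <- A) `|xn n k ^+ 2 - x k ^+ 2|.
  rewrite -sumrB; apply: ler_sum => k _; rewrite distrC; exact: ler_norm.
have h4 : Bn n <= B + e n by rewrite -lerBlDl le_max lexx orbT.
have := ge0 n; nra.
Qed.

End l2_bounds.

(** * Weights on the lattice *)

Section lattice_weights.
Context {R : realType} {d : nat}.
Local Notation Z := 'rV[int]_d.
Implicit Types (k l p q : Z) (r s : R).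

Definition l1 k : nat := (\sum_j `|k (0:'I_1)%R j|)%N.

(** Measures the size of a shift: comparable to [bracket], but submultiplicative without a constant,
    which [bracket] is not. *)
Definition om k : R := (l1 k).+1%:R.

Lemma l1D k (m : Z) : (l1 (k + m)%R <= l1 k + l1 m)%N.
Proof.
rewrite /l1 -big_split; apply: leq_sum => j _; rewrite mxE.
by move: (k 0 j) (m 0 j) => a b /=; lia.
Qed.

Lemma l1N k : l1 (- k) = l1 k.
Proof. by apply: eq_bigr => j _; rewrite mxE; move: (k 0 j) => a; lia. Qed.

Lemma om_ge1 k : 1 <= om k. Proof. by rewrite ler1n. Qed.

Lemma om_gt0 k : 0 < om k. Proof. by rewrite ltr0n. Qed.

Lemma omN k : om (- k) = om k. Proof. by rewrite /om l1N. Qed.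

Lemma omD k (m : Z) : om (k + m) <= om k * om m.
Proof. by rewrite /om -natrM ler_nat; have := l1D k m; nia. Qed.

Lemma sqnormk_ge0 k : 0 <= sqnormk k :> R.
Proof. by apply: sumr_ge0 => j _; exact: sqr_ge0. Qed.

Lemma bracket_sqr k : bracket k ^+ 2 = 1 + sqnormk k :> R.
Proof. by rewrite sqr_sqrtr// addr_ge0// sqnormk_ge0. Qed.

Lemma bracket_ge1 k : 1 <= bracket k :> R.
Proof. by rewrite -[leLHS]sqrtr1 ler_wsqrtr// lerDl sqnormk_ge0. Qed.

Lemma bracket_gt0 k : 0 < bracket k :> R.
Proof. exact: lt_le_trans (bracket_ge1 k). Qed.

Lemma l1E k : (l1 k)%:R = \sum_j `|(k 0 j)%:~R| :> R.
Proof.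
rewrite /l1 natr_sum; apply: eq_bigr => j _.
by rewrite -intr_norm natr_absz.
Qed.

Lemma sqnormk_l1 k : sqnormk k <= (l1 k)%:R ^+ 2 :> R.
Proof.
rewrite l1E /sqnormk.
have : forall s : seq 'I_d, \sum_(j <- s) (k 0 j)%:~R ^+ 2 <=
    (\sum_(j <- s) `|(k 0 j)%:~R|) ^+ 2 :> R.
  elim=> [|j s ih]; first by rewrite !big_nil expr0n.
  rewrite !big_cons; have : 0 <= \sum_(k0 <- s) `|(k 0 k0)%:~R| :> R by apply: sumr_ge0.
  rewrite -[X in X + _](real_normK (num_real _)).
  have := normr_ge0 ((k 0 j)%:~R : R); nra.
exact.
Qed.

Lemma coord_sqr_le k j : (k 0 j)%:~R ^+ 2 <= sqnormk k :> R.
Proof.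
by rewrite /sqnormk (bigD1 j)//= lerDl sumr_ge0// => i _; exact: sqr_ge0.
Qed.

Lemma coord_le_bracket k j : `|(k 0 j)%:~R| <= bracket k :> R.
Proof.
rewrite -ler_sqr ?nnegrE ?(ltW (bracket_gt0 k))// bracket_sqr real_normK ?num_real//.
by apply: le_trans (coord_sqr_le k j) _; lra.
Qed.

(** The mixed products 2 k_j m_j are at most |m_j| (1 + k_j^2), whose sum is at most |m|_1 (1 +
    |k|^2). *)
Lemma bracketD k (m : Z) : bracket (k + m) <= om m * bracket k :> R.
Proof.
rewrite -ler_sqr ?nnegrE ?mulr_ge0 ?(ltW (bracket_gt0 _)) ?(ltW (om_gt0 _))//.
rewrite exprMn !bracket_sqr.
have -> : sqnormk (k + m) = sqnormk k + sqnormk m + \sum_j 2 * (k 0 j)%:~R * (m 0 j)%:~R :> R.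
  rewrite /sqnormk -!big_split; apply: eq_bigr => j _ /=.
  by rewrite mxE intrD; ring.
have : \sum_j 2 * (k 0 j)%:~R * (m 0 j)%:~R <= (l1 m)%:R * (1 + sqnormk k) :> R.
  rewrite l1E mulr_suml; apply: ler_sum => j _.
  have := coord_sqr_le k j; set a := (k 0 j)%:~R; set b := (m 0 j)%:~R => ha.
  have h1 : 2 * a * b <= `|b| * (1 + a ^+ 2).
    apply: le_trans (_ : 2 * `|a| * `|b| <= _).
      by rewrite -!mulrA ler_wpM2l// -normrM ler_norm.
    rewrite mulrC ler_wpM2l// -(real_normK (num_real a)).
    by have := sqr_ge0 (1 - `|a|); lra.
  by apply: le_trans h1 _; rewrite ler_wpM2l// lerD2l.
have := sqnormk_l1 m; have := sqnormk_ge0 k.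
rewrite /om -natr1; have := ler0n R (l1 m); nra.
Qed.

Definition wt r k : R := bracket k `^ r.

Lemma wt_gt0 r k : 0 < wt r k. Proof. by rewrite powR_gt0// bracket_gt0. Qed.

Lemma wt_ge0 r k : 0 <= wt r k. Proof. exact: powR_ge0. Qed.

Lemma wt0 k : wt 0 k = 1. Proof. by rewrite /wt powRr0. Qed.

Lemma wt1 k : wt 1 k = bracket k.
Proof. by rewrite /wt powRr1// ltW// bracket_gt0. Qed.

Lemma wtD r s k : wt (r + s) k = wt r k * wt s k.
Proof.
by rewrite /wt powRD//; apply/implyP => _; rewrite gt_eqF// bracket_gt0.
Qed.

Lemma wt_le r s k : r <= s -> wt r k <= wt s k.
Proof. by move=> rs; apply: ler_powR => //; exact: bracket_ge1. Qed.

Lemma wt_ge1 r k : 0 <= r -> 1 <= wt r k.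
Proof. by move=> r0; rewrite -(wt0 k) wt_le. Qed.

Lemma wt_sqr r k : wt r k ^+ 2 = (1 + sqnormk k) `^ r.
Proof.
rewrite /wt /bracket -powR12_sqrt ?addr_ge0 ?sqnormk_ge0// -powRrM.
by rewrite -powR_mulrn ?powR_ge0// -powRrM mulrAC mulVf ?mul1r// pnatr_eq0.
Qed.

Lemma wt_nat n k : wt n%:R k = bracket k ^+ n.
Proof. by rewrite /wt powR_mulrn// ltW// bracket_gt0. Qed.

Lemma bracket_le_om k : bracket k <= om k :> R.
Proof.
have := bracketD 0 k; rewrite add0r /bracket /sqnormk => /le_trans; apply.
by rewrite big1 ?addr0 ?sqrtr1 ?mulr1// => j _; rewrite mxE expr0n.
Qed.

Lemma om_le_bracket k : om k <= (d.+1)%:R * bracket k.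
Proof.
rewrite /om -natr1 l1E addrC -natr1 mulrDl mul1r addrC lerD ?bracket_ge1//.
rewrite mulr_natl; apply: le_trans (_ : \sum_(j < d) bracket k <= _).
  by apply: ler_sum => j _; exact: coord_le_bracket.
by rewrite big_const_ord iter_addr_0.
Qed.

(** Peetre's inequality. For negative [r] it is [bracketD] used from [k + m] back to [k]. The
    exponent |r| is rounded up to an integer [M], so that later weights are integer powers of
    [om]. *)
Lemma wt_peetre r (M : nat) k (m : Z) : `|r| <= M%:R ->
  wt r (k + m) <= om m ^+ M * wt r k.
Proof.
move=> rM; have omM : om m `^ `|r| <= om m ^+ M.
  rewrite -powR_mulrn ?(ltW (om_gt0 _))//; apply: ler_powR => //; exact: om_ge1.
apply: le_trans (_ : om m `^ `|r| * wt r k <= _); last by rewrite ler_wpM2r// wt_ge0.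
rewrite /wt; have [r0|r0] := leP 0 r.
  rewrite (ger0_norm r0) -powRM ?(ltW (bracket_gt0 _)) ?(ltW (om_gt0 _))//.
  by apply: ge0_ler_powR => //; rewrite ?nnegrE ?mulr_ge0 ?(ltW (bracket_gt0 _)) ?(ltW (om_gt0 _)) ?bracketD.
rewrite (ltr0_norm r0) -[X in bracket _ `^ X]opprK -[X in _ * bracket _ `^ X]opprK.
set t := - r; have t0 : 0 <= t by rewrite /t oppr_ge0 ltW.
have h : bracket k `^ t <= om m `^ t * bracket (k + m) `^ t.
  rewrite -powRM ?(ltW (bracket_gt0 _)) ?(ltW (om_gt0 _))//.
  apply: ge0_ler_powR => //; rewrite ?nnegrE ?mulr_ge0 ?(ltW (bracket_gt0 _)) ?(ltW (om_gt0 _))//.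
  by have := bracketD (k + m) (- m); rewrite addrK omN.
clearbody t; rewrite !powRN ler_pdivlMr ?powR_gt0 ?bracket_gt0// mulrC.
by rewrite ler_pdivrMr ?powR_gt0 ?bracket_gt0.
Qed.

Definition box (n : nat) : seq Z :=
  [seq \row_j ((f j : nat)%:Z - n%:Z) | f : {ffun 'I_d -> 'I_(n + n).+1}].

Lemma mem_box n k : (k \in box n) = [forall j, (`|k 0%R j|%N <= n)%N].
Proof.
apply/mapP/forallP => [[f _ -> j]|h].
  rewrite mxE; move: (f j) => [a /= ha]; lia.
have hb j : (absz (k 0 j + n%:Z)%R < (n + n).+1)%N by have := h j; move: (k 0 j) => a; lia.
exists [ffun j => Ordinal (hb j)]; first by rewrite mem_enum.
by apply/rowP => j; rewrite mxE ffunE /=; have := h j; move: (k 0 j) => a; lia.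
Qed.

Lemma uniq_box n : uniq (box n).
Proof.
rewrite map_inj_uniq ?enum_uniq// => f g /rowP fg.
apply/ffunP => j; apply/val_inj => /=; have := fg j; rewrite !mxE; lia.
Qed.

Lemma box_le (m n : nat) k : (m <= n)%N -> k \in box m -> k \in box n.
Proof.
move=> mn; rewrite !mem_box => /forallP h; apply/forallP => j.
exact: leq_trans (h j) mn.
Qed.

Lemma box_l1 k : k \in box (l1 k).
Proof.
by rewrite mem_box; apply/forallP => j; rewrite /l1 (bigD1 j)//= leq_addr.
Qed.

Lemma boxN n k : (- k \in box n) = (k \in box n).
Proof.
by rewrite !mem_box; apply: eq_forallb => j; rewrite mxE; move: (k 0 j) => a; congr (_ <= _)%N; lia.
Qed.

Lemma boxD (m n : nat) k p : k \in box m -> p \in box n -> k + p \in box (m + n).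
Proof.
rewrite !mem_box => /forallP h /forallP h'; apply/forallP => j.
by rewrite mxE; have := h j; have := h' j; move: (k 0 j) (p 0 j) => a b; lia.
Qed.

Lemma seq_sub_box (A : seq Z) : exists n, {subset A <= box n}.
Proof.
elim: A => [|k A [n ih]]; first by exists 0%N.
exists (maxn (l1 k) n) => p; rewrite inE => /orP[/eqP ->|/ih].
  by apply: box_le (box_l1 k); exact: leq_maxl.
by apply: box_le; exact: leq_maxr.
Qed.

Lemma ler_sum_sub (A B : seq Z) (w : Z -> R) : uniq A -> uniq B ->
  {subset A <= B} -> (forall k, 0 <= w k) ->
  \sum_(k <- A) w k <= \sum_(k <- B) w k.
Proof.
move=> uA uB AB w0.
rewrite [leRHS](bigID (fun k => k \in A))/= -[X in _ <= X + _]big_filter.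
rewrite (@perm_big _ _ _ _ A [seq k <- B | k \in A]); last first.
  apply: uniq_perm => //; rewrite ?filter_uniq// => k; rewrite mem_filter.
  by case: (boolP (k \in A)) => // kA; rewrite AB.
by rewrite lerDl sumr_ge0.
Qed.

Lemma sum_box_diff (V : zmodType) (m n : nat) (F : Z -> V) : (m <= n)%N ->
  \sum_(k <- box n) F k - \sum_(k <- box m) F k =
  \sum_(k <- box n | k \notin box m) F k.
Proof.
move=> mn; rewrite (bigID (fun k => k \in box m))/= -big_filter.
rewrite (perm_big (box m)); last first.
  apply: uniq_perm; rewrite ?filter_uniq ?uniq_box// => k; rewrite mem_filter.
  by case: (boolP (k \in box m)) => // /(box_le mn) ->.
by rewrite [X in X - _]addrC addrK.
Qed.

(** Tested on boxes only; every finite set lies in a box, see [summ_seq]. *)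
Definition summ (w : Z -> R) (S : R) := [/\ 0 <= S, forall k, 0 <= w k &
  forall n, \sum_(k <- box n) w k <= S].

Lemma summ_seq w S A : summ w S -> uniq A -> \sum_(k <- A) w k <= S.
Proof.
move=> [S0 w0 h] uA; have [n An] := seq_sub_box A.
apply: le_trans (h n); apply: ler_sum_sub => //; exact: uniq_box.
Qed.

(** The tail is the gap between the box sums and their limit. It bounds all finite sums off the box
    at once, which later gives convergence of truncations in operator norm. *)
Lemma summ_tail w S : summ w S ->
  exists e : nat -> R, [/\ to0 e, forall n, 0 <= e n &
    forall n A, uniq A -> (forall k, k \in A -> k \notin box n) ->
      \sum_(k <- A) w k <= e n].
Proof.
move=> [S0 w0 h]; pose u n := \sum_(k <- box n) w k.
have mu : {homo u : n m / (n <= m)%N >-> n <= m}.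
  move=> m n mn; apply: ler_sum_sub => //; rewrite ?uniq_box// => k.
  exact: box_le.
have cu : cvgn u.
  by apply: nondecreasing_is_cvgn => //; exists S => _ [n _ <-]; exact: h.
have uL n : u n <= limn u by exact: nondecreasing_cvgn_le.
exists (fun n => limn u - u n); split.
- apply: to0_le (cvg_to0 cu) => n; rewrite distrC; exact: ler_norm.
- by move=> n; rewrite subr_ge0.
- move=> n A uA hA; rewrite lerBrDr.
  have [m hm] := seq_sub_box (A ++ box n).
  apply: le_trans (uL m); rewrite /u -big_cat/=.
  apply: ler_sum_sub => //; last exact: uniq_box.
  rewrite cat_uniq uA uniq_box andbT /=; apply/hasPn => k.
  by apply: contraL; exact: hA.
Qed.

(** Since 1 + k_j^2 <= <k>^2 for each j, the weight is at most the product of the 1 / (1 + k_j^2),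
    and the sum of that product over a box factors into one-dimensional sums. *)
Lemma summ_inv_bracket : exists S, summ (fun k => bracket k ^- (2 * d)) S.
Proof.
pose F (a : int) : R := (1 + a%:~R ^+ 2)^-1.
(* Telescoping with 1 / (1 + a^2) <= 2 / (a (a + 1)) = 2 / a - 2 / (a + 1). *)
have half (n : nat) : \sum_(i < n) F i.+1%:Z <= 2 - 2 / n.+1%:R :> R.
  elim: n => [|n ih]; first by rewrite big_ord0 divr1 subrr.
  rewrite big_ord_recr/=; apply: le_trans (lerD ih (lexx _)) _.
  have a0 : 1 <= n.+1%:R :> R by rewrite ler1n.
  rewrite /F -[n.+2%:R]natr1; change (n.+1%:Z%:~R : R) with (n.+1%:R : R).
  move: (n.+1%:R : R) a0 => a a0.
  suff : (1 + a ^+ 2)^-1 <= 2 / a - 2 / (a + 1) by lra.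
  have -> : 2 / a - 2 / (a + 1) = 2 / (a * (a + 1)).
    by field; rewrite !gt_eqF//; lra.
  rewrite ler_pdivlMr; last by nra.
  by rewrite mulrC ler_pdivrMr; nra.
have half' (n : nat) : \sum_(i < n) F i.+1%:Z <= 2.
  by apply: (le_trans (half n)); rewrite gerBl divr_ge0.
(* 5 = 2 + 1 + 2, for the negative integers, 0 and the positive ones. *)
have key (n : nat) : \sum_(i < (n + n).+1) F ((i : nat)%:Z - n%:Z) <= 5.
  rewrite -(big_mkord xpredT (fun i => F (i%:Z - n%:Z))).
  rewrite (@big_cat_nat _ _ _ n)//=; last by lia.
  rewrite [X in _ + X]big_ltn; last by lia.
  rewrite [X in X + _](_ : _ = \sum_(i < n) F i.+1%:Z); last first.
    rewrite big_nat_rev/= add0n big_mkord; apply: eq_bigr => -[i hi] _ /=.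
    rewrite /F -sqrrN -intrN; congr (1 + _%:~R ^+ 2)^-1; lia.
  rewrite [X in _ + (_ + X)](_ : _ = \sum_(i < n) F i.+1%:Z); last first.
    have -> : (n + n).+1 = (n + n.+1)%N by lia.
    rewrite -{1}(add0n n.+1) big_addn.
    have -> : (n + n.+1 - n.+1)%N = n by lia.
    rewrite big_mkord; apply: eq_bigr => -[i hi] _ /=.
    rewrite /F; congr (1 + _%:~R ^+ 2)^-1; lia.
  have -> : F (n%:Z - n%:Z) = 1 by rewrite /F subrr expr0n addr0 invr1.
  by have := half' n; lra.
exists (5 ^+ d); split => [|k|n].
- exact: exprn_ge0.
- by rewrite invr_ge0 exprn_ge0// ltW// bracket_gt0.
rewrite /box big_map big_enum/=.
apply: le_trans (_ : \sum_(f : {ffun 'I_d -> 'I_(n + n).+1}) \prod_j F ((f j : nat)%:Z - n%:Z) <= _).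
  apply: ler_sum => f _; rewrite exprM bracket_sqr -exprVn.
  rewrite -[d in _ ^+ d]card_ord -prodr_const.
  apply: ler_prod => j _; rewrite invr_ge0 addr_ge0 ?sqnormk_ge0//=.
  rewrite /F lef_pV2 ?posrE ?ltr_pwDl ?sqr_ge0 ?sqnormk_ge0// lerD2l.
  by apply: le_trans (coord_sqr_le _ j); rewrite mxE.
rewrite -(bigA_distr_bigA (fun (j : 'I_d) (i : 'I_(n + n).+1) => F ((i : nat)%:Z - n%:Z))).
rewrite -[d in leRHS]card_ord -prodr_const; apply: ler_prod => j _.
rewrite key andbT sumr_ge0// => i _.
by rewrite invr_ge0 addr_ge0// sqr_ge0.
Qed.

End lattice_weights.

(** * Convolution operators on weighted sequences *)

Section weighted_l2.
Context {R : realType} {d : nat}.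
Local Notation Z := 'rV[int]_d.
Local Notation C := R[i].
Implicit Types (k l p q : Z) (r s : R) (g h : Z -> C).

(* A function with Fourier coefficients [g] has H^r norm at most [B]. *)
Definition Hb r g (B : R) := l2b (fun k => wt r k * nc (g k)) B.

Lemma Hb_ge0 r g B : Hb r g B -> 0 <= B. Proof. by case. Qed.

Lemma Hb_le r g B B' : Hb r g B -> B <= B' -> Hb r g B'.
Proof. exact: l2b_le. Qed.

Lemma Hb_dom r r' g h B :
  (forall k, wt r k * nc (g k) <= wt r' k * nc (h k)) -> Hb r' h B -> Hb r g B.
Proof.
move=> gh; apply: l2b_mono => k.
by rewrite !ger0_norm ?mulr_ge0 ?wt_ge0 ?nc_ge0.
Qed.

Lemma Hb_eq r g h B : (forall k, g k = h k) -> Hb r g B -> Hb r h B.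
Proof. by move=> gh; apply: Hb_dom => k; rewrite gh. Qed.

Lemma Hb_mono r r' g B : r <= r' -> Hb r' g B -> Hb r g B.
Proof. by move=> rr; apply: Hb_dom => k; rewrite ler_wpM2r ?nc_ge0 ?wt_le. Qed.

Lemma HbD r g h B B' : Hb r g B -> Hb r h B' -> Hb r (fun k => g k + h k) (B + B').
Proof.
move=> hg hh; apply: l2b_mono (l2bD hg hh) => k; rewrite -mulrDr.
rewrite !ger0_norm ?mulr_ge0 ?addr_ge0 ?wt_ge0 ?nc_ge0//.
by rewrite ler_wpM2l ?wt_ge0 ?ncD.
Qed.

Lemma HbN r g B : Hb r g B -> Hb r (fun k => - g k) B.
Proof. by apply: Hb_dom => k; rewrite ncN. Qed.

Lemma Hb0 r : Hb r (fun=> 0) 0.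
Proof. by apply: l2b_mono (l2b0) => k; rewrite nc0 mulr0. Qed.

Lemma Hb_sum (I : Type) (A : seq I) r (G : I -> Z -> C) (B : I -> R) :
  (forall i, Hb r (G i) (B i)) ->
  Hb r (fun k => \sum_(i <- A) G i k) (\sum_(i <- A) B i).
Proof.
move=> h; elim: A => [|i A ih].
  by rewrite big_nil; apply: Hb_eq (Hb0 r) => k; rewrite big_nil.
by rewrite big_cons; apply: Hb_eq (HbD (h i) ih) => k; rewrite big_cons.
Qed.

(** One tail serves every [h] dominated by [g] and vanishing on the box, such as [g] minus its
    restriction to any set containing the box. *)
Lemma Hb_tail r g B : Hb r g B -> exists e : nat -> R, [/\ to0 e, forall n, 0 <= e n &
  forall n h, (forall k, k \in box n -> h k = 0) -> (forall k, nc (h k) <= nc (g k)) ->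
    Hb r h (e n)].
Proof.
move=> [B0 hB].
have [|e [e0 ge0 he]] := @summ_tail _ _ (fun k => (wt r k * nc (g k)) ^+ 2) (B ^+ 2).
  by split=> [|k|n]; [exact: sqr_ge0|exact: sqr_ge0|exact: hB (uniq_box n)].
exists (fun n => Num.sqrt (e n)); split=> [|n|n h h0 hg]; [|exact: sqrtr_ge0|].
  apply: to0_sqrP => [n|]; first exact: sqrtr_ge0.
  by apply: to0_le e0 => n; rewrite sqr_sqrtr.
split=> [|A uA]; first exact: sqrtr_ge0.
rewrite sqr_sqrtr//.
apply: (le_trans _ (he n [seq k <- A | k \notin box n] (filter_uniq _ uA) _)); last first.
  by move=> k; rewrite mem_filter => /andP[].
rewrite big_filter (bigID (fun k => k \notin box n)) -[leRHS]addr0 lerD//.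
  apply: ler_sum => k _; rewrite ler_sqr ?nnegrE ?mulr_ge0 ?wt_ge0 ?nc_ge0//.
  by rewrite ler_wpM2l ?wt_ge0.
by rewrite big1// => k; rewrite negbK => /andP[_ /h0 ->]; rewrite nc0 mulr0 expr0n.
Qed.

Lemma Hb_fatou r (gn : nat -> Z -> C) g Bn B :
  (forall k, to0 (fun n => nc (gn n k - g k))) -> (forall n, Hb r (gn n) (Bn n)) ->
  to0 (fun n => Bn n - B) -> 0 <= B -> Hb r g B.
Proof.
move=> h hb hB B0.
apply: (@l2b_fatou _ _ (fun n k => wt r k * nc (gn n k)) _ Bn) => // k.
apply: to0_le (to0Z (wt_ge0 r k) (h k)) => n.
rewrite -mulrBr normrM ger0_norm ?wt_ge0// ler_wpM2l ?wt_ge0//.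
exact: nc_tri_sub.
Qed.

Lemma Hb_pt r g B k : Hb r g B -> wt r k * nc (g k) <= B.
Proof.
by move=> /(l2b_pt k); rewrite ger0_norm// mulr_ge0 ?wt_ge0 ?nc_ge0.
Qed.

(** The translation by [p] costs [om p ^+ M] by Peetre's inequality, and the coefficient costs [s]
    derivatives. *)
Lemma Hb_shift r s (M : nat) (b : Z -> C) c p g B : 0 <= c -> `|r| <= M%:R ->
  (forall l, nc (b l) <= c * wt s l) -> Hb (r + s) g B ->
  Hb r (fun k => b (k - p) * g (k - p)) (c * om p ^+ M * B).
Proof.
move=> c0 rM hb hg.
have := l2bZ (c * om p ^+ M) (l2b_inj (h := fun k => k - p) (addIr _) hg).
rewrite ger0_norm; last by rewrite mulr_ge0// exprn_ge0// ltW// om_gt0.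
apply: l2b_mono => k /=.
rewrite !ger0_norm; last 2 first.
  by rewrite !mulr_ge0 ?exprn_ge0 ?wt_ge0 ?nc_ge0// ltW ?om_gt0.
  by rewrite mulr_ge0 ?wt_ge0 ?nc_ge0.
have := wt_peetre (k - p) p rM; rewrite subrK => hw.
rewrite ncM wtD.
apply: le_trans (_ : om p ^+ M * wt r (k - p) * (c * wt s (k - p)) * nc (g (k - p)) <= _).
  by rewrite [leLHS]mulrA ler_wpM2r ?nc_ge0// ler_pM ?wt_ge0 ?nc_ge0.
by rewrite le_eqVlt; apply/orP; left; apply/eqP; ring.
Qed.

(* [b i l] is the coefficient with which the [i]-th term moves frequency [l] to
   [l + sh i]. *)
Definition opI (I : Type) (sh : I -> Z) (b : I -> Z -> C) (A : seq I) g : Z -> C :=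
  fun k => \sum_(i <- A) b i (k - sh i) * g (k - sh i).

(** Triangle inequality over the terms: a weighted l^1 sum of the coefficient bounds controls the
    norm from H^(r+s) to H^r, whatever the finite list [A]. *)
Lemma Hb_opI (I : Type) (sh : I -> Z) (b : I -> Z -> C) (A : seq I) r s (M : nat)
    (c : I -> R) g B S : (forall i, 0 <= c i) -> `|r| <= M%:R ->
  (forall i l, nc (b i l) <= c i * wt s l) ->
  \sum_(i <- A) c i * om (sh i) ^+ M <= S -> Hb (r + s) g B ->
  Hb r (opI sh b A g) (S * B).
Proof.
move=> c0 rM hb hS hg; apply: Hb_le (ler_wpM2r (Hb_ge0 hg) hS).
rewrite mulr_suml; apply: Hb_sum => i; exact: Hb_shift hg.
Qed.

Lemma opIB (I : Type) (sh : I -> Z) (b : I -> Z -> C) (A : seq I) g h k :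
  opI sh b A (fun k => g k - h k) k = opI sh b A g k - opI sh b A h k.
Proof. by rewrite /opI -sumrB; apply: eq_bigr => i _; rewrite mulrBr. Qed.

Lemma opID (I : Type) (sh : I -> Z) (b : I -> Z -> C) (A : seq I) g h k :
  opI sh b A (fun k => g k + h k) k = opI sh b A g k + opI sh b A h k.
Proof. by rewrite /opI -big_split; apply: eq_bigr => i _; rewrite mulrDr. Qed.

(** Both compositions move [l] to l + sh i + sh' j, so the commutator is again an [opI], indexed by
    pairs, and cancellations can be sought pair by pair in its coefficients. *)
Lemma opI_comm (I J : Type) (sh : I -> Z) (b : I -> Z -> C) (A : seq I)
   (sh' : J -> Z) (b' : J -> Z -> C) (A' : seq J) g k :
  opI sh b A (opI sh' b' A' g) k - opI sh' b' A' (opI sh b A g) k =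
  opI (fun ij => sh ij.1 + sh' ij.2)
    (fun ij l => b ij.1 (l + sh' ij.2) * b' ij.2 l - b' ij.2 (l + sh ij.1) * b ij.1 l)
    [seq (i, j) | i <- A, j <- A'] g k.
Proof.
have e (x y z : Z) : x - (y + z) = x - y - z by rewrite opprD addrA.
rewrite /opI big_allpairs.
under [X in X - _ = _]eq_bigr do rewrite mulr_sumr.
under [X in _ - X = _]eq_bigr do rewrite mulr_sumr.
rewrite [X in _ - X = _]exchange_big -sumrB; apply: eq_bigr => i _ /=.
rewrite -sumrB; apply: eq_bigr => j _ /=.
have -> : k - sh' j - sh i = k - (sh i + sh' j) by rewrite e addrAC.
have -> : k - sh i - sh' j = k - (sh i + sh' j) by rewrite e.
have -> : k - (sh i + sh' j) + sh' j = k - sh i by rewrite e subrK.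
have -> : k - (sh i + sh' j) + sh i = k - sh' j by rewrite e addrAC subrK.
by rewrite mulrBl !mulrA.
Qed.

Definition op (b : Z -> Z -> C) n g := opI id b (box n) g.

(** The untruncated operator as a relation, because its series converges only for suitable [g]. *)
Definition oplim b g (y : Z -> C) := forall k, to0 (fun n => nc (op b n g k - y k)).

(** Operators of order [s]: for |r| <= [M], [op b n] maps H^(r+s) to H^r with norm at most [S],
    uniformly in [n]. *)
Definition fam s (M : nat) (b : Z -> Z -> C) (c : Z -> R) (S : R) :=
  [/\ forall q, 0 <= c q, forall q l, nc (b q l) <= c q * wt s l &
      summ (fun q => c q * om q ^+ M) S].

Lemma Hb_op s M b c S r n g B : fam s M b c S -> `|r| <= M%:R -> Hb (r + s) g B ->
  Hb r (op b n g) (S * B).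
Proof.
move=> [c0 hb hS] rM hg; apply: (Hb_opI c0 rM hb _ hg).
by case: hS.
Qed.

(** The tail depends on the family alone, not on [r] or [g]: the truncations are Cauchy in operator
    norm. *)
Lemma Hb_op_tail s M b c S : fam s M b c S -> exists e : nat -> R,
  [/\ to0 e, forall n, 0 <= e n & forall r g B m n, `|r| <= M%:R ->
    Hb (r + s) g B -> (m <= n)%N -> Hb r (fun k => op b n g k - op b m g k) (e m * B)].
Proof.
move=> [c0 hb hS]; have [e [e0 epos he]] := summ_tail hS.
exists e; split => // r g B m n rM hg mn.
have : Hb r (opI id b [seq q <- box n | q \notin box m] g) (e m * B).
  apply: (Hb_opI c0 rM hb _ hg); apply: he; first by rewrite filter_uniq// uniq_box.
  by move=> k; rewrite mem_filter => /andP[].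
by apply: Hb_eq => k; rewrite /op /opI sum_box_diff// big_filter.
Qed.

Lemma oplim_exists s M b c S r g B : fam s M b c S -> `|r| <= M%:R ->
  Hb (r + s) g B -> exists y, oplim b g y.
Proof.
move=> hf rM hg; have [e [e0 epos he]] := Hb_op_tail hf.
suff h k : exists y, to0 (fun n => nc (op b n g k - y)).
  by have [y hy] := choice h; exists y.
have w0 := wt_gt0 r k.
have [|m n mn|y hy] := @to0_complete R (fun n => op b n g k) (fun n => (wt r k)^-1 * (e n * B)).
- apply: to0Z; first by rewrite invr_ge0 ltW.
  by apply: to0_le (to0Z (Hb_ge0 hg) e0) => n; rewrite mulrC.
- by rewrite ler_pdivlMl//; exact: (Hb_pt k (he _ _ _ _ _ rM hg mn)).
exists y; apply: to0_le hy _.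
apply: to0Z; first by rewrite invr_ge0 ltW.
by apply: to0_le (to0Z (Hb_ge0 hg) e0) => n; rewrite mulrC.
Qed.

Lemma Hb_oplim s M b c S r g B y : fam s M b c S -> `|r| <= M%:R ->
  Hb (r + s) g B -> oplim b g y -> Hb r y (S * B).
Proof.
move=> hf rM hg hy; have hn n := Hb_op n hf rM hg.
apply: Hb_fatou hy hn _ (Hb_ge0 (hn 0%N)).
by apply: to0_le to0_cst => n; rewrite subrr.
Qed.

Lemma oplim_tail s M b c S : fam s M b c S -> exists e : nat -> R,
  [/\ to0 e, forall n, 0 <= e n & forall r g B y m, `|r| <= M%:R ->
    Hb (r + s) g B -> oplim b g y -> Hb r (fun k => op b m g k - y k) (e m * B)].
Proof.
move=> hf; have [e [e0 epos he]] := Hb_op_tail hf.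
exists e; split => // r g B y m rM hg hy.
(* The index [maxn m n] tends to infinity with [n] while staying at least [m]. *)
apply: (@Hb_fatou r (fun n k => op b m g k - op b (maxn m n) g k) _ (fun=> e m * B)).
- move=> k eps eps0; have [N hN] := hy k _ eps0; exists N => n Nn.
  have -> : op b m g k - op b (maxn m n) g k - (op b m g k - y k) =
      - (op b (maxn m n) g k - y k) by ring.
  rewrite ncN; apply: hN.
  exact: leq_trans (leq_maxr _ _).
- move=> n; have := he r g B m (maxn m n) rM hg (leq_maxl _ _).
  by move/HbN; apply: Hb_eq => k; rewrite opprB.
- by apply: to0_le to0_cst => n; rewrite subrr.
- by rewrite mulr_ge0// (Hb_ge0 hg).
Qed.

Lemma oplimB b g h y z : oplim b g y -> oplim b h z ->
  oplim b (fun k => g k - h k) (fun k => y k - z k).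
Proof.
move=> hg hh k; apply: to0_le (to0D (hg k) (hh k)) => n.
rewrite /op opIB; apply: le_trans (ncB _ _); rewrite le_eqVlt; apply/orP; left.
by apply/eqP; congr nc; ring.
Qed.

Lemma oplimD b g h y z : oplim b g y -> oplim b h z ->
  oplim b (fun k => g k + h k) (fun k => y k + z k).
Proof.
move=> hg hh k; apply: to0_le (to0D (hg k) (hh k)) => n.
rewrite /op opID opprD addrACA; exact: ncD.
Qed.

Lemma oplim0 b : oplim b (fun=> 0) (fun=> 0).
Proof.
move=> k; apply: to0_le to0_cst => n; rewrite /op /opI big1 ?subrr ?nc0//.
by move=> q _; rewrite mulr0.
Qed.

End weighted_l2.

(** * Commutator symbols *)

(** Applied with x = s and y = M, it allows Peetre's inequality at the orders s - 1 and s - 2, which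
    may be negative. *)
Lemma norm_subr_le (R : realDomainType) (x y a : R) : 0 <= x -> x + 2 <= y -> a <= 2 ->
  0 <= a -> `|x - a| <= y.
Proof. by move=> x0 xy a2 a0; rewrite ler_norml; apply/andP; split; lra. Qed.

(** Each term on the left is a subproduct of the one on the right, and the missing factors are at
    least 1. *)
Lemma sum3_le_prod (R : realDomainType) (x y z X Y : R) :
  1 <= x -> 1 <= y -> 1 <= z -> 1 <= X -> 1 <= Y ->
  x * X * Y + X * Y + z * Y <= 3 * (z * (x * X) * (y * Y)).
Proof.
move=> x1 y1 z1 X1 Y1.
have p (u w : R) : 1 <= u -> 1 <= w -> u <= u * w.
  by move=> u1 w1; rewrite ler_peMr//; lra.
have h1 : x * X * Y <= x * X * Y * (z * y) by rewrite p ?mulr_ege1.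
have h2 : X * Y <= X * Y * (x * (z * y)) by rewrite p ?mulr_ege1.
have h3 : z * Y <= z * Y * (x * (X * y)) by rewrite p ?mulr_ege1.
have -> : 3 * (z * (x * X) * (y * Y)) = x * X * Y * (z * y) +
  X * Y * (x * (z * y)) + z * Y * (x * (X * y)) by ring.
by rewrite !lerD.
Qed.

Section commutators.
Context {R : realType} {d : nat}.
Local Notation Z := 'rV[int]_d.
Local Notation C := R[i].
Implicit Types (k l p q : Z) (r s : R) (g h : Z -> C).

Definition dif (h : Z -> C) p l : C := h (l + p) - h l.

Definition uv (j : 'I_d) : Z := delta_mx 0 j.

Lemma l1_step p n : l1 p = n.+1 -> exists p' j, l1 p' = n /\
  (p = p' + uv j \/ p = p' - uv j).
Proof.
move=> hp; have [j hj] : exists j, p 0 j != 0.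
  apply/existsP; rewrite -[X in is_true X]negbK negb_exists; apply/negP => /forallP h.
  by move: hp; rewrite /l1 big1// => j _; have := h j; rewrite negbK => /eqP ->.
have l1e (a : int) : l1 (p + a *: uv j) = (absz (p 0 j + a)%R + \sum_(i | i != j) absz (p (0:'I_1)%R i))%N.
  rewrite /l1 (bigD1 j)//= !mxE !eqxx mulr1; congr (_ + _)%N.
  by apply: eq_bigr => i ij; rewrite !mxE (negbTE ij) andbF mulr0 addr0.
have := l1e 0; rewrite scale0r addr0 hp => e0.
have [pj|pj] := leP 0 (p 0 j).
  exists (p - uv j), j; split; last by left; rewrite subrK.
  have := l1e (-1); rewrite scaleN1r => ->.
  by move: (p 0 j) hj pj e0 => a; lia.
exists (p + uv j), j; split; last by right; rewrite addrK.
have := l1e 1; rewrite scale1r => ->.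
by move: (p 0 j) hj pj e0 => a; lia.
Qed.

(** Walk from [l] to [l + p] by |p|_1 unit steps. Peetre's inequality brings the bound of each step
    back to [l] at the cost of [om p ^+ M]; the number of steps gives one more power. *)
Lemma dif_path r (M : nat) c h p l : 0 <= c -> `|r| <= M%:R ->
  (forall j l, nc (dif h (uv j) l) <= c * wt r l) ->
  nc (dif h p l) <= c * om p ^+ M.+1 * wt r l.
Proof.
move=> c0 rM hd.
have wtb n p' : (l1 p' <= n)%N -> wt r (l + p') <= n.+1%:R ^+ M * wt r l.
  move=> hp; apply: le_trans (wt_peetre _ _ rM) _.
  rewrite ler_wpM2r ?wt_ge0// lerXn2r ?nnegrE ?ler0n//.
  by rewrite ler_nat ltnS.
suff H n : forall p, l1 p = n -> nc (dif h p l) <= n%:R * (c * n.+1%:R ^+ M * wt r l).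
  apply: le_trans (H _ p erefl) _; rewrite exprSr /om.
  have -> : c * ((l1 p).+1%:R ^+ M * (l1 p).+1%:R) * wt r l =
     (l1 p).+1%:R * (c * (l1 p).+1%:R ^+ M * wt r l) by ring.
  by rewrite ler_wpM2r ?mulr_ge0 ?wt_ge0 ?exprn_ge0 ?ler0n// ler_nat.
elim: n => [|n ih] {}p hp.
  rewrite mul0r (_ : p = 0); first by rewrite /dif addr0 subrr nc0.
  apply/rowP => j; rewrite mxE; apply/eqP; rewrite -absz_eq0 -leqn0.
  by have := hp; rewrite /l1 (bigD1 j)//=; lia.
have [p' [j [hp' pE]]] := l1_step hp.
have K0 : 0 <= c * n.+2%:R ^+ M * wt r l by rewrite !mulr_ge0 ?wt_ge0 ?exprn_ge0 ?ler0n.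
have step : nc (h (l + p) - h (l + p')) <= c * n.+2%:R ^+ M * wt r l.
  case: pE => pE.
    have -> : h (l + p) - h (l + p') = dif h (uv j) (l + p') by rewrite /dif pE addrA.
    apply: le_trans (hd _ _) _; rewrite -mulrA ler_wpM2l// wtb// hp'; lia.
  have -> : h (l + p) - h (l + p') = - dif h (uv j) (l + p).
    by rewrite /dif pE -addrA subrK opprB.
  rewrite ncN; apply: le_trans (hd _ _) _; rewrite -mulrA ler_wpM2l// wtb// hp; lia.
have -> : dif h p l = (h (l + p) - h (l + p')) + dif h p' l by rewrite /dif addrA subrK.
apply: le_trans (ncD _ _) _; rewrite -[n.+1%:R]natr1 mulrDl mul1r addrC lerD//.
apply: le_trans (ih _ hp') _; rewrite ler_wpM2l ?ler0n// ler_wpM2r ?wt_ge0//.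
by rewrite ler_wpM2l// lerXn2r ?nnegrE ?ler0n// ler_nat.
Qed.

(* Two differences are all that the double commutator requires of a symbol. *)
Definition symb (s c : R) (h : Z -> C) :=
  [/\ forall l, nc (h l) <= c * wt s l,
      forall j l, nc (dif h (uv j) l) <= c * wt (s - 1) l &
      forall i j l, nc (dif (dif h (uv i)) (uv j) l) <= c * wt (s - 2) l].

(** Differences commute, so [dif_path] applies in each direction in turn. *)
Lemma dif2_path s (M : nat) c h p p' l : 0 <= c -> `|s - 2| <= M%:R -> symb s c h ->
  nc (dif (dif h p) p' l) <= c * om p ^+ M.+1 * om p' ^+ M.+1 * wt (s - 2) l.
Proof.
move=> c0 sM [_ _ h2].
have c1 : 0 <= c * om p ^+ M.+1 by rewrite mulr_ge0 ?exprn_ge0 ?(ltW (om_gt0 _)).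
apply: dif_path => // j {}l.
have -> : dif (dif h p) (uv j) l = dif (dif h (uv j)) p l.
  by rewrite /dif [l + uv j + p]addrAC; ring.
by apply: dif_path => // i {}l; exact: h2.
Qed.

Variable v : Z -> 'I_d -> C.

Definition dotv k p : C := \sum_j (k 0 j)%:~R * v p j.
Definition vn p : R := \sum_j nc (v p j).

Lemma vn_ge0 p : 0 <= vn p. Proof. by apply: sumr_ge0 => j _; exact: nc_ge0. Qed.

Lemma dotvD k l p : dotv (k + l) p = dotv k p + dotv l p.
Proof.
by rewrite /dotv -big_split; apply: eq_bigr => j _; rewrite mxE intrD mulrDl.
Qed.

Lemma dotvN k p : dotv (- k) p = - dotv k p.
Proof.
by rewrite /dotv -sumrN; apply: eq_bigr => j _; rewrite mxE intrN mulNr.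
Qed.

Lemma nc_int (a : int) : nc (a%:~R : C) = `|a%:~R : R|.
Proof.
have -> : (a%:~R : C) = ((a%:~R : R)%:C)%C by rewrite rmorph_int.
exact: nc_real.
Qed.

Lemma nc_dotv k p : nc (dotv k p) <= vn p * bracket k.
Proof.
apply: le_trans (nc_sum _ _) _; rewrite mulr_suml; apply: ler_sum => j _.
by rewrite ncM mulrC ler_wpM2l ?nc_ge0// nc_int coord_le_bracket.
Qed.

Lemma nc_dotv_om k p : nc (dotv k p) <= vn p * om k.
Proof.
apply: le_trans (nc_dotv _ _) _; rewrite ler_wpM2l ?vn_ge0//; exact: bracket_le_om.
Qed.

Lemma nc_dotvD k l p : nc (dotv (k + l) p) <= vn p * om l * bracket k.
Proof.
by apply: le_trans (nc_dotv _ _) _; rewrite -mulrA ler_wpM2l ?vn_ge0// bracketD.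
Qed.

(* With [v] the Fourier coefficients of [X] over (2 pi)^d, [bL] is the symbol of
   f |-> div (f X) and [bm] that of the multiplication by div X. *)
Definition bL p l : C := 'i%C * dotv (l + p) p.
Definition bm p l : C := 'i%C * dotv p p.

Lemma nc_bL p l : nc (bL p l) <= vn p * om p * wt 1 l.
Proof. by rewrite ncM nc_i mul1r wt1; exact: nc_dotvD. Qed.

Lemma nc_bm p l : nc (bm p l) <= vn p * om p * wt 0 l.
Proof. by rewrite ncM nc_i mul1r wt0 mulr1; exact: nc_dotv_om. Qed.

Section double_commutator.
Variables (s : R) (M : nat) (b : Z -> Z -> C) (c : Z -> R).
Hypotheses (s0 : 0 <= s) (sM : s + 2 <= M%:R) (c0 : forall q, 0 <= c q)
  (hb : forall q, symb s (c q) (b q)).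

Let om1 p n : 1 <= om p ^+ n :> R. Proof. by rewrite exprn_ege1// om_ge1. Qed.

(* The symbol of [P, L]: by [tsymE] the gain of order in the difference of [b]
   compensates the order of [bL]. *)
Definition tsym (qp : Z * Z) l : C :=
  b qp.1 (l + qp.2) * bL qp.2 l - bL qp.2 (l + qp.1) * b qp.1 l.

Lemma tsymE q p l : tsym (q, p) l =
  'i%C * (dotv (l + p) p * dif (b q) p l - dotv q p * b q l).
Proof.
rewrite /tsym /bL /dif /= [l + q + p]addrAC [dotv (l + p + q) p]dotvD; ring.
Qed.

(** The 2 counts the two terms of [tsymE]. The exponent [M.+2] is [M.+1] from [dif_path] and 1 from
    [dotv (l + p) p]; the factor [om qp.1] comes from [dotv q p]. *)
Definition tbd (qp : Z * Z) : R := 2 * (c qp.1 * om qp.1) * (vn qp.2 * om qp.2 ^+ M.+2).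

Lemma nc_tsym qp l : nc (tsym qp l) <= tbd qp * wt s l.
Proof.
case: qp => q p; rewrite tsymE ncM nc_i mul1r; apply: le_trans (ncB _ _) _.
rewrite !ncM.
have [h0 h1 h2] := hb q.
have s1M := norm_subr_le s0 sM (ler1n R 2) ler01.
have a1 := nc_dotvD l p p.
have a2 := dif_path p l (c0 q) s1M h1.
have a3 := nc_dotv_om q p; have a4 := h0 l.
have w : wt s l = bracket l * wt (s - 1) l by rewrite -wt1 -wtD; congr wt; ring.
have := ler_pM (nc_ge0 _) (nc_ge0 _) a1 a2; have := ler_pM (nc_ge0 _) (nc_ge0 _) a3 a4.
rewrite w /tbd /=; set W := wt (s - 1) l; set B := bracket l; set V := vn p.
move=> h3 h4.
apply: le_trans (lerD h4 h3) _.
have P : 0 <= c q * V * (B * W) by rewrite !mulr_ge0 ?wt_ge0 ?vn_ge0 ?(ltW (bracket_gt0 _)).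
have -> : V * om p * B * (c q * om p ^+ M.+1 * W) + V * om q * (c q * (B * W)) =
  c q * V * (B * W) * (om p ^+ M.+2 + om q) by rewrite !exprS; ring.
have -> : 2 * (c q * om q) * (V * om p ^+ M.+2) * (B * W) =
  c q * V * (B * W) * (2 * (om q * om p ^+ M.+2)) by ring.
by rewrite ler_wpM2l//; have := om1 p M.+2; have := om_ge1 (R := R) q; nra.
Qed.

(** By the Leibniz rule the difference falls on [dotv (l + p) p], which is linear in [l], or on the
    values of [b q]; all three resulting terms have order s - 1. Second differences of the symbol
    enter here. *)
Lemma nc_tsym_dif q p p' l : nc (tsym (q, p) (l + p') - tsym (q, p) l) <=
  3 * (c q * om q) * (vn p * om p ^+ M.+2) * om p' ^+ M.+2 * wt (s - 1) l.
Proof.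
have [h0 h1 h2] := hb q.
have s1M := norm_subr_le s0 sM (ler1n R 2) ler01.
have s2M := norm_subr_le s0 sM (lexx 2) (ler0n R 2).
have -> : tsym (q, p) (l + p') - tsym (q, p) l =
  'i%C * (dotv (l + p) p * dif (dif (b q) p) p' l + dotv p' p * dif (b q) p (l + p')
    - dotv q p * dif (b q) p' l).
  by rewrite !tsymE /dif [l + p' + p]addrAC [dotv (l + p + p') p]dotvD; ring.
rewrite ncM nc_i mul1r; apply: le_trans (ncB _ _) _; rewrite (ncM (dotv q p)).
have a1 := nc_dotvD l p p.
have a2 := dif2_path p p' l (c0 q) s2M (hb q).
have a3 := nc_dotv_om p' p.
have a4 := dif_path p (l + p') (c0 q) s1M h1.
have a5 := nc_dotv_om q p.
have a6 := dif_path p' l (c0 q) s1M h1.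
have w : wt (s - 1) l = bracket l * wt (s - 2) l by rewrite -wt1 -wtD; congr wt; ring.
have a7 := wt_peetre l p' s1M.
have cp : 0 <= c q * om p ^+ M.+1 by rewrite mulr_ge0 ?exprn_ge0.
have a8 := le_trans a4 (ler_wpM2l cp a7).
have k1 := ler_pM (nc_ge0 _) (nc_ge0 _) a1 a2.
have k2 := ler_pM (nc_ge0 _) (nc_ge0 _) a3 a8.
have k3 := ler_pM (nc_ge0 _) (nc_ge0 _) a5 a6.
apply: le_trans (lerD (le_trans (ncD _ _) _) k3) _.
  by rewrite !ncM; exact: lerD k1 k2.
rewrite w; set W := wt (s - 2) l; set B := bracket l; set V := vn p.
have P : 0 <= c q * V * (B * W) by rewrite !mulr_ge0 ?wt_ge0 ?vn_ge0 ?(ltW (bracket_gt0 _)).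
have -> : V * om p * B * (c q * om p ^+ M.+1 * om p' ^+ M.+1 * W) +
  V * om p' * (c q * om p ^+ M.+1 * (om p' ^+ M * (B * W))) +
  V * om q * (c q * om p' ^+ M.+1 * (B * W)) =
  c q * V * (B * W) * (om p ^+ M.+2 * om p' ^+ M.+1 + om p ^+ M.+1 * om p' ^+ M.+1 + om q * om p' ^+ M.+1).
  by rewrite !exprS; ring.
have -> : 3 * (c q * om q) * (V * om p ^+ M.+2) * om p' ^+ M.+2 * (B * W) =
  c q * V * (B * W) * (3 * (om q * om p ^+ M.+2 * om p' ^+ M.+2)) by ring.
rewrite ler_wpM2l//.
by rewrite ![om _ ^+ M.+2]exprS sum3_le_prod ?om_ge1 ?om1.
Qed.

(** The symbol of [T, L], where T has symbol [tsym] and moves frequencies by q + p. *)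
Definition dsym (qpp : (Z * Z) * Z) l : C :=
  tsym qpp.1 (l + qpp.2) * bL qpp.2 l - bL qpp.2 (l + (qpp.1.1 + qpp.1.2)) * tsym qpp.1 l.

(** 5 = 3 + 2 adds the constants of [nc_tsym_dif] and [nc_tsym]. The extra powers of [om q] and
    [om p] come from om (q + p) <= om q om p in the bound of [dotv (q + p) p']. *)
Definition dbd (qpp : (Z * Z) * Z) : R := 5 * (c qpp.1.1 * om qpp.1.1 ^+ 2) *
  (vn qpp.1.2 * om qpp.1.2 ^+ M.+3) * (vn qpp.2 * om qpp.2 ^+ M.+3).

Lemma nc_dsym qpp l : nc (dsym qpp l) <= dbd qpp * wt s l.
Proof.
case: qpp => -[q p] p'.
have -> : dsym (q, p, p') l = 'i%C * (dotv (l + p') p' * (tsym (q, p) (l + p') - tsym (q, p) l)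
   - dotv (q + p) p' * tsym (q, p) l).
  by rewrite /dsym /bL /= [l + (q + p) + p']addrAC [dotv (l + p' + (q + p)) p']dotvD; ring.
rewrite ncM nc_i mul1r; apply: le_trans (ncB _ _) _; rewrite !ncM.
have a1 := nc_dotvD l p' p'.
have a2 := nc_tsym_dif q p p' l.
have a3 := le_trans (nc_dotv_om (q + p) p') (ler_wpM2l (vn_ge0 _) (omD q p)).
have a4 := nc_tsym (q, p) l.
have k1 := ler_pM (nc_ge0 _) (nc_ge0 _) a1 a2.
have k2 := ler_pM (nc_ge0 _) (nc_ge0 _) a3 a4.
apply: le_trans (lerD k1 k2) _.
have w : wt s l = bracket l * wt (s - 1) l by rewrite -wt1 -wtD; congr wt; ring.
rewrite w /tbd /dbd /=; set W := wt (s - 1) l; set B := bracket l.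
set V := vn p; set V' := vn p'.
have P : 0 <= c q * V * V' * (B * W) by rewrite !mulr_ge0 ?wt_ge0 ?vn_ge0 ?(ltW (bracket_gt0 _)).
have -> : V' * om p' * B * (3 * (c q * om q) * (V * om p ^+ M.+2) * om p' ^+ M.+2 * W) +
  V' * (om q * om p) * (2 * (c q * om q) * (V * om p ^+ M.+2) * (B * W)) =
  c q * V * V' * (B * W) * (3 * om q * om p ^+ M.+2 * om p' ^+ M.+3 + 2 * om q ^+ 2 * om p ^+ M.+3).
  by rewrite !exprS; ring.
have -> : 5 * (c q * om q ^+ 2) * (V * om p ^+ M.+3) * (V' * om p' ^+ M.+3) * (B * W) =
  c q * V * V' * (B * W) * (5 * om q ^+ 2 * om p ^+ M.+3 * om p' ^+ M.+3) by ring.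
rewrite ler_wpM2l//.
have := om1 p M.+2; have := om1 p' M.+3; have := om_ge1 (R := R) q.
have := om_ge1 (R := R) p.
rewrite [om p ^+ M.+3]exprS expr2; move: (om p) (om q) (om p ^+ M.+2) (om p' ^+ M.+3).
move=> x z X Y x1 z1 X1 Y1.
have e0 : 0 <= z * X * Y by rewrite !mulr_ge0//; lra.
have e1 : z * X * Y <= z * X * Y * (z * x) by rewrite ler_peMr//; nra.
have e2 : z * z * (x * X) <= z * z * (x * X) * Y by rewrite ler_peMr// !mulr_ge0//; lra.
nra.
Qed.

Lemma sum_allpairs_le (I J : Type) (A : seq I) (B : seq J) (x : I -> R) (y : J -> R) (X Y : R) :
  0 <= X -> 0 <= \sum_(j <- B) y j -> \sum_(i <- A) x i <= X -> \sum_(j <- B) y j <= Y ->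
  \sum_(ij <- [seq (i, j) | i <- A, j <- B]) x ij.1 * y ij.2 <= X * Y.
Proof.
move=> X0 B0 hX hY; rewrite big_allpairs /=.
under eq_bigr do rewrite -mulr_sumr.
rewrite -mulr_suml; apply: le_trans (ler_wpM2r B0 hX) _; exact: ler_wpM2l.
Qed.

End double_commutator.

End commutators.

(** * The energy inequality for truncated operators *)

Section inner_product.
Context {R : realType} {d : nat}.
Local Notation Z := 'rV[int]_d.
Local Notation C := R[i].
Implicit Types (k l p q : Z) (r s : R) (g h X Y : Z -> C) (A : seq Z).

Definition dot A X Y : C := \sum_(k <- A) X k * (Y k)^*%C.

Lemma dotDl A X X' Y : dot A (fun k => X k + X' k) Y = dot A X Y + dot A X' Y.
Proof. by rewrite /dot -big_split; apply: eq_bigr => k _; rewrite mulrDl. Qed.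

Lemma dotDr A X Y Y' : dot A X (fun k => Y k + Y' k) = dot A X Y + dot A X Y'.
Proof.
by rewrite /dot -big_split; apply: eq_bigr => k _; rewrite rmorphD mulrDr.
Qed.

Lemma dotBr A X Y Y' : dot A X (fun k => Y k - Y' k) = dot A X Y - dot A X Y'.
Proof.
by rewrite /dot -sumrB; apply: eq_bigr => k _; rewrite rmorphB mulrBr.
Qed.

Lemma dot_conj A X Y : dot A Y X = (dot A X Y)^*%C.
Proof.
rewrite /dot rmorph_sum; apply: eq_bigr => k _ /=.
by rewrite rmorphM /= conjcK mulrC.
Qed.

Lemma Re_dotC A X Y : complex.Re (dot A Y X) = complex.Re (dot A X Y).
Proof. by rewrite dot_conj; case: (dot A X Y). Qed.

Lemma eq_dot A X X' Y Y' : (forall k, X k = X' k) -> (forall k, Y k = Y' k) ->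
  dot A X Y = dot A X' Y'.
Proof. by move=> h h'; apply: eq_bigr => k _; rewrite h h'. Qed.

Lemma Re_dot_le A X Y B B' : uniq A -> Hb 0 X B -> Hb 0 Y B' ->
  `|complex.Re (dot A X Y)| <= B * B'.
Proof.
move=> uA [B0 hX] [B0' hY].
apply: le_trans (nc_ge_Re _) _; apply: le_trans (nc_sum _ _) _.
under eq_bigr do rewrite ncM nc_conj.
apply: sum_cs_le => //.
  by have := hX _ uA; under eq_bigr do rewrite wt0 mul1r.
by have := hY _ uA; under eq_bigr do rewrite wt0 mul1r.
Qed.

Lemma sum_supp (V : zmodType) (F : Z -> V) A A' : uniq A -> uniq A' ->
  (forall k, F k != 0 -> k \in A /\ k \in A') ->
  \sum_(k <- A) F k = \sum_(k <- A') F k.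
Proof.
move=> uA uA' h.
have aux (S S' : seq Z) : (forall k, F k != 0 -> k \in S /\ k \in S') ->
    \sum_(k <- S) F k = \sum_(k <- [seq k <- S | k \in S']) F k.
  move=> hS; rewrite big_filter (bigID (fun k => k \in S'))/= [X in _ + X]big1 ?addr0//.
  by move=> k kS; apply/eqP; apply: contraNT kS => /hS[].
rewrite (aux A A') // (aux A' A); last by move=> k /h[].
apply: perm_big; apply: uniq_perm; rewrite ?filter_uniq// => k.
by rewrite !mem_filter andbC.
Qed.

(** The support of [F] and its translate both lie in [box N], so the sum over that box is as
    translation invariant as the full one. *)
Lemma sum_box_shift (V : zmodType) (F : Z -> V) (a n N : nat) p :
  (forall k, F k != 0 -> k \in box a) -> p \in box n -> (a + n <= N)%N ->
  \sum_(k <- box N) F (k - p) = \sum_(k <- box N) F k.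
Proof.
move=> hF hp aN.
rewrite -(big_map (fun k => k - p) xpredT F).
have inj : injective (fun k => k - p) := @addIr _ (- p).
apply: sum_supp; rewrite ?(map_inj_uniq inj) ?uniq_box//.
move=> k /hF ka; split; last by apply: box_le ka; lia.
apply/mapP; exists (k + p); last by rewrite addrK.
by apply: box_le (boxD ka hp).
Qed.

(** Conjugate transpose: the entry from [l] to [l + p] is the conjugate of the entry from [l + p] to
    [l], a shift by [- p]. *)
Definition adj (b : Z -> Z -> C) p l : C := (b (- p) (l + p))^*%C.

(** [box n] is symmetric, so the adjoint of the truncation is the truncation of the adjoint, and [N]
    is large enough for [op b n X] to be supported in [box N]. *)
Lemma dot_adj (b : Z -> Z -> C) n a N X Y :
  (forall k, X k != 0 -> k \in box a) -> (a + n <= N)%N ->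
  dot (box N) (op b n X) Y = dot (box N) X (op (adj b) n Y).
Proof.
move=> hX aN; rewrite /dot /op /opI.
under eq_bigr do rewrite mulr_suml.
under [RHS]eq_bigr do rewrite rmorph_sum mulr_sumr.
rewrite exchange_big [RHS]exchange_big /=.
(* The change of shift from p to - p matches each term with its transpose. *)
rewrite (perm_big (map -%R (box n))) /=; last first.
  apply: uniq_perm; rewrite ?(map_inj_uniq oppr_inj) ?uniq_box//.
  move=> k; apply/idP/mapP => [hk|[l hl ->]]; last by rewrite boxN.
  by exists (- k); rewrite ?boxN ?opprK.
rewrite big_map !big_seq; apply: eq_bigr => p hp.
pose F k := X k * (adj b p (k - p) * Y (k - p))^*%C.
rewrite -[RHS](@sum_box_shift _ F a n N (- p)) ?boxN//; last first.
  by move=> k; rewrite /F => h; apply: hX; apply: contraNneq h => ->; rewrite mul0r.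
apply: eq_bigr => k _; rewrite /F /adj !opprK addrK rmorphM /= conjcK; ring.
Qed.

Lemma op_supp (b : Z -> Z -> C) n a X :
  (forall k, X k != 0 -> k \in box a) -> forall k, op b n X k != 0 -> k \in box (a + n).
Proof.
move=> hX k; apply: contraR => hk; rewrite /op /opI big_seq big1// => p hp.
case: (eqVneq (X (k - p)) 0) => [->|/hX h]; first by rewrite mulr0.
by move: hk; rewrite -(subrK p k) boxD.
Qed.

End inner_product.

Section energy_bound.
Context {R : realType} {d : nat}.
Local Notation Z := 'rV[int]_d.
Local Notation C := R[i].
Variables (s : R) (M : nat) (b : Z -> Z -> C) (c : Z -> R) (S : R).
Hypotheses (s0 : 0 <= s) (sM : s + 2 <= M%:R) (c0 : forall q, 0 <= c q)
  (hb : forall q, symb s (c q) (b q)) (hS : summ (fun q => c q * om q ^+ M.+3) S).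
Variables (v : Z -> 'I_d -> C) (V : R).
Hypotheses (hv : forall p j, v (- p) j = (v p j)^*%C)
  (hV : summ (fun p => vn v p * om p ^+ M.+3) V).

Lemma summ_le_exp (w : Z -> R) (m n : nat) S' : (m <= n)%N -> (forall k, 0 <= w k) ->
  summ (fun q => w q * om q ^+ n) S' -> summ (fun q => w q * om q ^+ m) S'.
Proof.
move=> mn w0 [S0 _ h]; split => // [k|N].
  by rewrite mulr_ge0// exprn_ge0// ltW// om_gt0.
apply: le_trans (h N); apply: ler_sum => k _.
by rewrite ler_wpM2l// ler_weXn2l// om_ge1.
Qed.

Lemma famP_le (m : nat) : (m <= M.+3)%N -> fam s m b c S.
Proof.
by move=> mM; split => // [q l|]; [case: (hb q) | exact: summ_le_exp hS].
Qed.

(** The bound of [bL] itself spends one power of [om], hence [M.+2] instead of [M.+3]. *)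
Lemma famL_le (m : nat) : (m <= M.+2)%N ->
  fam 1 m (bL v) (fun p => vn v p * om p) V.
Proof.
move=> mM; split => [q|q l|]; first by rewrite mulr_ge0 ?vn_ge0 ?ltW ?om_gt0.
  exact: nc_bL.
have [V0 h h'] := @summ_le_exp (vn v) m.+1 M.+3 V mM (vn_ge0 v) hV.
by split => // [k|n]; [have := h k | have := h' n]; rewrite ?exprS ?mulrA//;
  under eq_bigr do rewrite exprS mulrA.
Qed.

Lemma famm_le (m : nat) : (m <= M.+2)%N ->
  fam 0 m (bm v) (fun p => vn v p * om p) V.
Proof. by move=> /famL_le[h _ h']; split => // q l; exact: nc_bm. Qed.

Lemma dotv_conj k p : (dotv v k p)^*%C = dotv v k (- p).
Proof.
rewrite /dotv rmorph_sum; apply: eq_bigr => j _.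
by rewrite rmorphM /= hv rmorph_int.
Qed.

(** Both sides are - i l.v(p), the coefficient of f |-> - X.grad f; the reality of the field enters
    through [hv]. *)
Lemma adj_bL p l : adj (bL v) p l = bm v p l - bL v p l.
Proof.
rewrite /adj /bL /bm rmorphM /= addrK dotv_conj opprK dotvD.
have -> : (Complex 0 (-1) : C) = - 'i%C by apply/eqP; rewrite eq_complex /= ?oppr0 !eqxx.
ring.
Qed.

Lemma adj_bm p l : adj (bm v) p l = bm v p l.
Proof.
rewrite /adj /bm rmorphM /= dotv_conj opprK dotvN.
have -> : (Complex 0 (-1) : C) = - 'i%C by apply/eqP; rewrite eq_complex /= ?oppr0 !eqxx.
ring.
Qed.

Variable n : nat.
Let P := op b n.
Let L := op (bL v) n.
Let m := op (bm v) n.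

Lemma dot_L a N X Y : (forall k, X k != 0 -> k \in box a) -> (a + n <= N)%N ->
  dot (box N) (L X) Y = dot (box N) X (m Y) - dot (box N) X (L Y).
Proof.
move=> hX aN; rewrite (dot_adj _ _ hX aN) -dotBr; apply: eq_dot => // k.
rewrite /op /opI /m /L /op /opI -sumrB; apply: eq_bigr => p _.
by rewrite adj_bL mulrBl.
Qed.

Lemma dot_m a N X Y : (forall k, X k != 0 -> k \in box a) -> (a + n <= N)%N ->
  dot (box N) (m X) Y = dot (box N) X (m Y).
Proof.
move=> hX aN; rewrite (dot_adj _ _ hX aN); apply: eq_dot => // k.
by apply: eq_bigr => p _; rewrite adj_bm.
Qed.

(** [T], [D] and [E] are commutators of the truncated operators, not truncations of the commutators,
    so the relations below hold exactly. *)
Let T g := opI (fun ij : Z * Z => id ij.1 + id ij.2) (tsym v b) [seq (i, j) | i <- box n, j <- box n] g.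
Let D g := opI (fun ij : (Z * Z) * Z => ij.1.1 + ij.1.2 + id ij.2) (dsym v b)
  [seq (i, j) | i <- [seq (i, j) | i <- box n, j <- box n], j <- box n] g.
Let E g := opI (fun ij : Z * Z => id ij.1 + id ij.2)
  (fun ij l => bL v ij.1 (l + id ij.2) * bm v ij.2 l - bm v ij.2 (l + id ij.1) * bL v ij.1 l)
  [seq (i, j) | i <- box n, j <- box n] g.

Lemma PL_comm g k : P (L g) k = L (P g) k + T g k.
Proof.
by rewrite -[T g k](opI_comm id b (box n) id (bL v) (box n) g k) addrC subrK.
Qed.

Lemma TL_comm g k : T (L g) k = L (T g) k + D g k.
Proof.
rewrite -[D g k](opI_comm (fun ij : Z * Z => id ij.1 + id ij.2) (tsym v b) _ id (bL v) (box n) g k).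
by rewrite addrC subrK.
Qed.

Lemma Lm_comm g k : L (m g) k = m (L g) k + E g k.
Proof.
by rewrite -[E g k](opI_comm id (bL v) (box n) id (bm v) (box n) g k) addrC subrK.
Qed.

(** The term (PLf, LPf) produced by moving [L] to the right in (LPLf, Pf) cancels against the one in
    the expansion of |PLf|^2, and the real parts of (Tf, LPf) and (LPf, Tf) cancel. What is left of
    high order is Re (LPf, mPf). *)
Lemma energy_identity a N f : (forall k, f k != 0 -> k \in box a) -> (a + n *+ 5 <= N)%N ->
  complex.Re (dot (box N) (P (L (L f))) (P f)) + complex.Re (dot (box N) (P (L f)) (P (L f))) =
  complex.Re (dot (box N) (T f) (T f)) + complex.Re (dot (box N) (D f) (P f)) +
  2 * complex.Re (dot (box N) (T f) (m (P f))) +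
  2^-1 * (complex.Re (dot (box N) (m (P f)) (m (P f))) - complex.Re (dot (box N) (P f) (E (P f)))).
Proof.
move=> hf aN; set A := box N.
have hP := op_supp (b := b) (n := n) hf.
have hL := op_supp (b := bL v) (n := n) hf.
have hPL := op_supp (b := b) (n := n) hL.
have hLP := op_supp (b := bL v) (n := n) hP.
have hT : forall k, T f k != 0 -> k \in box (a + n + n).
  move=> k; apply: contraR => hk.
  have -> : T f k = P (L f) k - L (P f) k by rewrite PL_comm addrC addKr.
  have -> : P (L f) k = 0 by apply/eqP; apply: contraNT hk; exact: hPL.
  have -> : L (P f) k = 0 by apply/eqP; apply: contraNT hk; exact: hLP.
  by rewrite subrr.
have e1 : dot A (P (L (L f))) (P f) = dot A (L (P (L f))) (P f) + dot A (L (T f)) (P f) + dot A (D f) (P f).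
  rewrite -!dotDl; apply: eq_dot => // k.
  by rewrite PL_comm TL_comm addrA.
have e2 := @dot_L _ N (P (L f)) (P f) hPL ltac:(lia).
have e3 := @dot_L _ N (T f) (P f) hT ltac:(lia).
have e4 : dot A (P (L f)) (m (P f)) = dot A (L (P f)) (m (P f)) + dot A (T f) (m (P f)).
  by rewrite -dotDl; apply: eq_dot => // k; rewrite PL_comm.
have e5 : dot A (P (L f)) (P (L f)) = dot A (P (L f)) (L (P f)) + dot A (P (L f)) (T f).
  by rewrite -dotDr; apply: eq_dot => // k; rewrite PL_comm.
have e6 : dot A (P (L f)) (T f) = dot A (L (P f)) (T f) + dot A (T f) (T f).
  by rewrite -dotDl; apply: eq_dot => // k; rewrite PL_comm.
(* Moving [L] and then [m] across in (LPf, mPf) reproduces its real part with the opposite sign, up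
   to terms in [m] and [E]; hence the factor 1/2. *)
have e7 := @dot_L _ N (P f) (m (P f)) hP ltac:(lia).
have e8 : dot A (P f) (L (m (P f))) = dot A (P f) (m (L (P f))) + dot A (P f) (E (P f)).
  by rewrite -dotDr; apply: eq_dot => // k; rewrite Lm_comm.
have e9 := @dot_m _ N (P f) (L (P f)) hP ltac:(lia).
have e10 := @dot_m _ N (P f) (m (P f)) hP ltac:(lia).
have c1 := Re_dotC A (T f) (L (P f)).
have c2 := Re_dotC A (m (P f)) (L (P f)).
rewrite -/A in e2 e3 e7 e9 e10.
move: e1 e2 e3 e4 e5 e6 e7 e8 e9 e10.
pose Rec := congr1 (@complex.Re R).
move=> /Rec E1 /Rec E2 /Rec E3 /Rec E4 /Rec E5 /Rec E6 /Rec E7 /Rec E8 /Rec E9 /Rec E10.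
rewrite !(raddfD,raddfB) /= in E1 E2 E3 E4 E5 E6 E7 E8 E9 E10.
lra.
Qed.

Lemma energy_bound a N f B : (forall k, f k != 0 -> k \in box a) -> (a + n *+ 5 <= N)%N ->
  Hb s f B ->
  complex.Re (dot (box N) (P (L (L f))) (P f)) + complex.Re (dot (box N) (P (L f)) (P (L f)))
  <= 14 * (S * V * B) ^+ 2.
Proof.
move=> hf aN hB; rewrite (energy_identity hf aN).
have hB' : Hb (0 + s) f B by rewrite add0r.
have n0 : `|0 : R| <= 0%:R by rewrite normr0.
have [S0 _ _] := hS; have [V0 _ _] := hV; have B0 := Hb_ge0 hB.
have box0 (w : Z -> R) : (forall k, 0 <= w k) -> 0 <= \sum_(k <- box n) w k by move=> h; apply: sumr_ge0.
have vo0 p j : 0 <= vn v p * om p ^+ j by rewrite mulr_ge0 ?vn_ge0 ?exprn_ge0 ?ltW ?om_gt0.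
have co0 p j : 0 <= c p * om p ^+ j by rewrite mulr_ge0 ?c0 ?exprn_ge0 ?ltW ?om_gt0.
have cS j : (j <= M.+3)%N -> \sum_(k <- box n) c k * om k ^+ j <= S.
  by move=> jM; case: (summ_le_exp jM c0 hS).
have vV j : (j <= M.+3)%N -> \sum_(k <- box n) vn v k * om k ^+ j <= V.
  by move=> jM; case: (summ_le_exp jM (vn_ge0 v) hV).
have HP : Hb 0 (P f) (S * B) by exact: Hb_op (famP_le (leq0n _)) n0 hB'.
have HP' : Hb (0 + 0) (P f) (S * B) by rewrite addr0.
have Hm : Hb 0 (m (P f)) (V * (S * B)) by exact: Hb_op (famm_le (leq0n _)) n0 HP'.
(* The estimates are in H^0, where no Peetre factor is paid, hence the exponent 0; the sums over
   pairs and triples then factor. *)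
have sum1 : \sum_(qp <- [seq (i, j) | i <- box n, j <- box n]) tbd v M c qp * om (qp.1 + qp.2) ^+ 0 <= 2 * S * V.
  under eq_bigr do rewrite mulr1.
  apply: (sum_allpairs_le (x := fun q => 2 * (c q * om q)) (y := fun p => vn v p * om p ^+ M.+2)).
  - by rewrite mulr_ge0.
  - by apply: box0.
  - by rewrite -mulr_sumr ler_wpM2l// (cS 1%N).
  - exact: vV.
have sum2 : \sum_(qpp <- [seq (i, j) | i <- [seq (i, j) | i <- box n, j <- box n], j <- box n])
    dbd v M c qpp * om (qpp.1.1 + qpp.1.2 + qpp.2) ^+ 0 <= 5 * S * V * V.
  under eq_bigr do rewrite mulr1.
  apply: (sum_allpairs_le (x := fun qp : Z * Z => 5 * (c qp.1 * om qp.1 ^+ 2) * (vn v qp.2 * om qp.2 ^+ M.+3))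
    (y := fun p => vn v p * om p ^+ M.+3)).
  - by rewrite !mulr_ge0.
  - by apply: box0.
  - apply: (sum_allpairs_le (x := fun q => 5 * (c q * om q ^+ 2)) (y := fun p => vn v p * om p ^+ M.+3)).
    + by rewrite mulr_ge0.
    + by apply: box0.
    + by rewrite -mulr_sumr ler_wpM2l// cS.
    + exact: vV.
  - exact: vV.
have sum3 : \sum_(pp <- [seq (i, j) | i <- box n, j <- box n])
    vn v pp.1 * (vn v pp.2 * om pp.2 ^+ 2) * om (pp.1 + pp.2) ^+ 0 <= V * V.
  under eq_bigr do rewrite mulr1.
  apply: (sum_allpairs_le (x := fun q => vn v q) (y := fun p => vn v p * om p ^+ 2)).
  - exact: V0.
  - by apply: box0.
  - by have := vV 0%N isT; under eq_bigr do rewrite mulr1.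
  - exact: vV.
have o0 (p : Z) : 0 <= om p :> R by rewrite ltW ?om_gt0.
have e0 (p : Z) j : 0 <= om p ^+ j :> R := exprn_ge0 j (o0 p).
have tbd0 qp : 0 <= tbd v M c qp.
  by rewrite /tbd; repeat first [exact: e0 | exact: o0 | exact: c0 | exact: vn_ge0 | exact: ler0n | apply: mulr_ge0].
have dbd0 qp : 0 <= dbd v M c qp.
  by rewrite /dbd; repeat first [exact: e0 | exact: o0 | exact: c0 | exact: vn_ge0 | exact: ler0n | apply: mulr_ge0].
have HT : Hb 0 (T f) (2 * S * V * B).
  apply: (@Hb_opI _ _ _ _ _ _ 0 s 0 (tbd v M c)) => // qp l.
  exact: nc_tsym.
have HD : Hb 0 (D f) (5 * S * V * V * B).
  apply: (@Hb_opI _ _ _ _ _ _ 0 s 0 (dbd v M c)) => // qp l.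
  exact: nc_dsym.
have HE : Hb 0 (E (P f)) (V * V * (S * B)).
  apply: (@Hb_opI _ _ _ _ _ _ 0 0 0 (fun pp => vn v pp.1 * (vn v pp.2 * om pp.2 ^+ 2))) => //.
    by move=> pp; repeat first [exact: e0 | exact: o0 | exact: c0 | exact: vn_ge0 | exact: ler0n | apply: mulr_ge0].
  move=> [p p'] l; rewrite wt0 mulr1 /=.
  (* The dependence on [l] cancels: [E] is a multiplication operator, of order 0. *)
  have -> : bL v p (l + p') * bm v p' l - bm v p' (l + p) * bL v p l =
     'i%C * 'i%C * (dotv v p' p * dotv v p' p').
    by rewrite /bL /bm [l + p' + p]addrAC [dotv v (l + p + p') p]dotvD; ring.
  rewrite !ncM !nc_i !mul1r.
  have := ler_pM (nc_ge0 _) (nc_ge0 _) (nc_dotv_om v p' p) (nc_dotv_om v p' p').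
  by rewrite expr2 => /le_trans; apply; rewrite le_eqVlt; apply/orP; left; apply/eqP; ring.
have uN := uniq_box (d := d) N.
have t1 := Re_dot_le uN HT HT; have t2 := Re_dot_le uN HD HP.
have t3 := Re_dot_le uN HT Hm; have t4 := Re_dot_le uN Hm Hm.
have t5 := Re_dot_le uN HP HE.
move: t1 t2 t3 t4 t5; rewrite !ler_norml => /andP[_ t1] /andP[_ t2] /andP[_ t3] /andP[_ t4] /andP[t5 _].
(* 14 = 2 * 2 + 5 + 2 * 2 + (1 + 1) / 2, in the order of the terms of [energy_identity]. *)
have -> : 14 * (S * V * B) ^+ 2 = 2 * S * V * B * (2 * S * V * B) + 5 * S * V * V * B * (S * B)
   + 2 * (2 * S * V * B * (V * (S * B))) + 2^-1 * (V * (S * B) * (V * (S * B)) + S * B * (V * V * (S * B))).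
  by field.
rewrite !lerD// ?ler_wpM2l ?invr_ge0// lerD// lerNl; exact: t5.
Qed.

End energy_bound.

(** * Integration on the torus *)

Section circle.
Context {R : realType}.
Local Notation mR := (measurableTypeR R).
Local Notation circ := (@circle_measure R).
Local Notation per := (2 * pi : R).

Lemma per_gt0 : 0 < per. Proof. by rewrite mulr_gt0// pi_gt0. Qed.

Lemma circle_out : circ (~` `[0%R, per[%classic) = 0%E.
Proof. by rewrite /circle_measure/= /mfrestr /mrestr setICl measure0. Qed.

Lemma circle_setT : circ setT = per%:E.
Proof.
rewrite /circle_measure/= /mfrestr /mrestr setTI lebesgue_measure_itv /=.
by rewrite lte_fin per_gt0 -EFinD subr0.
Qed.

(** The restricted measure is traded for Lebesgue measure on the closed interval, where the
    fundamental theorem of calculus applies. *)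
Lemma circle_ftc (f F : R -> R) : continuous f ->
  (forall x : R, is_derive x (1 : R) F (f x)) -> F per = F 0 ->
  \int[circ]_x f x = 0.
Proof.
move=> cf dF F0.
have mf : measurable_fun (setT : set mR) (fun x : mR => (f x)%:E).
  by apply/measurable_EFinP; exact: continuous_measurable_fun.
have mD : measurable (`[0%R, per[%classic : set mR) by exact: measurable_itv.
have i1 : (\int[circ]_x (f x)%:E = \int[circ]_(x in `[0%R, per[%classic) (f x)%:E)%E.
  rewrite [RHS]integral_mkcond; apply: ae_eq_integral => //.
    by apply/(measurable_restrictT _ mD); exact: measurable_funS mf.
  exists (~` `[0%R, per[%classic); split; [exact: measurableC|exact: circle_out|].
  move=> x /= h xD; apply: h => _.
  by rewrite patchE mem_set.
have i2 : (\int[circ]_(x in `[0%R, per[%classic) (f x)%:E =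
   \int[lebesgue_measure]_(x in `[0%R, per[%classic) (f x)%:E)%E.
  apply: eq_measure_integral => A mA AD.
  by rewrite /circle_measure/= /mfrestr /mrestr setIidl.
rewrite /Rintegral i1 i2 integral_itv_bndo_bndc; last exact: measurable_funS mf.
rewrite (@continuous_FTC2 _ f F)//.
- by rewrite F0 subee.
- exact: per_gt0.
- exact: continuous_subspaceT.
- have cF : continuous F.
    move=> x; apply: differentiable_continuous; apply/derivable1_diffP.
    by have [] := dF x.
  split.
  + by move=> x _; have [] := dF x.
  + by apply: cvg_at_right_filter; exact: cF.
  + by apply: cvg_at_left_filter; exact: cF.
- by move=> x _; rewrite derive1E; have [] := dF x.
Qed.

End circle.

Section torus_integral.
Context {R : realType}.
Local Notation mR := (measurableTypeR R).
Local Notation circ := (@circle_measure R).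
Local Notation per := (2 * pi : R).
Local Notation T n := (n.-tuple mR).
Local Notation mu n := (torus_measure R n).

(** Bounded measurable functions are integrable for every finite measure and stable under sections,
    so Fubini's theorem applies to them repeatedly. *)
Definition bmf d (X : measurableType d) (F : X -> R) :=
  measurable_fun setT F /\ exists B, forall t, `|F t| <= B.

Lemma bmf_integrable d (X : measurableType d) (m : {finite_measure set X -> \bar R}) F :
  bmf F -> m.-integrable setT (EFin \o F).
Proof.
move=> [mF [B hB]]; apply: measurable_bounded_integrable => //.
  by rewrite -ge0_fin_numE// fin_num_measure.
exists B; split; first by rewrite num_real.
by move=> x Bx y _ /=; apply: (le_trans (hB y)); exact: ltW.
Qed.

Lemma bmf_cst d (X : measurableType d) (r : R) : bmf (fun _ : X => r).
Proof. by split; [exact: measurable_cst | exists `|r|]. Qed.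

Lemma bmfD d (X : measurableType d) (F G : X -> R) : bmf F -> bmf G -> bmf (fun t => F t + G t).
Proof.
move=> [mF [B hB]] [mG [B' hB']]; split; first exact: measurable_funD.
by exists (B + B') => t; rewrite (le_trans (ler_normD _ _))// lerD.
Qed.

Lemma bmfM d (X : measurableType d) (F G : X -> R) : bmf F -> bmf G -> bmf (fun t => F t * G t).
Proof.
move=> [mF [B hB]] [mG [B' hB']]; split; first exact: measurable_funM.
by exists (B * B') => t; rewrite normrM ler_pM.
Qed.

Lemma bmf_comp d d' (X : measurableType d) (Y : measurableType d') (F : Y -> R) (h : X -> Y) :
  measurable_fun setT h -> bmf F -> bmf (F \o h).
Proof.
move=> mh [mF [B hB]]; split; first exact: measurableT_comp.
by exists B => t; exact: hB.
Qed.

Lemma bmf_cos d (X : measurableType d) (F : X -> R) : measurable_fun setT F -> bmf (fun t => cos (F t)).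
Proof.
move=> mF; split; last by exists 1 => t; rewrite ler_norml cos_geN1 cos_le1.
by apply: measurableT_comp => //; apply: continuous_measurable_fun; exact: continuous_cos.
Qed.

Lemma bmf_sin d (X : measurableType d) (F : X -> R) : measurable_fun setT F -> bmf (fun t => sin (F t)).
Proof.
move=> mF; split; last by exists 1 => t; rewrite ler_norml sin_geN1 sin_le1.
by apply: measurableT_comp => //; apply: continuous_measurable_fun; exact: continuous_sin.
Qed.

Definition tcons n (x : R) (t : T n) : T n.+1 := @tuple_cons R n (x, t).

Lemma tnth_tcons0 n x (t : T n) : tnth (tcons x t) ord0 = x.
Proof. by rewrite (tnth_nth 0). Qed.

Lemma tnth_tconsS n x (t : T n) j : tnth (tcons x t) (lift ord0 j) = tnth t j.
Proof. by rewrite !(tnth_nth 0). Qed.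

Lemma torus_measureS_E n : (mu n.+1 : set (T n.+1) -> \bar R) =
  pushforward (circ \x mu n)%E (@tuple_cons R n).
Proof. by []. Qed.

Lemma measurable_tcons n (x : R) : measurable_fun setT (@tcons n x).
Proof. by apply: measurable_cons; [exact: measurable_cst|exact: measurable_id]. Qed.

Lemma measurable_tcons1 n (t : T n) : measurable_fun (setT : set mR) (fun x => tcons x t).
Proof. by apply: (@measurable_cons _ _ mR mR id n (fun=> t)). Qed.

Lemma bmf_prod_integrable n (F : T n.+1 -> R) : bmf F ->
  (circ \x mu n)%E.-integrable setT (fun z => (F (tuple_cons z))%:E).
Proof.
move=> bF.
have [mF [B hB]] := bmf_comp (@measurable_tuple_cons R n) bF.
apply: measurable_bounded_integrable => //.
  suff : ((circ \x mu n)%E setT < +oo)%E by [].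
  rewrite -setXTT product_measure1E//.
  by rewrite lte_mul_pinfty// ?fin_num_measure// -ge0_fin_numE// fin_num_measure.
exists B; split; first by rewrite num_real.
by move=> x Bx y _ /=; apply: (le_trans (hB y)); exact: ltW.
Qed.

Lemma torus_intS n (F : T n.+1 -> R) : bmf F ->
  (\int[mu n.+1]_t (F t)%:E = \int[circ \x mu n]_z (F (tuple_cons z))%:E)%E.
Proof.
move=> bF; rewrite torus_measureS_E integral_pushforward//=.
- exact: measurable_tuple_cons.
- by apply/measurable_EFinP; case: bF.
- exact: bmf_prod_integrable.
Qed.

Lemma torus_fubini1 n (F : T n.+1 -> R) : bmf F ->
  \int[mu n.+1]_t F t = \int[circ]_x \int[mu n]_t F (tcons x t).
Proof.
move=> bF; rewrite /Rintegral torus_intS// -integral12_prod_meas1; last exact: bmf_prod_integrable.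
congr fine; apply: eq_integral => x _; rewrite /fubini_F /= fineK//.
apply: integrable_fin_num => //.
exact: (bmf_integrable _ (bmf_comp (measurable_tcons x) bF)).
Qed.

Lemma torus_fubini2 n (F : T n.+1 -> R) : bmf F ->
  \int[mu n.+1]_t F t = \int[mu n]_t \int[circ]_x F (tcons x t).
Proof.
move=> bF; rewrite /Rintegral torus_intS// -integral21_prod_meas1; last exact: bmf_prod_integrable.
congr fine; apply: eq_integral => t _; rewrite /fubini_G /= fineK//.
apply: integrable_fin_num => //.
exact: (bmf_integrable _ (bmf_comp (measurable_tcons1 t) bF)).
Qed.

Lemma torus_setT n : mu n setT = (per ^+ n)%:E.
Proof.
elim: n => [|n ih]; first by rewrite /= diracT expr0.
rewrite torus_measureS_E /pushforward preimage_setT -setXTT.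
apply: (eq_trans (product_measure1E circ (mu n) measurableT measurableT)).
by apply: (eq_trans (congr2 mule circle_setT ih)); rewrite -EFinM exprS.
Qed.

Lemma torus_out n (j : 'I_n) : mu n [set t | ~ `[0%R, per[%classic (tnth t j)] = 0%E.
Proof.
elim: n j => [[]//|n ih] j; rewrite torus_measureS_E /pushforward.
have mD : measurable (~` `[0%R, per[%classic : set mR) by apply: measurableC; exact: measurable_itv.
case: (unliftP ord0 j) => [j'|] ->.
  rewrite (_ : _ @^-1` _ = setT `*` [set t | ~ `[0%R, per[%classic (tnth t j')]); last first.
    apply/seteqP; split => -[x t] /=; rewrite -[tuple_cons (x, t)]/(tcons x t) tnth_tconsS; tauto.
  rewrite product_measure1E//.
    by rewrite [X in (_ * X)%E](_ : _ = 0%E) ?mule0//; exact: ih.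
  by have := measurable_tnth j' measurableT mD; rewrite setTI.
rewrite (_ : _ @^-1` _ = (~` `[0%R, per[%classic) `*` setT); last first.
  apply/seteqP; split => -[x t] /=; rewrite -[tuple_cons (x, t)]/(tcons x t) tnth_tcons0; tauto.
apply: (eq_trans (product_measure1E circ (mu n) mD measurableT)).
by apply: (eq_trans (congr2 mule circle_out erefl)); rewrite mul0e.
Qed.

Definition upd n (t : T n) (j : 'I_n) (r : R) : T n :=
  [tuple (if i == j then r else tnth t i) | i < n].

Lemma tnth_upd n (t : T n) j r i : tnth (upd t j r) i = if i == j then r else tnth t i.
Proof. by rewrite tnth_mktuple. Qed.

Lemma upd_tcons0 n x (t : T n) r : upd (tcons x t) ord0 r = tcons r t.
Proof.
apply: eq_from_tnth => i; rewrite tnth_upd.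
by case: (unliftP ord0 i) => [i'|] ->; rewrite ?tnth_tcons0 ?tnth_tconsS ?eqxx.
Qed.

Lemma upd_tconsS n x (t : T n) j r : upd (tcons x t) (lift ord0 j) r = tcons x (upd t j r).
Proof.
apply: eq_from_tnth => i; rewrite tnth_upd.
case: (unliftP ord0 i) => [i'|] ->; rewrite ?tnth_tcons0 ?tnth_tconsS ?tnth_upd//.
Qed.

(** With the first coordinate outermost, Fubini's theorem lowers the dimension, unless that
    coordinate is the direction of differentiation; then it is put innermost and [circle_ftc]
    applies. *)
Lemma torus_div n (j : 'I_n) (F G : T n -> R) : bmf G ->
  (forall t, continuous (fun r : R => G (upd t j r))) ->
  (forall t (r : R), is_derive r (1 : R) (fun r : R => F (upd t j r)) (G (upd t j r))) ->
  (forall t, F (upd t j per) = F (upd t j 0)) -> \int[mu n]_t G t = 0.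
Proof.
elim: n j F G => [[]//|n ih] j F G bG cG dG pG.
case: (unliftP ord0 j) => [j'|] jE; subst j.
  rewrite torus_fubini1//.
  rewrite (_ : (fun x => _) = fun=> 0) ?Rintegral_cst ?mul0r//.
  apply/funext => x; apply: (ih j' (fun t => F (tcons x t))).
  - exact: bmf_comp (measurable_tcons x) bG.
  - by move=> t; have := cG (tcons x t); under eq_fun do rewrite upd_tconsS.
  - by move=> t r; have := dG (tcons x t) r; rewrite upd_tconsS; under eq_fun do rewrite upd_tconsS.
  - by move=> t; have := pG (tcons x t); rewrite !upd_tconsS.
rewrite torus_fubini2//.
rewrite (_ : (fun x => _) = fun=> 0) ?Rintegral_cst ?mul0r//.
apply/funext => t; apply: (@circle_ftc _ _ (fun x => F (tcons x t))).
- by have := cG (tcons 0 t); under eq_fun do rewrite upd_tcons0.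
- by move=> r; have := dG (tcons 0 t) r; rewrite upd_tcons0; under eq_fun do rewrite upd_tcons0.
- by have := pG (tcons 0 t); rewrite !upd_tcons0.
Qed.

End torus_integral.

(** * Trigonometric integrals *)

Section real_integrable.
Context {R : realType} d {X : measurableType d} (m : {finite_measure set X -> \bar R}).
Implicit Types f g : X -> R.

Definition rint f := m.-integrable setT (EFin \o f).

Lemma rint_mf f : rint f -> measurable_fun setT f.
Proof. by case/integrableP => /measurable_EFinP. Qed.

Lemma rint_bmf f : bmf f -> rint f. Proof. exact: bmf_integrable. Qed.

Lemma rint_cst r : rint (fun=> r). Proof. by apply: rint_bmf; exact: bmf_cst. Qed.

Lemma rint_dom f g : measurable_fun setT f -> (forall t, `|f t| <= g t) -> rint g -> rint f.
Proof.
move=> mf fg ig; apply: (le_integrable measurableT _ _ ig).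
  by apply/measurable_EFinP.
by move=> t _ /=; rewrite lee_fin (le_trans (fg t))// ler_norm.
Qed.

Lemma rintD f g : rint f -> rint g -> rint (fun t => f t + g t).
Proof. by move=> hf hg; exact: (integrableD measurableT hf hg). Qed.

Lemma rintZ c f : rint f -> rint (fun t => c * f t).
Proof. by move=> hf; exact: (integrableZl measurableT c hf). Qed.

Lemma rintN f : rint f -> rint (fun t => - f t).
Proof. by move=> /(rintZ (-1)); under eq_fun do rewrite mulN1r. Qed.

Lemma rintB f g : rint f -> rint g -> rint (fun t => f t - g t).
Proof. by move=> hf /rintN; exact: rintD. Qed.

Lemma rint_M f g : bmf f -> rint g -> rint (fun t => f t * g t).
Proof.
move=> [mf [B hB]] hg; apply: (@rint_dom _ (fun t => B * `|g t|)).
- by apply: measurable_funM => //; exact: rint_mf.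
- by move=> t; rewrite normrM ler_wpM2r.
- apply: rintZ; apply: (le_integrable measurableT _ _ hg) => /=.
    by apply/measurable_EFinP; apply: measurableT_comp => //; exact: rint_mf.
  by move=> t _; rewrite lee_fin normr_id.
Qed.

Local Notation I f := (\int[m]_t f t).

Lemma RintD f g : rint f -> rint g -> I (fun t => f t + g t) = I f + I g.
Proof. by move=> hf hg; exact: RintegralD. Qed.

Lemma RintB f g : rint f -> rint g -> I (fun t => f t - g t) = I f - I g.
Proof. by move=> hf hg; exact: RintegralB. Qed.

Lemma RintZ c f : rint f -> I (fun t => c * f t) = c * I f.
Proof. by move=> hf; exact: RintegralZl. Qed.

Lemma RintN f : rint f -> I (fun t => - f t) = - I f.
Proof.
by move=> hf; under eq_Rintegral do rewrite -mulN1r; rewrite RintZ// mulN1r.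
Qed.

Lemma Rint0 : I (fun=> 0) = 0. Proof. by rewrite Rintegral_cst// mul0r. Qed.

Lemma Rint_le f g : rint f -> rint g -> (forall t, f t <= g t) -> I f <= I g.
Proof. by move=> hf hg fg; apply: le_Rintegral => // t _; exact: fg. Qed.

Lemma Rint_ge0 f : (forall t, 0 <= f t) -> 0 <= I f.
Proof. by move=> h; apply: Rintegral_ge0 => t _; exact: h. Qed.

Lemma Rint_EFin f : rint f -> (\int[m]_t (f t)%:E)%E = (I f)%:E.
Proof. by move=> hf; rewrite /Rintegral fineK//; exact: integrable_fin_num. Qed.

End real_integrable.

Section trigonometric.
Context {R : realType} {d : nat}.
Local Notation mu := (torus_measure R d).
Local Notation point := 'rV[R]_d.
Local Notation Z := 'rV[int]_d.
Local Notation C := R[i].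
Local Notation tp := (@torus_point R d).
Local Notation per := (2 * pi : R).
Local Notation T := (d.-tuple (measurableTypeR R)).
Implicit Types (u v : point -> C) (k : Z).

Definition dd : R := per ^+ d.

Lemma dd_gt0 : 0 < dd. Proof. by rewrite exprn_gt0// per_gt0. Qed.

Lemma expiD (a b : R) : expi (a + b) = expi a * expi b :> C.
Proof. by rewrite /expi cosD sinD; simpc; congr (_ +i* _)%C; ring. Qed.

Lemma expi0 : expi 0 = 1 :> C. Proof. by rewrite /expi cos0 sin0. Qed.

Lemma nc_expi (a : R) : nc (expi a) = 1.
Proof. by rewrite nc_def /= cos2Dsin2 sqrtr1. Qed.

Lemma expiN (a : R) : expi (- a) = (expi a)^*%C.
Proof. by rewrite /expi cosN sinN. Qed.

Lemma expi_per (z : int) : expi (per * z%:~R) = 1 :> C.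
Proof.
have h1 : expi per = 1 :> C.
  have -> : per = pi + pi by rewrite mulr_natl mulr2n.
  by rewrite /expi cosD sinD cospi sinpi mulN1r opprK !mulr0 !mul0r subr0 addr0.
have hn (n : nat) : expi (per * n%:R) = 1 :> C.
  elim: n => [|n ih]; first by rewrite mulr0 expi0.
  by rewrite -[n.+1%:R]natr1 mulrDr mulr1 expiD ih h1 mulr1.
case: z => n; first exact: hn.
by rewrite NegzE intrN mulrN expiN hn rmorph1.
Qed.

Lemma dotkD k l (x : point) : dotk (k + l) x = dotk k x + dotk l x.
Proof. by rewrite /dotk -big_split; apply: eq_bigr => j _; rewrite mxE intrD mulrDl. Qed.

Lemma dotkN k (x : point) : dotk (- k) x = - dotk k x.
Proof. by rewrite /dotk -sumrN; apply: eq_bigr => j _; rewrite mxE intrN mulNr. Qed.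

Lemma dotk0 (x : point) : dotk 0 x = 0.
Proof. by rewrite /dotk big1// => j _; rewrite mxE mul0r. Qed.

Lemma dotkDr k (x y : point) : dotk k (x + y) = dotk k x + dotk k y.
Proof. by rewrite /dotk -big_split; apply: eq_bigr => j _; rewrite mxE mulrDr. Qed.

Lemma dotkZr k (a : R) (x : point) : dotk k (a *: x) = a * dotk k x.
Proof. by rewrite /dotk mulr_sumr; apply: eq_bigr => j _; rewrite mxE mulrCA. Qed.

Lemma dotk_delta k j : dotk k (delta_mx 0 j : point) = (k 0 j)%:~R.
Proof.
rewrite /dotk (bigD1 j)//= mxE !eqxx mulr1 big1 ?addr0// => i ij.
by rewrite mxE (negbTE ij) andbF mulr0.
Qed.

Definition ek k (x : point) : C := expi (dotk k x).

Lemma ek_per k : torus_periodic (ek k).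
Proof.
by move=> x j; rewrite /ek dotkDr dotkZr dotk_delta expiD expi_per mulr1.
Qed.

Lemma ekD k l x : ek (k + l) x = ek k x * ek l x.
Proof. by rewrite /ek dotkD expiD. Qed.

Lemma ekN k x : ek (- k) x = (ek k x)^*%C.
Proof. by rewrite /ek dotkN expiN. Qed.

Lemma ek0 x : ek 0 x = 1. Proof. by rewrite /ek dotk0 expi0. Qed.

Lemma measurable_dotk k : measurable_fun setT (fun t : T => dotk k (tp t)).
Proof.
rewrite /dotk; apply: measurable_sum => j; apply: measurable_funM => //.
under eq_fun do rewrite mxE.
exact: measurable_tnth.
Qed.

Definition mfC u := measurable_fun setT (re u \o tp) /\ measurable_fun setT (im u \o tp).

Lemma mfC_ek k : mfC (ek k).
Proof.
split; rewrite /comp /re /im /ek /expi /=.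
  by have [] := bmf_cos (measurable_dotk k).
by have [] := bmf_sin (measurable_dotk k).
Qed.

Lemma mfC_toC f : measurable_fun setT (f \o tp) -> mfC (toC f).
Proof. by move=> mf; split => //; exact: measurable_cst. Qed.

Lemma mfC_cst c : mfC (fun=> c).
Proof. by split; exact: measurable_cst. Qed.

Lemma mfCD u v : mfC u -> mfC v -> mfC (fun x => u x + v x).
Proof.
move=> [a b] [a' b']; split.
  have -> : re (fun x => u x + v x) \o tp = (re u \o tp) \+ (re v \o tp).
    by apply/funext => t /=; rewrite /re raddfD.
  exact: measurable_funD.
have -> : im (fun x => u x + v x) \o tp = (im u \o tp) \+ (im v \o tp).
  by apply/funext => t /=; rewrite /im raddfD.
exact: measurable_funD.
Qed.

Lemma ReM (a b : C) : complex.Re (a * b) = complex.Re a * complex.Re b - complex.Im a * complex.Im b.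
Proof. by case: a => ? ?; case: b. Qed.

Lemma ImM (a b : C) : complex.Im (a * b) = complex.Re a * complex.Im b + complex.Im a * complex.Re b.
Proof. by case: a => ? ?; case: b. Qed.

Lemma mfCM u v : mfC u -> mfC v -> mfC (fun x => u x * v x).
Proof.
move=> [a b] [a' b']; split.
  have -> : re (fun x => u x * v x) \o tp =
      ((re u \o tp) \* (re v \o tp)) \- ((im u \o tp) \* (im v \o tp)).
    by apply/funext => t /=; rewrite /re ReM.
  by apply: measurable_funB; exact: measurable_funM.
have -> : im (fun x => u x * v x) \o tp =
    ((re u \o tp) \* (im v \o tp)) \+ ((im u \o tp) \* (re v \o tp)).
  by apply/funext => t /=; rewrite /im ImM.
by apply: measurable_funD; exact: measurable_funM.
Qed.

Lemma mfCJ u : mfC u -> mfC (fun x => (u x)^*%C).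
Proof.
move=> [a b]; split.
  have -> : re (fun x => (u x)^*%C) = re u by apply/funext => x; rewrite /re; case: (u x).
  exact: a.
have -> : im (fun x => (u x)^*%C) \o tp = \- (im u \o tp).
  by apply/funext => t /=; rewrite /im; case: (u _).
exact: measurable_funN.
Qed.

Lemma mf_nc2 u : mfC u -> measurable_fun setT (fun t => nc (u (tp t)) ^+ 2).
Proof.
move=> [a b]; under eq_fun do rewrite nc_sqr.
by apply: measurable_funD; apply: measurable_funX.
Qed.

Definition cint u := rint mu (re u \o tp) /\ rint mu (im u \o tp).

Lemma cintD u v : cint u -> cint v -> cint (fun x => u x + v x).
Proof.
move=> [a b] [a' b']; split.
  by have := rintD a a'; under [X in rint _ X]eq_fun do rewrite -raddfD.
by have := rintD b b'; under [X in rint _ X]eq_fun do rewrite -raddfD.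
Qed.

Lemma cintZ c u : cint u -> cint (fun x => c * u x).
Proof.
move=> [a b]; split.
  have := rintB (rintZ (complex.Re c) a) (rintZ (complex.Im c) b).
  by under [X in rint _ X]eq_fun do rewrite -ReM.
have := rintD (rintZ (complex.Re c) b) (rintZ (complex.Im c) a).
by under [X in rint _ X]eq_fun do rewrite -ImM.
Qed.

Lemma cint0 : cint (fun=> 0). Proof. by split; exact: rint_cst. Qed.

Lemma cint_sum (I : Type) (r : seq I) (F : I -> point -> C) :
  (forall i, cint (F i)) -> cint (fun x => \sum_(i <- r) F i x).
Proof.
move=> h; elim: r => [|i r ih].
  by under [X in cint X]eq_fun do rewrite big_nil; exact: cint0.
by under [X in cint X]eq_fun do rewrite big_cons; exact: cintD.
Qed.

Local Notation IC := (@torus_intC R d).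

Lemma eq_IC u v : (forall x, u x = v x) -> IC u = IC v.
Proof. by move=> h; congr (@torus_intC _ _); apply/funext. Qed.

Lemma ICD u v : cint u -> cint v -> IC (fun x => u x + v x) = IC u + IC v.
Proof.
move=> [a b] [a' b']; rewrite /torus_intC /torus_int.
have -> (x y z w : R) : ((x +i* y) + (z +i* w) = (x + z) +i* (y + w))%C by [].
congr (_ +i* _)%C.
  by rewrite -RintD//; apply: eq_Rintegral => t _; rewrite /re raddfD.
by rewrite -RintD//; apply: eq_Rintegral => t _; rewrite /im raddfD.
Qed.

Lemma ICZ c u : cint u -> IC (fun x => c * u x) = c * IC u.
Proof.
move=> [a b]; rewrite /torus_intC /torus_int; case: c => c1 c2; simpc.
congr (_ +i* _)%C.
  rewrite -(RintZ c1 a) -(RintZ c2 b) -RintB; [|exact: rintZ..].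
  by apply: eq_Rintegral => t _; rewrite /re ReM.
rewrite -(RintZ c1 b) -(RintZ c2 a) -RintD; [|exact: rintZ..].
by apply: eq_Rintegral => t _; rewrite /im ImM.
Qed.

Lemma ICN u : cint u -> IC (fun x => - u x) = - IC u.
Proof. by move=> h; rewrite -mulN1r -ICZ//; apply: eq_IC => x; rewrite mulN1r. Qed.

Lemma cintN u : cint u -> cint (fun x => - u x).
Proof. by move=> /(cintZ (-1)); under [X in cint X]eq_fun do rewrite mulN1r. Qed.

Lemma IC0 : IC (fun=> 0) = 0.
Proof. by rewrite /torus_intC /torus_int !Rint0. Qed.

Lemma IC_sum (I : Type) (r : seq I) (F : I -> point -> C) : (forall i, cint (F i)) ->
  IC (fun x => \sum_(i <- r) F i x) = \sum_(i <- r) IC (F i).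
Proof.
move=> h; elim: r => [|i r ih].
  by rewrite big_nil; apply: (etrans _ IC0); apply: eq_IC => x; rewrite big_nil.
rewrite big_cons -ih -ICD//; last exact: cint_sum.
by apply: eq_IC => t; rewrite big_cons.
Qed.

Lemma ICJ u : cint u -> IC (fun x => (u x)^*%C) = (IC u)^*%C.
Proof.
move=> [a b]; rewrite /torus_intC /torus_int /=; congr (_ +i* _)%C.
  by apply: eq_Rintegral => t _; rewrite /re; case: (u _).
by rewrite -(RintN b); apply: eq_Rintegral => t _; rewrite /im /=; case: (u _).
Qed.

Lemma dotk_upd k t j r : dotk k (tp (upd t j r)) =
  \sum_(i | i != j) (k 0 i)%:~R * tnth t i + (k 0 j)%:~R * r.
Proof.
rewrite /dotk (bigD1 j)//= mxE tnth_upd eqxx addrC; congr (_ + _).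
by apply: eq_bigr => i ij; rewrite mxE tnth_upd (negbTE ij).
Qed.

(** If some k_j is nonzero, the real and imaginary parts are derivatives in direction [j] of
    periodic functions. *)
Lemma IC_ek k : IC (ek k) = if k == 0 then (dd%:C)%C else 0.
Proof.
case: ifPn => [/eqP ->|k0].
  rewrite (@eq_IC (ek 0) (fun=> 1)) => [|x]; last exact: ek0.
  rewrite /torus_intC /torus_int /re /im /= Rint0 Rintegral_cst// mul1r.
  by congr (_ +i* _)%C; exact: (congr1 fine (@torus_setT R d)).
have [j kj] : exists j, k 0 j != 0.
  apply/existsP; rewrite -[X in is_true X]negbK negb_exists; apply: contraNN k0 => /forallP h.
  by apply/eqP/rowP => j; rewrite mxE; have := h j; rewrite negbK => /eqP.
have kj0 : ((k 0 j)%:~R : R) != 0 by rewrite intr_eq0.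
have per_upd t r : expi (dotk k (tp (upd t j (per + r)))) = expi (dotk k (tp (upd t j r))) :> C.
  by rewrite !dotk_upd mulrDr addrCA expiD (mulrC (_%:~R)) expi_per mul1r.
rewrite /torus_intC; congr (_ +i* _)%C.
  apply: (@torus_div _ _ j (fun t => (k 0 j)%:~R^-1 * sin (dotk k (tp t)))).
  - exact: bmf_cos (measurable_dotk k).
  - move=> t; rewrite /re /ek /expi /=; under eq_fun do rewrite dotk_upd.
    move=> r; apply: continuous_comp; last exact: continuous_cos.
    apply: cvgD; first exact: cvg_cst.
    by apply: cvgM; [exact: cvg_cst|exact: cvg_id].
  - move=> t r; rewrite /re /ek /expi /= dotk_upd; under eq_fun do rewrite dotk_upd.
    apply: is_derive_eq; rewrite /GRing.scale /= add0r mul1r mulr1.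
    by rewrite mulrC -mulrA mulfV// mulr1.
  - move=> t; have := per_upd t 0; rewrite addr0 => /(congr1 (@complex.Im R)) /= ->.
    by [].
apply: (@torus_div _ _ j (fun t => - ((k 0 j)%:~R^-1 * cos (dotk k (tp t))))).
- exact: bmf_sin (measurable_dotk k).
- move=> t; rewrite /im /ek /expi /=; under eq_fun do rewrite dotk_upd.
  move=> r; apply: continuous_comp; last exact: continuous_sin.
  apply: cvgD; first exact: cvg_cst.
  by apply: cvgM; [exact: cvg_cst|exact: cvg_id].
- move=> t r; rewrite /im /ek /expi /= dotk_upd; under eq_fun do rewrite dotk_upd.
  apply: is_derive_eq; rewrite /GRing.scale /= add0r mul1r mulr1.
  by rewrite mulNr mulrN opprK mulrC -mulrA mulfV// mulr1.
- by move=> t; have := per_upd t 0; rewrite addr0 => /(congr1 (@complex.Re R)) /= ->.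
Qed.

End trigonometric.

(** * Fourier coefficients of square integrable functions *)

Section square_integrable.
Context {R : realType} {d : nat}.
Local Notation mu := (torus_measure R d).
Local Notation point := 'rV[R]_d.
Local Notation Z := 'rV[int]_d.
Local Notation C := R[i].
Local Notation tp := (@torus_point R d).
Local Notation IC := (@torus_intC R d).
Local Notation dd := (@dd R d).
Implicit Types (u v w : point -> C) (k : Z).

Lemma perD u v : torus_periodic u -> torus_periodic v -> torus_periodic (fun x => u x + v x).
Proof. by move=> a b x j; rewrite a b. Qed.

Lemma perM u v : torus_periodic u -> torus_periodic v -> torus_periodic (fun x => u x * v x).
Proof. by move=> a b x j; rewrite a b. Qed.

Lemma perJ u : torus_periodic u -> torus_periodic (fun x => (u x)^*%C).
Proof. by move=> a x j; rewrite a. Qed.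

Lemma per_cst (c : C) : torus_periodic (fun _ : point => c).
Proof. by []. Qed.

Lemma L2P u : L2 u <-> [/\ torus_periodic u, mfC u & rint mu (fun t => nc (u (tp t)) ^+ 2)].
Proof.
split=> [[p a b h]|[p [a b] h]].
  split => //; apply/integrableP; split.
    by apply/measurable_EFinP; apply: mf_nc2; split.
  under eq_integral do rewrite /= ger0_norm ?sqr_ge0//.
  exact: h.
split => //; move/integrableP : h => [_].
by under eq_integral do rewrite /= ger0_norm ?sqr_ge0//.
Qed.

Definition N2 u : R := \int[mu]_t nc (u (tp t)) ^+ 2.

Lemma N2_ge0 u : 0 <= N2 u. Proof. by apply: Rint_ge0 => t; exact: sqr_ge0. Qed.

Lemma L2_int u : L2 u -> (\int[mu]_t (nc (u (tp t)) ^+ 2)%:E)%E = (N2 u)%:E.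
Proof. by move=> /L2P[_ _ h]; rewrite Rint_EFin. Qed.

Lemma cint_dom u (g : _ -> R) : mfC u -> rint mu g -> (forall t, nc (u (tp t)) <= g t) -> cint u.
Proof.
move=> [a b] hg h; split; apply: (rint_dom _ _ hg) => // t.
  exact: le_trans (nc_ge_Re _) (h t).
exact: le_trans (nc_ge_Im _) (h t).
Qed.

Lemma L2_mul u v : L2 u -> L2 v -> cint (fun x => u x * v x).
Proof.
move=> /L2P[_ mu' hu] /L2P[_ mv hv].
apply: (cint_dom (mfCM mu' mv) (rintD hu hv)) => t.
rewrite ncM; have := nc_ge0 (u (tp t)); have := nc_ge0 (v (tp t)).
have := sqr_ge0 (nc (u (tp t)) - nc (v (tp t))); nra.
Qed.

Lemma L2J u : L2 u -> L2 (fun x => (u x)^*%C).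
Proof.
move=> /L2P[a b c]; apply/L2P; split; [exact: perJ|exact: mfCJ|].
by under [X in rint _ X]eq_fun do rewrite nc_conj.
Qed.

Lemma L2D u v : L2 u -> L2 v -> L2 (fun x => u x + v x).
Proof.
move=> /L2P[a b c] /L2P[a' b' c']; apply/L2P; split; [exact: perD|exact: mfCD|].
apply: (rint_dom _ _ (rintD (rintZ 2 c) (rintZ 2 c'))).
  exact: mf_nc2 (mfCD b b').
move=> t; rewrite ger0_norm ?sqr_ge0//.
have := ncD (u (tp t)) (v (tp t)); have := nc_ge0 (u (tp t) + v (tp t)).
have := sqr_ge0 (nc (u (tp t)) - nc (v (tp t))); nra.
Qed.

Lemma L2_bddM w B u : torus_periodic w -> mfC w -> (forall x, nc (w x) <= B) ->
  L2 u -> L2 (fun x => w x * u x).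
Proof.
move=> p m h /L2P[a b c]; apply/L2P; split; [exact: perM|exact: mfCM|].
apply: (rint_dom _ _ (rintZ (B ^+ 2) c)).
  exact: mf_nc2 (mfCM m b).
move=> t; rewrite ger0_norm ?sqr_ge0// ncM exprMn ler_wpM2r ?sqr_ge0//.
by rewrite ler_sqr ?nnegrE ?nc_ge0 ?h// (le_trans (nc_ge0 (w 0))).
Qed.

Lemma L2_cst c : L2 (fun _ : point => c).
Proof. by apply/L2P; split; [exact: per_cst|exact: mfC_cst|exact: rint_cst]. Qed.

Lemma L2_bdd w B : torus_periodic w -> mfC w -> (forall x, nc (w x) <= B) -> L2 w.
Proof.
move=> a b h; have := L2_bddM a b h (L2_cst 1).
by under [X in L2 X]eq_fun do rewrite mulr1.
Qed.

Lemma L2Z c u : L2 u -> L2 (fun x => c * u x).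
Proof. by move=> hu; apply: (@L2_bddM (fun=> c) (nc c)) => //; exact: mfC_cst. Qed.

Lemma L2N u : L2 u -> L2 (fun x => - u x).
Proof. by move=> /(L2Z (-1)); under [X in L2 X]eq_fun do rewrite mulN1r. Qed.

Lemma L2B u v : L2 u -> L2 v -> L2 (fun x => u x - v x).
Proof. by move=> h /L2N; exact: L2D. Qed.

Lemma L2_sum (I : Type) (r : seq I) (F : I -> point -> C) :
  (forall i, L2 (F i)) -> L2 (fun x => \sum_(i <- r) F i x).
Proof.
move=> h; elim: r => [|i r ih].
  by under [X in L2 X]eq_fun do rewrite big_nil; exact: L2_cst.
by under [X in L2 X]eq_fun do rewrite big_cons; exact: L2D.
Qed.

Lemma L2_ek k : L2 (ek k : point -> C).
Proof.
apply: (@L2_bdd _ 1); [exact: ek_per|exact: mfC_ek|].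
by move=> x; rewrite nc_expi.
Qed.

Lemma L2_cint u : L2 u -> cint u.
Proof. by move=> /L2_mul/(_ (L2_cst 1)); under [X in cint X]eq_fun do rewrite mulr1. Qed.

Lemma fourierE u k : fourier u k = IC (fun x => u x * ek (- k) x).
Proof. by apply: eq_IC => x; rewrite /ek dotkN. Qed.

Lemma eq_fourier u v k : (forall x, u x = v x) -> fourier u k = fourier v k.
Proof. by move=> h; apply: eq_IC => x; rewrite h. Qed.

Lemma fourierD u v k : L2 u -> L2 v ->
  fourier (fun x => u x + v x) k = fourier u k + fourier v k.
Proof.
move=> hu hv; rewrite !fourierE -ICD; [|exact: L2_mul hu (L2_ek _)|exact: L2_mul hv (L2_ek _)].
by apply: eq_IC => x; rewrite mulrDl.
Qed.

Lemma fourierZ c u k : L2 u -> fourier (fun x => c * u x) k = c * fourier u k.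
Proof.
move=> hu; rewrite !fourierE -ICZ; last exact: L2_mul hu (L2_ek _).
by apply: eq_IC => x; rewrite mulrA.
Qed.

Lemma fourierB u v k : L2 u -> L2 v ->
  fourier (fun x => u x - v x) k = fourier u k - fourier v k.
Proof.
move=> hu hv; rewrite -mulN1r -fourierZ// -fourierD//; last exact: L2Z.
by apply: eq_fourier => x; rewrite mulN1r.
Qed.

Lemma fourier0 k : fourier (fun _ : point => 0 : C) k = 0.
Proof. by rewrite fourierE; apply: (etrans _ (@IC0 R d)); apply: eq_IC => x; rewrite mul0r. Qed.

Lemma fourier_sum (I : Type) (r : seq I) (F : I -> point -> C) k : (forall i, L2 (F i)) ->
  fourier (fun x => \sum_(i <- r) F i x) k = \sum_(i <- r) fourier (F i) k.
Proof.
move=> h; elim: r => [|i r ih].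
  by rewrite big_nil; apply: (etrans _ (fourier0 k)); apply: eq_fourier => x; rewrite big_nil.
rewrite big_cons -ih -fourierD//; last exact: L2_sum.
by apply: eq_fourier => x; rewrite big_cons.
Qed.

Lemma fourierJ u k : L2 u -> fourier (fun x => (u x)^*%C) k = (fourier u (- k))^*%C.
Proof.
move=> hu; rewrite !fourierE -ICJ; last exact: L2_mul hu (L2_ek _).
by apply: eq_IC => x; rewrite rmorphM opprK /= ekN.
Qed.

Lemma fourier_ekM p u k : fourier (fun x => ek p x * u x) k = fourier u (k - p).
Proof.
by rewrite !fourierE; apply: eq_IC => x; rewrite opprB ekD; ring.
Qed.

Lemma fourier_ek p k : fourier (ek p : point -> C) k = if k == p then (dd%:C)%C else 0.
Proof.
rewrite fourierE; have -> : (k == p) = (p - k == 0) by rewrite subr_eq0 eq_sym.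
by rewrite -IC_ek; apply: eq_IC => x; rewrite -ekD.
Qed.

Lemma innerE u v : innerL2 u v = IC (fun x => u x * (v x)^*%C).
Proof. by []. Qed.

Definition trigp (A : seq Z) (g : Z -> C) : point -> C :=
  fun x => \sum_(k <- A) (dd^-1%:C)%C * g k * ek k x.

Lemma L2_trigp A g : L2 (trigp A g).
Proof. by apply: L2_sum => k; apply: L2Z; exact: L2_ek. Qed.

Lemma ddC_unit : (dd^-1%:C * dd%:C)%C = 1 :> C.
Proof. by rewrite -rmorphM mulVf ?rmorph1// gt_eqF// dd_gt0. Qed.

Lemma fourier_trigp A g k : uniq A -> fourier (trigp A g) k = if k \in A then g k else 0.
Proof.
move=> uA; rewrite fourier_sum; last by move=> l; apply: L2Z; exact: L2_ek.
under eq_bigr do rewrite (fourierZ _ _ (L2_ek _)) fourier_ek.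
case: ifPn => kA.
  rewrite (bigD1_seq k)//= eqxx big1 ?addr0.
    by rewrite mulrAC ddC_unit mul1r.
  by move=> l lk; rewrite eq_sym (negbTE lk) mulr0.
rewrite big_seq big1// => l lA; case: eqP => [e|_]; last by rewrite mulr0.
by rewrite e lA in kA.
Qed.

Lemma inner_trigp u A g : L2 u ->
  innerL2 u (trigp A g) = (dd^-1%:C)%C * \sum_(k <- A) fourier u k * (g k)^*%C.
Proof.
move=> hu; rewrite innerE.
transitivity (IC (fun x => \sum_(k <- A) ((dd^-1%:C)%C * (g k)^*%C) * (u x * ek (- k) x))).
  apply: eq_IC => x; rewrite rmorph_sum mulr_sumr; apply: eq_bigr => k _ /=.
  have e (a b c : C) : (a * b * c)^*%C = a^*%C * b^*%C * c^*%C by rewrite !rmorphM.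
  by rewrite [((_ * _ * _)^*)%C]e conjc_real ekN; ring.
have hk k : cint (fun x => u x * ek (- k) x) by exact: L2_mul hu (L2_ek _).
rewrite IC_sum; last by move=> k; exact: cintZ.
rewrite mulr_sumr; apply: eq_bigr => k _; rewrite ICZ// fourierE.
by rewrite -mulrA; congr (_ * _); rewrite mulrC.
Qed.

Lemma N2_inner u : N2 u = complex.Re (innerL2 u u).
Proof.
by rewrite innerE /torus_intC /=; apply: eq_Rintegral => t _; rewrite /re Re_mulconj.
Qed.

Lemma N2D u v : L2 u -> L2 v ->
  N2 (fun x => u x + v x) = N2 u + 2 * complex.Re (innerL2 u v) + N2 v.
Proof.
move=> hu hv; rewrite !N2_inner !innerE.
have huu := L2_mul hu (L2J hu); have huv := L2_mul hu (L2J hv).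
have hvu := L2_mul hv (L2J hu); have hvv := L2_mul hv (L2J hv).
have e := etrans (ICD (cintD huu huv) (cintD hvu hvv)) (congr2 +%R (ICD huu huv) (ICD hvu hvv)).
rewrite (@eq_IC _ _ _ (fun x => (u x * (u x)^*%C + u x * (v x)^*%C) + (v x * (u x)^*%C + v x * (v x)^*%C))); last first.
  by move=> x; rewrite rmorphD /=; ring.
rewrite e (@eq_IC _ _ (fun x => v x * (u x)^*%C) (fun x => (u x * (v x)^*%C)^*%C)); last first.
  by move=> x; rewrite rmorphM /= conjcK mulrC.
rewrite ICJ//; move: (IC _) (IC _) (IC _) => [a a'] [b b'] [c c'] /=; ring.
Qed.

Lemma ReZ (a : R) (z : C) : complex.Re ((a%:C)%C * z) = a * complex.Re z.
Proof. by case: z => x y /=; rewrite mul0r subr0. Qed.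

Lemma Re_sum (I : Type) (A : seq I) (F : I -> C) :
  complex.Re (\sum_(i <- A) F i) = \sum_(i <- A) complex.Re (F i).
Proof. by rewrite raddf_sum. Qed.

Lemma innerN u v : L2 u -> L2 v -> innerL2 u (fun x => - v x) = - innerL2 u v.
Proof.
move=> hu hv; rewrite !innerE -ICN; last exact: L2_mul hu (L2J hv).
by apply: eq_IC => x; rewrite rmorphN mulrN.
Qed.

Lemma N2N u : N2 (fun x => - u x) = N2 u.
Proof. by apply: eq_Rintegral => t _; rewrite ncN. Qed.

Lemma N2B u v : L2 u -> L2 v ->
  N2 (fun x => u x - v x) = N2 u - 2 * complex.Re (innerL2 u v) + N2 v.
Proof.
move=> hu hv; rewrite N2D//; last exact: L2N.
by rewrite N2N innerN// raddfN /= mulrN.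
Qed.

Lemma N2_trigp A g : uniq A -> N2 (trigp A g) = dd^-1 * \sum_(k <- A) nc (g k) ^+ 2.
Proof.
move=> uA; rewrite N2_inner inner_trigp; last exact: L2_trigp.
rewrite big_seq; under eq_bigr => k kA do rewrite fourier_trigp// kA.
rewrite -big_seq ReZ Re_sum; congr (_ * _).
by apply: eq_bigr => k _; rewrite Re_mulconj.
Qed.

(** Expansion of the nonnegative squared distance from [u] to a partial Fourier sum; [dd] appears
    because the coefficients are not normalised. *)
Lemma bessel u : L2 u -> Hb 0 (fourier u) (Num.sqrt (dd * N2 u)).
Proof.
move=> hu; split; first exact: sqrtr_ge0.
move=> A uA; rewrite sqr_sqrtr ?mulr_ge0 ?N2_ge0 ?(ltW dd_gt0)//.
under eq_bigr do rewrite wt0 mul1r.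
have := N2_ge0 (fun x => u x - trigp A (fourier u) x).
rewrite N2B//; last exact: L2_trigp.
rewrite N2_trigp// inner_trigp//; move: (fourier u) => g.
rewrite ReZ Re_sum (eq_bigr (fun k => nc (g k) ^+ 2)); last by move=> k _; rewrite Re_mulconj.
move=> h; rewrite -(ler_pdivrMl _ _ (@dd_gt0 R d)).
by move: h; set a := dd^-1; lra.
Qed.

End square_integrable.

(** * Uniqueness of Fourier coefficients *)

Section fourier_uniqueness.
Context {R : realType} {d : nat}.
Local Notation mu := (torus_measure R d).
Local Notation mR := (measurableTypeR R).
Local Notation T := (d.-tuple mR).
Local Notation Z := 'rV[int]_d.
Local Notation tp := (@torus_point R d).
Local Notation I f := (\int[mu]_t f t).
Variables (h : T -> R) (hh : rint mu h).
Implicit Types (phi psi : T -> R) (k : Z).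

(** The phase [a] covers sines and cosines at once, and products of such functions are sums of such
    functions. *)
Let cs k (a : R) (t : T) : R := cos (dotk k (tp t) + a).

Let bmf_cs k a : bmf (cs k a).
Proof. by apply: bmf_cos; apply: measurable_funD => //; exact: measurable_dotk. Qed.

(* [Mul] is an algebra containing the cosines and closed under bounded pointwise
   limits, hence it contains the indicators of all measurable sets. *)
Let Hz phi := bmf phi /\ forall k a, I (fun t => h t * phi t * cs k a t) = 0.

Let Mul psi := bmf psi /\ forall phi, Hz phi -> Hz (fun t => psi t * phi t).

Let rint_h phi k a : bmf phi -> rint mu (fun t => h t * phi t * cs k a t).
Proof.
move=> bp; have := rint_M (bmfM bp (bmf_cs k a)) hh.
by under [X in rint _ X]eq_fun do rewrite mulrC mulrA.
Qed.

Let eqI f g : (forall t, f t = g t) -> I f = I g.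
Proof. by move=> fg; apply: eq_Rintegral => t _; exact: fg. Qed.

Let Mul_cst (c : R) : Mul (fun=> c).
Proof.
split=> [|phi [bp hp]]; first exact: bmf_cst.
split=> [|k a]; first by apply: bmfM => //; exact: bmf_cst.
rewrite (@eqI _ (fun t => c * (h t * phi t * cs k a t))) => [|t]; last by ring.
by rewrite (RintZ c (rint_h k a bp)) hp mulr0.
Qed.

Let MulD psi psi' : Mul psi -> Mul psi' -> Mul (fun t => psi t + psi' t).
Proof.
move=> [b1 h1] [b2 h2]; split=> [|phi Hp]; first exact: bmfD.
have [c1 e1] := h1 _ Hp; have [c2 e2] := h2 _ Hp.
split=> [|k a]; first by apply: bmfM (bmfD b1 b2) _; case: Hp.
rewrite (@eqI _ (fun t => h t * (psi t * phi t) * cs k a t + h t * (psi' t * phi t) * cs k a t)) => [|t]; last by ring.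
by rewrite (RintD (rint_h k a c1) (rint_h k a c2)) e1 e2 addr0.
Qed.

Let MulM psi psi' : Mul psi -> Mul psi' -> Mul (fun t => psi t * psi' t).
Proof.
move=> [b1 h1] [b2 h2]; split=> [|phi Hp]; first exact: bmfM.
by have := h1 _ (h2 _ Hp); under [X in Hz X]eq_fun do rewrite mulrA.
Qed.

Let eqMul psi psi' : (forall t, psi t = psi' t) -> Mul psi -> Mul psi'.
Proof. by move=> /funext ->. Qed.

Let Mul_lim (psin : nat -> T -> R) psi B : (forall n, Mul (psin n)) ->
  (forall n t, `|psin n t| <= B) -> (forall t, psin ^~ t @ \oo --> psi t) -> Mul psi.
Proof.
move=> hn hB hlim.
have mpsi : measurable_fun setT psi.
  apply: (measurable_fun_cvg (h := psin)) => [n|t _]; last exact: hlim.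
  by case: (hn n) => -[].
have bpsi t : `|psi t| <= B.
  rewrite -subr_le0; apply: to0_const; apply: to0_le (cvg_to0 (hlim t)) => n.
  have := ler_normD (psi t - psin n t) (psin n t); rewrite subrK (distrC (psi t)).
  by have := hB n t; lra.
have bmpsi : bmf psi by split => //; exists B.
split=> // phi Hp; have [[mphi [B' hB']] hp0] := Hp.
split=> [|k a]; first by apply: bmfM => //; case: Hp.
pose f n t := (h t * (psin n t * phi t) * cs k a t)%:E.
have i0 n : (\int[mu]_t f n t)%E = 0%E.
  have [bn hn'] := hn n; have [c e] := hn' _ Hp.
  by rewrite /f (Rint_EFin (rint_h k a c)) e.
have habs : rint mu (fun t => B * B' * `|h t|).
  by apply: rintZ; exact: (integrable_norm hh).
have [|||||_ _] := @dominated_convergence _ _ _ mu setT measurableT f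
  (fun t => (h t * (psi t * phi t) * cs k a t)%:E) (fun t => (B * B' * `|h t|)%:E).
- move=> n; apply/measurable_EFinP; apply: rint_mf; apply: rint_h.
  by apply: bmfM; [case: (hn n)|case: Hp].
- apply/measurable_EFinP; apply: rint_mf; apply: rint_h.
  by apply: bmfM => //; case: Hp.
- apply: aeW => t _; apply: cvg_EFin; first by near=> n.
  apply: cvgM; last exact: cvg_cst.
  apply: cvgM; first exact: cvg_cst.
  by apply: cvgM; [exact: hlim|exact: cvg_cst].
- exact: habs.
- apply: aeW => t n _; rewrite /f lee_fin !normrM.
  have c1 : `|cs k a t| <= 1 by rewrite ler_norml cos_geN1 cos_le1.
  apply: le_trans (ler_piMr _ c1) _; first by rewrite !mulr_ge0.
  by rewrite mulrC ler_wpM2r// ler_pM.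
move=> hc; rewrite /Rintegral.
have -> : (\int[mu]_t (h t * (psi t * phi t) * cs k a t)%:E)%E = 0%E; last by [].
apply: (cvg_unique _ hc) => //; rewrite /=.
under eq_fun do rewrite i0.
exact: cvg_cst.
Unshelve. all: by end_near.
Qed.

(* p_(n+1) = p_n + (psi - p_n^2) / 2 increases to sqrt psi. *)
Let Mul_sqrt psi : Mul psi -> (forall t, 0 <= psi t <= 1) -> Mul (fun t => Num.sqrt (psi t)).
Proof.
move=> hp p01.
pose p := fix p n t : R := if n is m.+1 then p m t + 2^-1 * (psi t + -1 * (p m t * p m t)) else 0.
have Mp n : Mul (p n).
  elim: n => [|n ih]; first exact: Mul_cst.
  apply: MulD => //; apply: MulM; first exact: Mul_cst.
  by apply: MulD => //; apply: MulM; [exact: Mul_cst|exact: MulM].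
have key t n : 0 <= p n t <= Num.sqrt (psi t) /\
    Num.sqrt (psi t) - p n t <= Num.sqrt (psi t) * (1 - Num.sqrt (psi t) / 2) ^+ n.
  have /andP[t0 t1] := p01 t.
  have s0 := sqrtr_ge0 (psi t); have s2 := sqr_sqrtr t0.
  have s1 : Num.sqrt (psi t) <= 1 by rewrite -[leRHS]sqrtr1 ler_wsqrtr.
  move: s0 s2 s1; set s := Num.sqrt (psi t) => s0 s2 s1.
  elim: n => [|n [/andP[ih1 ih2] ih3]] /=; first by rewrite lexx s0 expr0 mulr1 subr0.
  rewrite -s2; move: ih1 ih2 ih3; set q := p n t => ih1 ih2 ih3.
  (* Each step multiplies the error by 1 - (s + q) / 2, which lies between 0 and 1 - s / 2. *)
  have e : s - (q + 2^-1 * (s ^+ 2 + -1 * (q * q))) = (s - q) * (1 - (s + q) / 2) by field.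
  split; first by apply/andP; split; nra.
  rewrite e exprSr mulrA; apply: le_trans (_ : (s - q) * (1 - s / 2) <= _); first by nra.
  by rewrite ler_wpM2r//; lra.
apply: (@Mul_lim p _ 1) => [//|n t|t].
  have [/andP[a b] _] := key t n; rewrite ger0_norm//; apply: le_trans b _.
  by have /andP[t0 t1] := p01 t; rewrite -[leRHS]sqrtr1 ler_wsqrtr.
apply: to0_cvgP.
have [s0|s0] := eqVneq (Num.sqrt (psi t)) 0.
  apply: to0_le (@to0_cst R) => n; have [_] := key t n.
  have [/andP[a b] _] := key t n.
  by rewrite s0 mul0r distrC ger0_norm// subr_ge0 -s0.
have sp : 0 < Num.sqrt (psi t) by rewrite lt_neqAle eq_sym s0 sqrtr_ge0.
have s1 : Num.sqrt (psi t) <= 1.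
  by have /andP[t0 t1] := p01 t; rewrite -[leRHS]sqrtr1 ler_wsqrtr.
apply: to0_le (to0Z (sqrtr_ge0 (psi t)) (cvg_to0 (cvg_expr (z := 1 - Num.sqrt (psi t) / 2) _))) => [n|].
  have [/andP[a b] c] := key t n; rewrite distrC ger0_norm ?subr_ge0// subr0.
  by rewrite ger0_norm// exprn_ge0//; lra.
by rewrite ltr_norml; apply/andP; split; lra.
Qed.

(** The absolute value is the square root of the square, after scaling into [-1, 1] by the positive
    number |B| + 1. *)
Let Mul_abs psi : Mul psi -> Mul (fun t => `|psi t|).
Proof.
move=> hp; have [[_ [B hB]] _] := hp.
have B1 : 0 < `|B| + 1 by rewrite ltr_wpDl.
have := Mul_sqrt (MulM (MulM (Mul_cst (`|B| + 1)^-1) hp) (MulM (Mul_cst (`|B| + 1)^-1) hp)).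
move=> /(_ _)/(MulM (Mul_cst (`|B| + 1))) h2; apply: eqMul (h2 _) => t.
  rewrite -expr2 sqrtr_sqr normrM (ger0_norm (ltW _)) ?invr_gt0// mulrA mulfV ?mul1r// gt_eqF//.
rewrite -expr2 sqr_ge0 /= -(real_normK (num_real _)) expr_le1//.
rewrite normrM (ger0_norm (ltW _)) ?invr_gt0// ler_pdivrMl// mulr1.
by apply: le_trans (hB t) _; apply: le_trans (ler_norm B) _; lra.
Qed.

(* The indicator is the limit of y_n = min (1, n (tau - psi)^+). *)
Let Mul_lt psi (tau : R) : Mul psi -> Mul (fun t => (psi t < tau)%R%:R).
Proof.
move=> hp.
pose z (n : nat) t : R := n%:R * 2^-1 * ((tau + -1 * psi t) + `|tau + -1 * psi t|).
pose y n t : R := 2^-1 * ((1 + z n t) + -1 * `|1 + -1 * z n t|).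
have M1 : Mul (fun t => tau + -1 * psi t).
  by apply: MulD; [exact: Mul_cst|apply: MulM => //; exact: Mul_cst].
have Mz n : Mul (z n).
  apply: MulM; first exact: Mul_cst.
  by apply: MulD => //; exact: Mul_abs.
have My n : Mul (y n).
  apply: MulM; first exact: Mul_cst.
  apply: MulD; first by apply: MulD => //; exact: Mul_cst.
  apply: MulM; first exact: Mul_cst.
  by apply: Mul_abs; apply: MulD; [exact: Mul_cst|apply: MulM => //; exact: Mul_cst].
have z0 n t : 0 <= z n t.
  rewrite /z mulr_ge0//.
  by have := ler_norm (- (tau + -1 * psi t)); rewrite normrN; lra.
apply: (@Mul_lim y _ 1) => [//|n t|t].
  have := z0 n t; rewrite /y; move: (z n t) => x x0.
  by rewrite ler_norml; case: (ger0P (1 + -1 * x)) => hx; apply/andP; split; lra.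
apply: to0_cvgP; case: (ltP (psi t) tau) => ht.
  have d0 : 0 < tau - psi t by rewrite subr_gt0.
  apply: (@to0_eventually _ _ (fun=> 0) (Num.truncn (tau - psi t)^-1).+1); last exact: to0_cst.
  move=> n nN; have hz : 1 <= z n t.
    rewrite /z ger0_norm; last by lra.
    have : (tau - psi t)^-1 <= n%:R.
      apply: (le_trans (ltW (truncnS_gt _))); by rewrite ler_nat.
    by rewrite -[_^-1]mulr1 ler_pdivrMl//; lra.
  have hn : `|1 + -1 * z n t| = - (1 + -1 * z n t) by rewrite ler0_norm//; lra.
  rewrite /y hn.
  by rewrite normr_le0; apply/eqP; rewrite /=; field.
apply: to0_le (@to0_cst R) => n.
have -> : y n t = 0; last by rewrite subr0 normr0.
have zn : z n t = 0 by rewrite /z ler0_norm; [ring | lra].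
by rewrite /y zn mulr0 addr0 normr1; lra.
Qed.

(** By the product-to-sum formula a cosine factor only changes the frequency and the phase, over
    which [Hz] quantifies. *)
Let cos_shift k (a : R) : Mul (cs k a).
Proof.
split=> [|phi [bp hp]]; first exact: bmf_cs.
split=> [|l b]; first exact: bmfM.
rewrite (@eqI _ (fun t => 2^-1 * (h t * phi t * cs (l + k) (b + a) t + h t * phi t * cs (l - k) (b - a) t))).
  rewrite (RintZ _ (rintD (rint_h (l + k) (b + a) bp) (rint_h (l - k) (b - a) bp))).
  by rewrite (RintD (rint_h (l + k) (b + a) bp) (rint_h (l - k) (b - a) bp)) !hp addr0 mulr0.
move=> t; rewrite /cs !dotkD dotkN.
set x := dotk k _; set y := dotk l _.
have -> : y + x + (b + a) = (y + b) + (x + a) by ring.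
have -> : y - x + (b - a) = (y + b) - (x + a) by ring.
by rewrite (cosD (y + b)) (cosB (y + b)); move: (cos (x + a)) (sin (x + a)) (cos (y + b)) (sin (y + b)) => *; field.
Qed.

Hypothesis h0 : forall k a, I (fun t => h t * cs k a t) = 0.

Let Hz1 : Hz (fun=> 1).
Proof.
split=> [|k a]; first exact: bmf_cst.
by rewrite -(h0 k a); apply: eqI => t; rewrite mulr1.
Qed.

Let Mul_ae psi psi' : bmf psi' -> {ae mu, forall t, psi t = psi' t} -> Mul psi -> Mul psi'.
Proof.
move=> b' hae [b hm]; split=> // phi Hp; have [c e] := hm _ Hp; have [bp _] := Hp.
split=> [|k a]; first exact: bmfM.
rewrite -(e k a) /Rintegral; congr fine; apply: ae_eq_integral => //.
- by apply/measurable_EFinP; apply: rint_mf; apply: rint_h; exact: bmfM.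
- by apply/measurable_EFinP; apply: rint_mf; exact: rint_h.
- by apply: filterS hae => t ht _; rewrite ht.
Qed.

(** These sets form a sigma-algebra: closure of [Mul] under products gives intersections, and
    closure under bounded limits gives countable ones. *)
Let C (A : set T) := measurable A /\ Mul (\1_A : T -> R).

Let C0 : C set0.
Proof. by split=> //; rewrite indic0; exact: Mul_cst. Qed.

Let CC A : C A -> C (~` A).
Proof.
move=> [mA hA]; split; first exact: measurableC.
apply: eqMul (MulD (Mul_cst 1) (MulM (Mul_cst (-1)) hA)) => t.
by rewrite !indicE in_setC; case: (t \in A) => /=; ring.
Qed.

Let CI A B : C A -> C B -> C (A `&` B).
Proof.
move=> [mA hA] [mB hB]; split; first exact: measurableI.
by rewrite indicI; exact: MulM.
Qed.

Let C_bigcap (F : nat -> set T) : (forall n, C (F n)) -> C (\bigcap_n F n).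
Proof.
move=> hF; pose G n := \bigcap_(i in [set i | (i < n)%N]) F i.
have hG n : C (G n).
  elim: n => [|n ih].
    have -> : G 0%N = ~` set0 by rewrite setC0 -subTset => t _ i.
    exact: CC.
  have -> : G n.+1 = G n `&` F n; last exact: CI.
  apply/seteqP; split=> t /=.
    by move=> ht; split=> [i /= ni|]; apply: ht => //=; exact: ltnW.
  move=> [ht hn] i /=; rewrite ltnS leq_eqVlt => /orP[/eqP ->//|]; exact: ht.
split; first by apply: bigcapT_measurable => n; case: (hF n).
apply: (@Mul_lim (fun n => \1_(G n)) _ 1) => [n|n t|t].
- by case: (hG n).
- by rewrite indicE; case: (_ \in _); rewrite ?normr1 ?normr0.
- apply: to0_cvgP; have [ht|ht] := pselect ((\bigcap_n F n) t).
    apply: to0_le (@to0_cst R) => n; rewrite !indicE !mem_set ?subrr ?normr0//.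
    by move=> i _; exact: ht.
  have [i hi] : exists i, ~ F i t.
    by apply/existsNP => hall; apply: ht => i _; exact: hall.
  apply: (@to0_eventually _ _ (fun=> 0) i.+1); last exact: to0_cst.
  move=> n ni; rewrite !indicE !memNset ?subrr ?normr0//.
  by move=> hG'; apply: hi; exact: (hG' i).
Qed.

Let C_bigcup (F : nat -> set T) : (forall n, C (F n)) -> C (\bigcup_n F n).
Proof.
move=> hF; rewrite -[X in C X]setCK setC_bigcup; apply: CC.
by apply: C_bigcap => n; exact: CC.
Qed.

Let mem_ae (j : 'I_d) : {ae mu, forall t : T, 0 <= tnth t j < 2 * pi}.
Proof.
exists [set t | ~ `[0%R, (2 * pi)%R[%classic (tnth t j)]; split.
- have mD : measurable (~` `[0%R, (2 * pi)%R[%classic : set mR).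
    by apply: measurableC; exact: measurable_itv.
  by have := measurable_tnth j measurableT mD; rewrite setTI.
- exact: torus_out.
- by move=> t /=; rewrite in_itv.
Qed.

(* On the circle the arc ]b, 2 pi[ is a sublevel set of a shifted cosine, so that
   indicators of half-spaces belong to [Mul]. *)
Let cos_gt_half (x b : R) : 0 <= x < 2 * pi -> 0 <= b < 2 * pi ->
  (cos (x - b / 2) < cos (b / 2)) = (b < x).
Proof.
move=> /andP[x0 x2] /andP[b0 b2].
have pi0 := @pi_gt0 R.
have hb : b / 2 \in `[0, pi] by rewrite in_itv /=; apply/andP; split; lra.
have [bx|xb] := ltP b x.
  have [h1|h1] := lerP (x - b / 2) pi.
    by rewrite ltr_cos ?hb// ?in_itv /=; [lra | apply/andP; split; lra].
  have -> : cos (x - b / 2) = cos (2 * pi - (x - b / 2)).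
    have -> : 2 * pi - (x - b / 2) = - (x - b / 2) + pi + pi by ring.
    by rewrite !cosDpi opprK cosN.
  by rewrite ltr_cos ?hb// ?in_itv /=; [lra | apply/andP; split; lra].
apply/negbTE; rewrite -leNgt.
have [h1|h1] := lerP 0 (x - b / 2).
  have [e|ne] := eqVneq (b / 2) (x - b / 2); first by rewrite -e.
  by rewrite ltW// ltr_cos ?hb// ?in_itv /=; [rewrite lt_neqAle eq_sym ne; lra | apply/andP; split; lra].
rewrite -(cosN (x - b / 2)).
have [e|ne] := eqVneq (b / 2) (- (x - b / 2)); first by rewrite -e.
rewrite ltW// ltr_cos ?hb// ?in_itv /=; last by apply/andP; split; lra.
by rewrite lt_neqAle eq_sym ne; lra.
Qed.

Let C_ray (j : 'I_d) (b : R) : C ((tnth (T := mR))^~ j @^-1` `]b, +oo[%classic).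
Proof.
set A := _ @^-1` _.
have mA : measurable A.
  by have := measurable_tnth j measurableT (measurable_itv `]b, +oo[); rewrite setTI.
have bA : bmf (\1_A : T -> R).
  split; first exact: measurable_indic.
  by exists 1 => t; rewrite indicE; case: (_ \in _); rewrite ?normr1 ?normr0.
have inA t : (t \in A) = (b < tnth t j).
  by apply/idP/idP => [/set_mem|hb]; rewrite /A /= ?in_itv /= ?andbT//; apply/mem_set; rewrite /= in_itv /= andbT.
(* Coordinates lie in [0, 2 pi[ almost everywhere, so outside this range of [b] the indicator is
   almost everywhere constant. *)
split=> //; have [b0|b0] := ltP b 0.
  apply: Mul_ae bA _ (Mul_cst 1); apply: filterS (mem_ae j) => t /andP[t0 _].
  by rewrite indicE inA (lt_le_trans b0).
have [b2|b2] := ltP b (2 * pi); last first.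
  apply: Mul_ae bA _ (Mul_cst 0); apply: filterS (mem_ae j) => t /andP[_ t2].
  by rewrite indicE inA ltNge (ltW (lt_le_trans t2 b2)).
apply: Mul_ae bA _ (Mul_lt (cos (b / 2)) (cos_shift (delta_mx 0 j) (- (b / 2)))).
apply: filterS (mem_ae j) => t ht; rewrite indicE inA -(cos_gt_half ht) ?b0//.
rewrite /cs /dotk (bigD1 j)//= !mxE !eqxx mul1r big1 ?addr0// => i ij.
by rewrite mxE (negbTE ij) andbF mul0r.
Qed.

Let C_all A : measurable A -> C A.
Proof.
apply: smallest_sub.
  split=> [|A' hA'|F hF]; [exact: C0|by rewrite setTD; exact: CC|exact: C_bigcup].
apply: (big_ind (fun X => X `<=` C)) => [//|X Y hX hY A' [/hX|/hY]//|i _ A'].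
case=> B mB <-; rewrite setTI.
suff : (@measurable _ mR) `<=` [set B | C ((tnth (T := mR))^~ i @^-1` B)] by apply.
rewrite RGenOInfty.measurableE; apply: smallest_sub => /=.
  split=> [|B' hB'|F hF] /=.
  - by rewrite preimage_set0; exact: C0.
  - by rewrite setTD preimage_setC; exact: CC.
  - by rewrite preimage_bigcup; exact: C_bigcup.
by move=> _ [b ->] /=; exact: C_ray.
Qed.

(** The hypothesis puts 1 in [Hz]; multiplying it by the indicator of any measurable set shows that
    [h] has integral 0 over that set. *)
Lemma fourier_coeff_eq0_ae : {ae mu, forall t, h t = 0}.
Proof.
have : ae_eq mu setT (EFin \o h) (cst 0%E).
  apply: integral_ae_eq => //.
  move=> E _ mE; rewrite integral0.
  have [_ [_ hE]] := C_all mE; have [_ e] := hE _ Hz1.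
  have := e 0 0; rewrite /cs; under eq_Rintegral do rewrite dotk0 addr0 cos0 !mulr1.
  move=> e'; rewrite integral_mkcond.
  have -> : (EFin \o h) \_ E = (fun t => (h t * \1_E t)%:E).
    apply/funext => t; rewrite patchE indicE /=.
    by case: ifP => _; rewrite ?mulr1 ?mulr0.
  rewrite Rint_EFin ?e'//.
  have := @rint_M _ _ _ mu (\1_E) h _ hh; under [X in _ -> rint _ X]eq_fun do rewrite mulrC.
  apply; split; first exact: measurable_indic.
  by exists 1 => t; rewrite indicE; case: (_ \in _); rewrite ?normr1 ?normr0.
by apply: filterS => t /(_ Logic.I) [].
Qed.

End fourier_uniqueness.

(** * Functions determined almost everywhere by their coefficients *)

Section riesz_fischer.
Context {R : realType} {d : nat}.
Local Notation mu := (torus_measure R d).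
Local Notation point := 'rV[R]_d.
Local Notation Z := 'rV[int]_d.
Local Notation C := R[i].
Local Notation tp := (@torus_point R d).
Local Notation IC := (@torus_intC R d).
Local Notation dd := (@dd R d).
Local Notation T := (d.-tuple (measurableTypeR R)).
Implicit Types (u v w : point -> C) (k : Z).

Lemma Rint_ae (f g : T -> R) : measurable_fun setT f -> measurable_fun setT g ->
  {ae mu, forall t, f t = g t} -> \int[mu]_t f t = \int[mu]_t g t.
Proof.
move=> mf mg fg; rewrite /Rintegral; congr fine; apply: ae_eq_integral => //; [exact/measurable_EFinP..|].
by apply: filterS fg => t -> _.
Qed.

Lemma rint_ae (f g : T -> R) : rint mu f -> measurable_fun setT g ->
  {ae mu, forall t, f t = g t} -> rint mu g.
Proof.
move=> hf mg fg.
have mf := rint_mf hf.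
apply/integrableP; split; first exact/measurable_EFinP.
have [_] := integrableP _ _ _ hf.
rewrite (@ae_eq_integral _ _ _ mu setT (fun t => `|(EFin \o g) t|%E) (fun t => `|(EFin \o f) t|%E))//.
- by apply: measurableT_comp => //; exact/measurable_EFinP.
- by apply: measurableT_comp => //; exact/measurable_EFinP.
- by apply: filterS fg => t /= -> _.
Qed.

Lemma L2_ae u v : L2 u -> torus_periodic v -> mfC v ->
  {ae mu, forall t, u (tp t) = v (tp t)} -> L2 v.
Proof.
move=> /L2P[p a b] pv mv uv; apply/L2P; split => //.
by apply: rint_ae b (mf_nc2 mv) _; apply: filterS uv => t ->.
Qed.

Lemma IC_ae u v : mfC u -> mfC v -> {ae mu, forall t, u (tp t) = v (tp t)} -> IC u = IC v.
Proof.
move=> [a b] [a' b'] uv; rewrite /torus_intC /torus_int; congr (_ +i* _)%C.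
  by apply: Rint_ae => //; apply: filterS uv => t; rewrite /re => ->.
by apply: Rint_ae => //; apply: filterS uv => t; rewrite /im => ->.
Qed.

Lemma N2_ae u v : mfC u -> mfC v -> {ae mu, forall t, u (tp t) = v (tp t)} -> N2 u = N2 v.
Proof.
move=> a b uv; apply: Rint_ae; [exact: mf_nc2..|].
by apply: filterS uv => t ->.
Qed.

Lemma fourier_ae u v k : mfC u -> mfC v ->
  {ae mu, forall t, u (tp t) = v (tp t)} -> fourier u k = fourier v k.
Proof.
move=> a b uv; rewrite !fourierE; apply: IC_ae.
- exact: mfCM a (mfC_ek _).
- exact: mfCM b (mfC_ek _).
- by apply: filterS uv => t ->.
Qed.

Lemma L2_mfC u : L2 u -> mfC u. Proof. by move=> /L2P[]. Qed.

Lemma fourier_eq0_re u : L2 u -> (forall k, fourier u k = 0) -> {ae mu, forall t, re u (tp t) = 0}.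
Proof.
move=> hu h0; pose ur x := (2^-1%:C)%C * (u x + (u x)^*%C).
have urE x : ur x = ((re u x)%:C)%C.
  rewrite /ur /re; case: (u x) => a b /=; apply/eqP; rewrite eq_complex /=; apply/andP.
  by split; apply/eqP; field.
have L2ur : L2 ur by apply: L2Z; apply: L2D => //; exact: L2J.
have fur k : fourier ur k = 0.
  rewrite fourierZ; last by apply: L2D => //; exact: L2J.
  rewrite fourierD//; last exact: L2J.
  by rewrite fourierJ// !h0 conjc0 addr0 mulr0.
have cu := L2_cint hu.
apply: fourier_coeff_eq0_ae; first by case: cu.
move=> k a; have := fur (- k); rewrite fourierE opprK.
have [hu1 hu2] : cint u := cu.
have c1 : rint mu (fun t => re u (tp t) * cos (dotk k (tp t))).
  have := rint_M (bmf_cos (measurable_dotk k)) hu1.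
  by under [X in rint _ X]eq_fun do rewrite mulrC.
have c2 : rint mu (fun t => re u (tp t) * sin (dotk k (tp t))).
  have := rint_M (bmf_sin (measurable_dotk k)) hu1.
  by under [X in rint _ X]eq_fun do rewrite mulrC.
rewrite /torus_intC /torus_int => /eqP; rewrite eq_complex /= => /andP[/eqP e1 /eqP e2].
transitivity (\int[mu]_t (cos a * (re u (tp t) * cos (dotk k (tp t))) - sin a * (re u (tp t) * sin (dotk k (tp t))))).
  by apply: eq_Rintegral => t _; rewrite cosD /=; ring.
rewrite (RintB (rintZ _ c1) (rintZ _ c2)) (RintZ _ c1) (RintZ _ c2).
rewrite [X in cos a * X](_ : _ = 0) ?[X in sin a * X](_ : _ = 0) ?mulr0 ?subrr//.
  by rewrite -[RHS]e2; apply: eq_Rintegral => t _; rewrite /im urE /ek /expi /= mul0r addr0.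
by rewrite -[RHS]e1; apply: eq_Rintegral => t _; rewrite /re urE /ek /expi /= mul0r subr0.
Qed.

(** The imaginary part of [u] is the real part of - i u, so the real case applies twice. *)
Lemma fourier_eq0 u : L2 u -> (forall k, fourier u k = 0) -> {ae mu, forall t, u (tp t) = 0}.
Proof.
move=> hu h0.
have := @fourier_eq0_re (fun x => - 'i%C * u x) (L2Z _ hu) _.
move=> /(_ _)-/(_ (fun k => _)) h2.
have h2' : {ae mu, forall t, im u (tp t) = 0}.
  apply: filterS (h2 _) => [t|k]; last by rewrite fourierZ// h0 mulr0.
  by rewrite /re /im ReM /= !(oppr0,mul0r) sub0r mulN1r opprK.
apply: filterS2 h2' (fourier_eq0_re hu h0) => t; rewrite /re /im.
by case: (u _) => a b /= -> ->.
Qed.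

Lemma fourier_inj u v : L2 u -> L2 v -> (forall k, fourier u k = fourier v k) ->
  {ae mu, forall t, u (tp t) = v (tp t)}.
Proof.
move=> hu hv h; have := fourier_eq0 (L2B hu hv) _.
move=> /(_ _)-/(_ (fun k => _)) h2.
apply: filterS (h2 _) => [t /eqP|k]; first by rewrite subr_eq0 => /eqP.
by rewrite fourierB// h subrr.
Qed.

Lemma fatou_rint (f : nat -> T -> R) (g : T -> R) (c : R) :
  (forall n t, 0 <= f n t) -> (forall n, rint mu (f n)) ->
  (exists N, forall n, (N <= n)%N -> \int[mu]_t f n t <= c) ->
  (forall t, f ^~ t @ \oo --> g t) -> rint mu g /\ \int[mu]_t g t <= c.
Proof.
move=> f0 fi [N fc] fg.
have g0 t : 0 <= g t.
  rewrite -oppr_le0; apply: to0_const; apply: to0_le (cvg_to0 (fg t)) => n.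
  have := ler_norm (f n t - g t); have := f0 n t; lra.
have mg : measurable_fun setT g.
  by apply: (measurable_fun_cvg (h := f)) => [n|t _]; [exact: rint_mf|exact: fg].
have : (\int[mu]_t (g t)%:E <= c%:E)%E.
  have := @fatou _ _ _ mu setT measurableT (fun n t => (f (n + N)%N t)%:E) _ _.
  have -> : (fun t => limn_einf ((fun n t => (f (n + N)%N t)%:E) ^~ t)) = (fun t => (g t)%:E).
    apply/funext => t; apply: (cvg_limn_einf_sup _).1; apply: cvg_EFin; first by near=> n.
    by have := fg t; rewrite -(@cvg_shiftn N _ (f ^~ t)).
  move=> h; apply: le_trans (h _ _) _.
  - by move=> n; apply/measurable_EFinP; exact: rint_mf.
  - by move=> n t _; rewrite lee_fin.
  - rewrite limn_einf_lim; apply: lime_le; first exact: is_cvg_einfs.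
    near=> n; apply: le_trans (_ : \int[mu]_t (f (n + N)%N t)%:E <= _)%E.
      by apply: ereal_inf_lbound; exists n => //=.
    by rewrite Rint_EFin// lee_fin fc// leq_addl.
move=> h; have ig : rint mu g.
  apply/integrableP; split; first exact/measurable_EFinP.
  under eq_integral do rewrite /= ger0_norm//.
  by rewrite (le_lt_trans h)// ltry.
by split=> //; rewrite -lee_fin -Rint_EFin.
Unshelve. all: by end_near.
Qed.

End riesz_fischer.

(** * The Riesz-Fischer theorem *)

Section riesz_fischer2.
Context {R : realType} {d : nat}.
Local Notation mu := (torus_measure R d).
Local Notation point := 'rV[R]_d.
Local Notation Z := 'rV[int]_d.
Local Notation C := R[i].
Local Notation tp := (@torus_point R d).
Local Notation IC := (@torus_intC R d).
Local Notation dd := (@dd R d).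
Local Notation T := (d.-tuple (measurableTypeR R)).
Implicit Types (u v w : point -> C) (k : Z).

Lemma rint_nc u : L2 u -> rint mu (fun t => nc (u (tp t))).
Proof.
move=> hu; have /L2P[_ m i] := hu.
apply: (rint_dom _ _ (rintD (rint_cst mu 1) i)).
  by under [X in measurable_fun _ X]eq_fun do rewrite nc_def -nc_sqr -[Num.sqrt _]/(Num.sqrt _);
     apply: measurableT_comp (mf_nc2 m); apply: continuous_measurable_fun; exact: sqrt_continuous.
by move=> t; rewrite ger0_norm ?nc_ge0//; have := sqr_ge0 (nc (u (tp t)) - 1); have := nc_ge0 (u (tp t)); nra.
Qed.

Lemma Hb_summ (g : Z -> C) B : Hb 0 g B -> summ (fun k => nc (g k) ^+ 2) (B ^+ 2).
Proof.
move=> [B0 h]; split=> [|k|n]; [exact: sqr_ge0|exact: sqr_ge0|].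
by have := h _ (uniq_box n); under eq_bigr do rewrite wt0 mul1r.
Qed.

Lemma trigp_box_diff (g : Z -> C) m n : (m <= n)%N ->
  forall x, trigp (box n) g x - trigp (box m) g x = trigp [seq k <- box n | k \notin box m] g x.
Proof. by move=> mn x; rewrite /trigp sum_box_diff// big_filter. Qed.

Lemma fast_subseq (e : nat -> R) (eps : nat -> R) : to0 e -> (forall n, 0 < eps n) ->
  exists phi : nat -> nat, {homo phi : m n / (m <= n)%N} /\
    (forall i, (i <= phi i)%N) /\ forall i, e (phi i) <= eps i.
Proof.
move=> e0 eps0.
have [psi hpsi] := choice (fun i => e0 _ (eps0 i)).
pose phi i := (\sum_(j < i.+1) psi j + i)%N.
exists phi; split; last split.
- apply: homo_leq; [exact: leqnn|exact: leq_trans|].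
  by move=> i; rewrite /phi [X in (_ <= X + _)%N]big_ord_recr /=; lia.
- by move=> i; rewrite /phi leq_addl.
- by move=> i; apply: hpsi; rewrite /phi big_ord_recr /=; lia.
Qed.

(* Along a fast subsequence the increments have a finite sum [F] almost everywhere;
   the limit is set to 0 where [F] is infinite. *)
Lemma riesz_fischer (g : Z -> C) B : Hb 0 g B -> exists w,
  [/\ L2 w, forall k, fourier w k = g k & N2 w <= dd^-1 * B ^+ 2].
Proof.
move=> hg; have [B0 hB] := hg.
have [e [e0 epos he]] := summ_tail (Hb_summ hg).
(* Squared norms of increments of size 4^-i make their norms of size 2^-i, which is summable. *)
have p4 i : 0 < (4 ^+ i)^-1 :> R by rewrite invr_gt0 exprn_gt0.
have [phi [hphi [phin ephi]]] := fast_subseq e0 p4.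
have dd0 := @dd_gt0 R d.
pose u i : point -> C := trigp (box (phi i)) g.
have L2u i : L2 (u i) by exact: L2_trigp.
have u_diff i j : (i <= j)%N -> N2 (fun x => u j x - u i x) <= dd^-1 * (4 ^+ i)^-1.
  move=> ij; rewrite (_ : (fun x => _) = trigp [seq k <- box (phi j) | k \notin box (phi i)] g).
    rewrite N2_trigp ?filter_uniq ?uniq_box// ler_wpM2l ?invr_ge0 ?(ltW dd0)//.
    apply: le_trans (ephi i); apply: he; first by rewrite filter_uniq// uniq_box.
    by move=> k; rewrite mem_filter => /andP[].
  by apply/funext => x; rewrite trigp_box_diff// hphi.
pose D i x := nc (u i.+1 x - u i x).
pose F x : \bar R := (\sum_(0 <= i <oo) (D i x)%:E)%E.
have D0 i x : 0 <= D i x by exact: nc_ge0.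
have iD i : rint mu (fun t => D i (tp t)) by exact: (rint_nc (L2B (L2u i.+1) (L2u i))).
have mF : measurable_fun setT (fun t => F (tp t)).
  apply: ge0_emeasurable_sum => [k t _ _|k _]; first by rewrite lee_fin.
  by apply/measurable_EFinP; exact: rint_mf (iD k).
have F0 x : (0 <= F x)%E by apply: nneseries_ge0 => i _ _; rewrite lee_fin.
(* From y <= (2^i y^2 + 2^-i) / 2: the square contributes dd^-1 and the constant, integrated over
   the torus, contributes dd. *)
have intD i : \int[mu]_t D i (tp t) <= (dd^-1 + dd) / 2 * (2 ^+ i)^-1.
  have /L2P[_ _ i2] := L2B (L2u i.+1) (L2u i).
  have i3 := rintD (rintZ (2 ^+ i / 2) i2) (rint_cst mu ((2 ^+ i)^-1 / 2)).
  apply: le_trans (Rint_le (iD i) i3 _) _ => [t|].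
    rewrite /D; move: (nc _) => y.
    have a0 : 0 < 2 ^+ i :> R by rewrite exprn_gt0.
    move: (2 ^+ i : R) a0 => a a0; have := sqr_ge0 (a * y - 1).
    move=> h; rewrite -subr_ge0; have -> : a / 2 * y ^+ 2 + a^-1 / 2 - y = (a * y - 1) ^+ 2 / (2 * a).
      by field; rewrite gt_eqF.
    by rewrite divr_ge0// mulr_ge0// ltW.
  rewrite (RintD (rintZ _ i2) (rint_cst mu _)) (RintZ _ i2) Rintegral_cst//.
  have -> : fine (mu setT) = dd by rewrite (@torus_setT R d).
  have := u_diff i i.+1 (leqnSn i); rewrite -/(N2 _).
  have -> : 4 ^+ i = 2 ^+ i * 2 ^+ i :> R by rewrite -exprMn -natrM.
  have a0 : 0 < 2 ^+ i :> R by rewrite exprn_gt0.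
  move: (2 ^+ i : R) a0 => a a0; rewrite /N2; move: (\int[mu]_t _) => y hy.
  have : a / 2 * y <= a / 2 * (dd^-1 / (a * a)) by rewrite ler_wpM2l// divr_ge0// ltW.
  have -> : a / 2 * (dd^-1 / (a * a)) = dd^-1 / 2 / a by field; rewrite !gt_eqF.
  by rewrite mulrDl mulrDl; move: (dd^-1 / 2 / a) => z; rewrite (mulrC (a^-1 / 2)) mulrA (mulrAC dd); lra.
have Ffin : {ae mu, forall t, F (tp t) \is a fin_num}.
  suff iF : mu.-integrable setT (fun t => F (tp t)).
    by apply: filterS (integrable_ae measurableT iF) => t; apply.
  apply/integrableP; split=> //.
  under eq_integral do rewrite gee0_abs//.
  rewrite integral_nneseries//; last 2 first.
  - by move=> n; apply/measurable_EFinP; exact: rint_mf (iD n).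
  - by move=> n t _; rewrite lee_fin.
  apply: le_lt_trans (_ : ((dd^-1 + dd) / 2 * 2)%:E < +oo)%E; last exact: ltry.
  apply: lime_le.
    by apply: is_cvg_nneseries => n _ _; apply: integral_ge0 => t _; rewrite lee_fin.
  near=> n; apply: le_trans (_ : \sum_(0 <= i < n) (((dd^-1 + dd) / 2 * (2 ^+ i)^-1)%:E) <= _)%E.
    by apply: lee_sum => i _; rewrite Rint_EFin// lee_fin.
  rewrite sumEFin lee_fin -mulr_sumr ler_wpM2l ?divr_ge0 ?addr_ge0 ?invr_ge0 ?(ltW dd0)//.
  have key m : \sum_(0 <= i < m) (2 ^+ i)^-1 = 2 - 2 * (2 ^+ m)^-1 :> R.
    elim: m => [|m ih]; first by rewrite big_geq// expr0 invr1; ring.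
    rewrite big_nat_recr//= ih exprS invfM; field.
    by rewrite expf_neq0.
  by rewrite key gerBl mulr_ge0// invr_ge0 exprn_ge0.
have per_u i : torus_periodic (u i) by have /L2P[] := L2u i.
(* [L2] demands periodicity at every point; as [F] is periodic, setting the limit to 0 where [F] is
   infinite respects it. *)
have per_F : torus_periodic F.
  move=> x j; apply: eq_eseriesr => i _; congr EFin; rewrite /D.
  by rewrite !per_u.
pose W i x : C := if F x \is a fin_num then u i x else 0.
have Wlim x : exists y, to0 (fun i => nc (W i x - y)).
  rewrite /W; case: (boolP (F x \is a fin_num)) => hF; last first.
    by exists 0; apply: to0_le (@to0_cst R) => i; rewrite subrr nc0.
  have sF n : \sum_(0 <= i < n) D i x <= fine (F x).
    rewrite -lee_fin fineK// -sumEFin.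
    by apply: nneseries_lim_ge => i _ _; rewrite lee_fin.
  pose s n := \sum_(0 <= i < n) D i x.
  have ms : {homo s : m n / (m <= n)%N >-> m <= n}.
    move=> m n mn; rewrite /s (@big_cat_nat _ _ _ m 0 n)//= lerDl.
    by apply: sumr_ge0 => i _; exact: D0.
  have cs : cvgn s.
    by apply: nondecreasing_is_cvgn => //; exists (fine (F x)) => _ [n _ <-]; exact: sF.
  have [||y hy] := @to0_complete R (fun i => u i x) (fun m => `|s m - limn s|).
  - exact: cvg_to0.
  - move=> m n mn; apply: le_trans (_ : s n - s m <= _).
      rewrite /s (@big_cat_nat _ _ _ m 0 n)//= [X in _ <= X - _]addrC addrK.
      elim: n mn => [|n ih]; first by rewrite leqn0 => /eqP ->; rewrite subrr nc0 big_geq.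
      rewrite leq_eqVlt => /orP[/eqP ->|]; first by rewrite subrr nc0 big_geq.
      rewrite ltnS => mn; rewrite big_nat_recr//=.
      have -> : u n.+1 x - u m x = (u n x - u m x) + (u n.+1 x - u n x) by ring.
      by apply: le_trans (ncD _ _) _; rewrite lerD// ih.
    rewrite distrC; apply: le_trans (ler_norm _); rewrite lerD2r.
    exact: nondecreasing_cvgn_le.
  by exists y; apply: to0_le hy (cvg_to0 cs).
have [w hw] := choice Wlim.
have per_w : torus_periodic w.
  move=> x j; apply: nc_lim_unique (hw x).
  by apply: to0_le (hw (x + (2 * pi) *: delta_mx 0 j)) => i; rewrite /W per_F per_u.
have mW i : mfC (W i).
  have mS : measurable [set t | F (tp t) \is a fin_num].
    have -> : [set t | F (tp t) \is a fin_num] = setT `&` [set t | F (tp t) < +oo]%E.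
      by rewrite setTI; apply/seteqP; split=> t /=; rewrite ge0_fin_numE.
    exact: emeasurable_fun_infty_o.
  have [a b] : mfC (fun x => u i x) by exact: L2_mfC.
  have mi : measurable_fun setT (\1_[set t : T | F (tp t) \is a fin_num] : T -> R).
    exact: measurable_indic.
  split.
    apply: (eq_measurable_fun (fun t => \1_[set t : T | F (tp t) \is a fin_num] t * re (u i) (tp t))).
      move=> t _; rewrite indicE /W /re /=; case: ifPn => h; first by rewrite mem_set// mul1r.
      by rewrite memNset ?mul0r//; exact/negP.
    exact: measurable_funM.
  apply: (eq_measurable_fun (fun t => \1_[set t : T | F (tp t) \is a fin_num] t * im (u i) (tp t))).
    move=> t _; rewrite indicE /W /im /=; case: ifPn => h; first by rewrite mem_set// mul1r.
    by rewrite memNset ?mul0r//; exact/negP.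
  exact: measurable_funM.
have W_ae i : {ae mu, forall t, u i (tp t) = W i (tp t)}.
  by apply: filterS Ffin => t ht; rewrite /W ht.
have per_W i : torus_periodic (W i) by move=> x j; rewrite /W per_F per_u.
have L2W i : L2 (W i) by exact: L2_ae (L2u i) (per_W i) (mW i) (W_ae i).
have mw : mfC w.
  split.
    apply: (measurable_fun_cvg (h := fun i t => re (W i) (tp t))) => [i|t _].
      by case: (mW i).
    apply: to0_cvgP; apply: to0_le (hw (tp t)) => i.
    by rewrite /re -raddfB; exact: nc_ge_Re.
  apply: (measurable_fun_cvg (h := fun i t => im (W i) (tp t))) => [i|t _].
    by case: (mW i).
  apply: to0_cvgP; apply: to0_le (hw (tp t)) => i.
  by rewrite /im -raddfB; exact: nc_ge_Im.
have sq_cvg (a : nat -> C) (l : C) : to0 (fun i => nc (a i - l)) -> (fun i => nc (a i) ^+ 2) @ \oo --> nc l ^+ 2.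
  move=> ha; have : (fun i => nc (a i)) @ \oo --> nc l.
    by apply: to0_cvgP; apply: to0_le ha => i; exact: nc_tri_sub.
  by move=> h2; rewrite expr2; under eq_fun do rewrite expr2; exact: (cvgM h2 h2).
have [iw Nw] : rint mu (fun t => nc (w (tp t)) ^+ 2) /\ \int[mu]_t nc (w (tp t)) ^+ 2 <= dd^-1 * B ^+ 2.
  apply: (@fatou_rint R d (fun i t => nc (W i (tp t)) ^+ 2)).
  - by move=> n t; exact: sqr_ge0.
  - by move=> n; have /L2P[] := L2W n.
  - exists 0%N => n _; rewrite -/(N2 _) -(N2_ae (L2_mfC (L2u n)) (mW n) (W_ae n)).
    rewrite N2_trigp ?uniq_box// ler_wpM2l ?invr_ge0 ?(ltW dd0)//.
    by have := hB _ (uniq_box (phi n)); under eq_bigr do rewrite wt0 mul1r.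
  - by move=> t; exact: sq_cvg.
have L2w : L2 w by apply/L2P.
have Nwi i : N2 (fun x => w x - W i x) <= dd^-1 * (4 ^+ i)^-1.
  have [] // := @fatou_rint R d (fun j t => nc (W j (tp t) - W i (tp t)) ^+ 2)
    (fun t => nc (w (tp t) - W i (tp t)) ^+ 2) (dd^-1 * (4 ^+ i)^-1).
  - by move=> n t; exact: sqr_ge0.
  - by move=> n; have /L2P[] := L2B (L2W n) (L2W i).
  - exists i => n ni; apply: le_trans (u_diff _ _ ni).
    rewrite -/(N2 (fun x => W n x - W i x)) (@N2_ae R d (fun x => u n x - u i x) (fun x => W n x - W i x))//.
    + exact: L2_mfC (L2B (L2u n) (L2u i)).
    + exact: L2_mfC (L2B (L2W n) (L2W i)).
    + by apply: filterS2 (W_ae n) (W_ae i) => t -> ->.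
  - move=> t; apply: sq_cvg; apply: to0_le (hw (tp t)) => j.
    by rewrite opprB addrA subrK.
exists w; split => // k.
have p40 : to0 (fun i => (4 ^+ i)^-1 : R).
  have z1 : `|4^-1 : R| < 1 by rewrite ger0_norm// invf_lt1// ltr1n.
  apply: to0_le (cvg_to0 (cvg_expr z1)) => i.
  by rewrite subr0 ger0_norm ?exprn_ge0// exprVn.
(* The coefficients of [W i] tend to those of [w] by Bessel's inequality, and equal [g k] as soon as
   [box (phi i)] contains [k]. *)
apply: (@nc_lim_unique R (fun i => fourier (W i) k)).
  apply: to0_sqrP => [i|]; first exact: nc_ge0.
  apply: to0_le p40 => i.
  have hb := Hb_pt k (bessel (L2B L2w (L2W i))).
  move: hb; rewrite wt0 mul1r fourierB// => hb.
  have : nc (fourier w k - fourier (W i) k) ^+ 2 <= Num.sqrt (dd * N2 (fun x => w x - W i x)) ^+ 2.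
    by rewrite ler_sqr ?nnegrE ?nc_ge0 ?sqrtr_ge0.
  rewrite sqr_sqrtr ?mulr_ge0 ?N2_ge0 ?(ltW dd0)// nc_distC => /le_trans; apply.
  by rewrite -ler_pdivlMl//; apply: Nwi.
apply: (@to0_eventually _ _ (fun=> 0) (l1 k)); last exact: to0_cst.
move=> i ki; rewrite -(fourier_ae k (L2_mfC (L2u i)) (mW i) (W_ae i)).
rewrite fourier_trigp ?uniq_box// (box_le _ (box_l1 k)) ?subrr ?nc0//.
exact: leq_trans ki (phin i).
Unshelve. all: by end_near.
Qed.

(** The function that Riesz-Fischer builds from the coefficients of [u] obeys the bound, and by
    uniqueness it equals [u] almost everywhere. This is the half of Plancherel that Bessel does not
    give. *)
Lemma N2_le u B : L2 u -> Hb 0 (fourier u) B -> N2 u <= dd^-1 * B ^+ 2.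
Proof.
move=> hu /riesz_fischer[w [hw fw Nw]].
rewrite (N2_ae (L2_mfC hu) (L2_mfC hw))//.
by apply: fourier_inj => // k; rewrite fw.
Qed.

End riesz_fischer2.

(** * Integration by parts and Parseval's identity *)

Section continuous_periodic.
Context {R : realType} {d : nat}.
Local Notation mu := (torus_measure R d).
Local Notation mR := (measurableTypeR R).
Local Notation point := 'rV[R]_d.
Local Notation Z := 'rV[int]_d.
Local Notation C := R[i].
Local Notation tp := (@torus_point R d).
Local Notation T := (d.-tuple (measurableTypeR R)).
Local Notation per := (2 * pi : R).
Local Notation I f := (\int[mu]_t f t).
Implicit Types (f g phi : point -> R) (k : Z).

(* An open set is the countable union of the cubes [cell (n, z)], of side 1 / (n + 1),
   that it contains. *)
Lemma continuous_torus_measurable g : continuous g -> measurable_fun setT (g \o tp).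
Proof.
move=> cg; apply: (measurability _ (RGenOInfty.measurableE R)).
move=> _ [_ [b ->] <-]; rewrite setTI.
set O := _ @^-1` _.
pose cell (i : nat * Z) : set T :=
  [set t | forall j, (i.2 0 j)%:~R <= i.1.+1%:R * tnth t j < (i.2 0 j)%:~R + 1].
have mcell i : measurable (cell i).
  have -> : cell i = ~` \bigcup_(j : 'I_d) (~` ((tnth (T := mR))^~ j @^-1`
     `[(i.2 0 j)%:~R / i.1.+1%:R, ((i.2 0 j)%:~R + 1) / i.1.+1%:R[%classic)).
    apply/seteqP; split=> t /=.
      move=> ht [j _ /=]; apply; have /andP[h1 h2] := ht j.
      by rewrite in_itv /=; rewrite ler_pdivrMr// ltr_pdivlMr// (mulrC (tnth t j)) h1 h2.
    move=> ht j; have : (tnth (T := mR))^~ j t \in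
      `[(i.2 0 j)%:~R / i.1.+1%:R, ((i.2 0 j)%:~R + 1) / i.1.+1%:R[.
      by apply: contrapT => hn; apply: ht; exists j.
    by rewrite in_itv /= ler_pdivrMr// ltr_pdivlMr// (mulrC (tnth t j)).
  apply: measurableC; apply: countable_bigcupT_measurable; first exact: countableP.
  move=> j; apply: measurableC.
  have mD : measurable (`[(i.2 0 j)%:~R / i.1.+1%:R, ((i.2 0 j)%:~R + 1) / i.1.+1%:R[%classic : set mR).
    exact: measurable_itv.
  by have := measurable_tnth j measurableT mD; rewrite setTI.
have -> : O = \bigcup_i (if `[< cell i `<=` O >] then cell i else set0).
  apply/seteqP; split=> t; last by move=> [i _]; case: asboolP => // h /h.
  move=> Ot.
  have hO : nbhs (tp t) (g @^-1` `]b, +oo[%classic).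
    by apply: cg; apply: open_nbhs_nbhs; split => //; exact: interval_open.
  have [e /= e0 he] := (nbhs_ballP _ _).1 hO.
  pose n := Num.truncn e^-1.
  have ne : (n.+1%:R)^-1 < e :> R.
    by rewrite invf_plt ?posrE//; exact: truncnS_gt.
  pose z : Z := \row_j Num.floor (n.+1%:R * tnth t j).
  have zt j : (z 0 j)%:~R <= n.+1%:R * tnth t j < (z 0 j)%:~R + 1.
    by rewrite mxE; have := floor_itv (n.+1%:R * tnth t j); rewrite intrD.
  exists (n, z) => //; rewrite asboolT// => t' ht'.
  have hb : ball (tp t) e (tp t').
    split=> // i0 j; rewrite !mxE /ball /=.
    have /andP[a1 a2] := zt j; have /andP[a3 a4] := ht' j.
    apply: lt_trans ne; rewrite -[ltRHS]mul1r ltr_pdivlMr// -[X in _ * X]ger0_norm// -normrM.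
    by rewrite ltr_norml mulrBl !(mulrC _ n.+1%:R) /=; simpl in *; lra.
  by have := he _ hb; rewrite /O /= in_itv /= andbT.
apply: countable_bigcupT_measurable; first exact: countableP.
by move=> i; case: asboolP.
Qed.

Lemma per_shift g (z : Z) x : torus_periodic g -> g (x + per *: map_mx intr z) = g x.
Proof.
move=> pg.
have pn (n : nat) j y : g (y + (n%:R * per) *: delta_mx 0 j) = g y.
  elim: n => [|n ih]; first by rewrite mul0r scale0r addr0.
  by rewrite -[n.+1]addn1 natrD mulrDl mul1r scalerDl addrA pg ih.
have pz (m : int) j y : g (y + (m%:~R * per) *: delta_mx 0 j) = g y.
  case: m => n; first exact: pn.
  by rewrite -(pn n.+1 j (y + _)) -addrA -scalerDl NegzE mulrNz mulNr addNr scale0r addr0.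
have -> : per *: map_mx intr z = \sum_j ((z 0 j)%:~R * per) *: delta_mx 0 j.
  rewrite [LHS]row_sum_delta; apply: eq_bigr => j _.
  by rewrite !mxE mulrC.
elim: (index_enum _) x => [|j js ih] x; first by rewrite big_nil addr0.
by rewrite big_cons addrA ih pz.
Qed.

Lemma continuous_periodic_bounded g : continuous g -> torus_periodic g ->
  exists B, forall x, `|g x| <= B.
Proof.
move=> cg pg.
pose K : set point := [set v | forall i, `[0%R, per]%classic (v ord0 i)].
have cK : compact K by exact: (@rV_compact _ _ (fun=> `[0%R, per]%classic) (fun i => @segment_compact _ _ _)).
have cgK : compact [set g x | x in K].
  by apply: continuous_compact => //; exact: continuous_subspaceT.
have [B [_ hB]] := compact_bounded cgK.
exists (B + 1) => x.
pose z : Z := \row_j (- Num.floor (x 0 j / per)).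
rewrite -(per_shift z x pg); apply: (hB (B + 1)); first by rewrite ltrDl.
exists (x + per *: map_mx intr z) => // i /=.
have p0 := @per_gt0 R.
have /andP[h1 h2] := floor_itv (x 0 i / per).
move: h1 h2; rewrite intrD ler_pdivlMr// ltr_pdivrMr// => h1 h2.
by rewrite in_itv /= !mxE mulrNz; move: h1 h2; set w := (_%:~R : R); nra.
Qed.

Lemma bmf_periodic g : continuous g -> torus_periodic g -> bmf (g \o tp).
Proof.
move=> cg pg; split; first exact: continuous_torus_measurable.
by have [B hB] := continuous_periodic_bounded cg pg; exists B => t; exact: hB.
Qed.

Lemma line_derive g (x v : point) (r : R) : derivable g (x + r *: v) v ->
  is_derive r (1 : R) (fun r => g (x + r *: v)) ('D_v g (x + r *: v)).
Proof.
move=> dg.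
have E : (fun h : R => h^-1 *: (((fun r => g (x + r *: v)) \o shift r) (h *: (1 : R)) - g (x + r *: v))) =
   (fun h => h^-1 *: ((g \o shift (x + r *: v)) (h *: v) - g (x + r *: v))).
  apply/funext => h /=; congr (_ *: (g _ - _)).
  by rewrite scalerDl /GRing.scale /= mulr1 addrCA.
by apply: DeriveDef; rewrite /derivable /derive E.
Qed.

Lemma tp_upd (t : T) j r : tp (upd t j r) = tp (upd t j 0) + r *: delta_mx 0 j.
Proof.
apply/rowP => i; rewrite !mxE !tnth_upd eqxx /=.
by case: eqP => _; rewrite ?mulr1 ?mulr0 ?add0r ?addr0.
Qed.

Definition C1 j g := [/\ torus_periodic g, continuous g, continuous (partial j g) &
  forall x, derivable g x (delta_mx 0 j)].

Lemma periodic_partial j g : torus_periodic g -> torus_periodic (partial j g).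
Proof.
move=> pg x i; rewrite /partial /derive;
rewrite pg; under eq_fun do rewrite /= addrA pg.
by [].
Qed.

Lemma smooth_C1 j g : torus_periodic g -> smooth g -> C1 j g.
Proof.
move=> pg sg; split => //; first by have [] := sg [::].
  by have [] := sg [:: j].
by move=> x; have [_ /(_ j x)] := sg [::].
Qed.

Lemma C1_bmf j g : C1 j g -> bmf (g \o tp).
Proof. by case=> p c _ _; exact: bmf_periodic. Qed.

Lemma C1_bmf_partial j g : C1 j g -> bmf (partial j g \o tp).
Proof. by case=> p _ c _; apply: bmf_periodic => //; exact: periodic_partial. Qed.

Lemma torus_parts j f g : C1 j f -> C1 j g ->
  torus_int (fun x => f x * partial j g x) = - torus_int (fun x => partial j f x * g x).
Proof.
move=> hf hg; have bf := C1_bmf hf; have bg := C1_bmf hg.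
have bpf := C1_bmf_partial hf; have bpg := C1_bmf_partial hg.
have [pf cf cpf df] := hf; have [pg cg cpg dg] := hg.
have cup (w : point -> R) t : continuous w -> continuous (fun r => w (tp (upd t j r))).
  move=> cw r; have -> : (fun r => w (tp (upd t j r))) =
      w \o (fun r => tp (upd t j 0) + r *: delta_mx 0 j).
    by apply/funext => r' /=; rewrite tp_upd.
  apply: continuous_comp; last exact: cw.
  by apply: cvgD; [exact: cvg_cst|apply: cvgZr_tmp; exact: cvg_id].
have key : I (fun t => f (tp t) * partial j g (tp t) + partial j f (tp t) * g (tp t)) = 0.
  apply: (@torus_div R d j (fun t => f (tp t) * g (tp t))).
  - by apply: bmfD; exact: bmfM.
  - move=> t r; apply: (@cvgD _ _ _ _ _ (fun r => f (tp (upd t j r)) * partial j g (tp (upd t j r)))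
      (fun r => partial j f (tp (upd t j r)) * g (tp (upd t j r)))); apply: cvgM; exact: cup.
  - move=> t r.
    have -> : (fun r => f (tp (upd t j r)) * g (tp (upd t j r))) =
       (fun r => f (tp (upd t j 0) + r *: delta_mx 0 j)) * (fun r => g (tp (upd t j 0) + r *: delta_mx 0 j)).
      by apply/funext => r'; rewrite !(tp_upd _ _ r').
    have h1 := @line_derive f (tp (upd t j 0)) (delta_mx 0 j) r (df _).
    have h2 := @line_derive g (tp (upd t j 0)) (delta_mx 0 j) r (dg _).
    have h := is_deriveM h1 h2.
    apply: is_derive_eq; rewrite /GRing.scale /= /partial !(tp_upd _ _ r); ring.
  - by move=> t; rewrite (tp_upd _ _ per) pf pg.
move: key; rewrite RintD; [|exact: (rint_bmf _ (bmfM bf bpg))|exact: (rint_bmf _ (bmfM bpf bg))].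
by move/eqP; rewrite addr_eq0 => /eqP.
Qed.

(** A family closed under differentiation, which adds pi / 2 to the phase and multiplies the
    amplitude by k_j; smoothness is then an induction. *)
Definition csf (c : R) k (a : R) : point -> R := fun x => c * cos (dotk k x + a).

Lemma dotk_continuous k : continuous (dotk k : point -> R).
Proof.
have h (r : seq 'I_d) : continuous (fun x : point => \sum_(j <- r) (k 0 j)%:~R * x 0 j).
  elim: r => [|j r ih] x.
    by under eq_fun do rewrite big_nil; exact: cst_continuous.
  have c1 : {for x, continuous (fun x : point => (k 0 j)%:~R * x 0 j : R)}.
    by apply: continuousM; [exact: cst_continuous|exact: coord_continuous].
  have := continuousD c1 (ih x).
  rewrite (_ : _ + _ = (fun x : point => \sum_(j0 <- j :: r) (k 0 j0)%:~R * x 0 j0))//.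
  by apply/funext => y; rewrite big_cons.
exact: h.
Qed.

Lemma csf_continuous c k a : continuous (csf c k a).
Proof.
have hc : continuous (fun x : point => cos (dotk k x + a)).
  move=> x; apply: (@continuous_comp _ _ _ (fun x => dotk k x + a) cos); last exact: continuous_cos.
  by apply: continuousD; [exact: dotk_continuous|exact: cst_continuous].
by move=> x; apply: continuousM; [exact: cst_continuous|exact: hc].
Qed.

Lemma csf_is_derive c k a j x :
  is_derive x (delta_mx 0 j) (csf c k a) (csf (c * (k 0 j)%:~R) k (a + pi / 2) x).
Proof.
pose g r := c * cos (dotk k x + a + (k 0 j)%:~R * r).
have dg : is_derive (0 : R) (1 : R) g (csf (c * (k 0 j)%:~R) k (a + pi / 2) x).
  have h1 : is_derive (0 : R) (1 : R) (fun r : R => dotk k x + a + (k 0 j)%:~R * r) ((k 0 j)%:~R).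
    apply: (is_derive_eq (is_deriveD (is_derive_cst (dotk k x + a) (0 : R) (1 : R))
      (is_deriveZ (k 0 j)%:~R (is_derive_id (0 : R) (1 : R))))).
    by rewrite add0r /GRing.scale /= mulr1.
  have h2 := @is_derive1_comp _ cos (fun r : R => dotk k x + a + (k 0 j)%:~R * r) 0 _ _ (is_derive_cos _) h1.
  have h3 := is_deriveZ c h2.
  apply: (@is_derive_eq _ _ _ _ _ _ _ _ h3).
  rewrite /csf addrA cosDpihalf mulr0 addr0 /GRing.scale /=; ring.
have E : (fun h : R => h^-1 *: ((g \o shift 0) (h *: (1 : R)) - g 0)) =
   (fun h => h^-1 *: ((csf c k a \o shift x) (h *: delta_mx 0 j) - csf c k a x)).
  apply/funext => h /=; rewrite /g /csf /GRing.scale /= addr0 mulr0 addr0 mulr1 dotkDr dotkZr dotk_delta.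
  by congr (_ * (c * cos _ - _)); ring.
case: dg => d1 d2; apply: DeriveDef; first by rewrite /derivable -E.
by rewrite -d2 /derive -E.
Qed.

Lemma partial_csf c k a j : partial j (csf c k a) = csf (c * (k 0 j)%:~R) k (a + pi / 2).
Proof. by apply/funext => x; have [] := csf_is_derive c k a j x. Qed.

Lemma csf_smooth c k a : smooth (csf c k a).
Proof.
move=> js; have [c' [a' ->]] : exists c' a', partials js (csf c k a) = csf c' k a'.
  elim: js => [|j js [c' [a' /= ->]]]; first by exists c, a.
  by exists (c' * (k 0 j)%:~R), (a' + pi / 2); rewrite partial_csf.
split; first exact: csf_continuous.
by move=> j x; have [] := csf_is_derive c' k a' j x.
Qed.

Lemma csf_per c k a : torus_periodic (csf c k a).
Proof.
move=> x j; rewrite /csf; congr (_ * _).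
have := ek_per k x j; rewrite /ek /expi => -[h1 h2].
by rewrite !cosD h1 h2.
Qed.

Definition cs k (a : R) : point -> R := fun x => cos (dotk k x + a).

Lemma csfE k a : csf 1 k a = cs k a.
Proof. by apply/funext => x; rewrite /csf mul1r. Qed.

Lemma rint_cs f k a : L2 (toC f) -> rint mu (fun t => f (tp t) * cs k a (tp t)).
Proof.
move=> hf; have [h _] := L2_cint hf.
have -> : (fun t => f (tp t) * cs k a (tp t)) = (fun t => cs k a (tp t) * f (tp t)).
  by apply/funext => t; rewrite mulrC.
apply: (rint_M _ h); apply: bmf_periodic; rewrite -csfE; [exact: csf_continuous|exact: csf_per].
Qed.

Lemma fourier_toC f k : L2 (toC f) -> fourier (toC f) k =
  (torus_int (fun x => f x * cs k 0 x) +i* - torus_int (fun x => f x * cs k (- (pi / 2)) x))%C.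
Proof.
move=> hf; rewrite /fourier /torus_intC /torus_int; congr (_ +i* _)%C.
  apply: eq_Rintegral => t _; rewrite /re /cs /= addr0 cosN; ring.
rewrite -RintN; last exact: rint_cs.
apply: eq_Rintegral => t _; rewrite /im /cs /= cosBpihalf sinN; ring.
Qed.

(** Cosines suffice as test functions: by [fourier_toC] the phases 0 and - pi / 2 give the two parts
    of a coefficient, and differentiation exchanges these phases up to sign. *)
Lemma fourier_parts f g j : L2 (toC f) -> L2 (toC g) ->
  (forall k a, torus_int (fun x => f x * partial j (csf 1 k a) x) =
     - torus_int (fun x => g x * csf 1 k a x)) ->
  forall k, fourier (toC g) k = 'i%C * ((k 0 j)%:~R%:C)%C * fourier (toC f) k.
Proof.
move=> hf hg h k; rewrite !fourier_toC//.
have h' a : torus_int (fun x => g x * cs k a x) =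
    - ((k 0 j)%:~R * torus_int (fun x => f x * cs k (a + pi / 2) x)).
  rewrite -csfE -[LHS]opprK -h; congr (- _); rewrite partial_csf /torus_int.
  rewrite -RintZ; last exact: rint_cs.
  by apply: eq_Rintegral => t _; rewrite /csf /cs mul1r; ring.
have cs_pi : cs k (0 + pi / 2) = (fun x => - cs k (- (pi / 2)) x).
  by apply/funext => x; rewrite /cs add0r cosDpihalf cosBpihalf.
rewrite !h' addNr cs_pi.
have -> : torus_int (fun x => f x * - cs k (- (pi / 2)) x) = - torus_int (fun x => f x * cs k (- (pi / 2)) x).
  rewrite /torus_int -RintN; last exact: rint_cs.
  by apply: eq_Rintegral => t _; rewrite mulrN.
by simpc; congr (_ +i* _)%C; ring.
Qed.

End continuous_periodic.

Section parseval.
Context {R : realType} {d : nat}.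
Local Notation mu := (torus_measure R d).
Local Notation point := 'rV[R]_d.
Local Notation Z := 'rV[int]_d.
Local Notation C := R[i].
Local Notation tp := (@torus_point R d).
Local Notation dd := (@dd R d).
Implicit Types (u v w : point -> C) (k : Z).

Lemma N2_sub_trigp u A : L2 u -> uniq A ->
  N2 (fun x => u x - trigp A (fourier u) x) = N2 u - dd^-1 * \sum_(k <- A) nc (fourier u k) ^+ 2.
Proof.
move=> hu uA; rewrite N2B//; last exact: L2_trigp.
rewrite inner_trigp// N2_trigp// ReZ Re_sum.
under eq_bigr do rewrite Re_mulconj.
ring.
Qed.

Lemma N2_trigp_to0 u : L2 u ->
  to0 (fun n => N2 (fun x => u x - trigp (box n) (fourier u) x)).
Proof.
move=> hu; have [e [e0 ge0 he]] := Hb_tail (bessel hu).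
have dge0 : 0 <= dd^-1 by rewrite invr_ge0 ltW// dd_gt0.
apply: to0_le (to0Z dge0 (to0_sqr ge0 e0)) => n.
have cE k : fourier (fun x => u x - trigp (box n) (fourier u) x) k =
    if k \in box n then 0 else fourier u k.
  rewrite (fourierB _ hu (L2_trigp _ _)) fourier_trigp ?uniq_box//.
  by case: ifP; rewrite ?subrr ?subr0.
apply: N2_le; first exact: L2B hu (L2_trigp _ _).
by apply: he => k; rewrite cE; case: ifP => // _; rewrite nc0 nc_ge0.
Qed.

Lemma parseval_N2 u : L2 u ->
  to0 (fun n => `|N2 u - dd^-1 * \sum_(k <- box n) nc (fourier u k) ^+ 2|).
Proof.
move=> hu; apply: to0_le (N2_trigp_to0 hu) => n.
by rewrite -N2_sub_trigp ?uniq_box// ger0_norm// N2_ge0.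
Qed.

(** Polarisation: 2 Re (u, v) = |u + v|^2 - |u|^2 - |v|^2, on both sides. *)
Lemma parseval u v : L2 u -> L2 v ->
  to0 (fun n => `|complex.Re (innerL2 u v)
     - dd^-1 * complex.Re (dot (box n) (fourier u) (fourier v))|).
Proof.
move=> hu hv.
have h := to0D (parseval_N2 (L2D hu hv)) (to0D (parseval_N2 hu) (parseval_N2 hv)).
apply: to0_le h => n.
have E : \sum_(k <- box n) nc (fourier (fun x => u x + v x) k) ^+ 2 =
  \sum_(k <- box n) nc (fourier u k) ^+ 2 + 2 * complex.Re (dot (box n) (fourier u) (fourier v)) +
  \sum_(k <- box n) nc (fourier v k) ^+ 2.
  under eq_bigr do rewrite fourierD//.
  rewrite /dot Re_sum mulr_sumr -!big_split; apply: eq_bigr => k _.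
  rewrite !nc_sqr; case: (fourier u k) => a b; case: (fourier v k) => a' b' /=.
  ring.
rewrite E N2D//.
set S1 := \sum_(k <- _) nc (fourier u k) ^+ 2; set S2 := \sum_(k <- _) nc (fourier v k) ^+ 2.
set r := complex.Re _; set q := complex.Re _.
have -> : r - dd^-1 * q = 2^-1 * (N2 u + 2 * r + N2 v - dd^-1 * (S1 + 2 * q + S2) - (N2 u - dd^-1 * S1) - (N2 v - dd^-1 * S2)).
  by move: (dd^-1) => D; field.
set X := N2 u + _ + _ - _; set Y := _ - _ * S1; set W := _ - _ * S2.
have := ler_norm X; have := ler_norm Y; have := ler_norm W.
have := ler_norm (-X); have := ler_norm (-Y); have := ler_norm (-W).
rewrite !normrN ler_norml => *; apply/andP; split; lra.
Qed.

Lemma eq_Re_inner u v u' v' : L2 u -> L2 v -> L2 u' -> L2 v' ->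
  (forall k, complex.Re (fourier u k * (fourier v k)^*%C) = complex.Re (fourier u' k * (fourier v' k)^*%C)) ->
  complex.Re (innerL2 u v) = complex.Re (innerL2 u' v').
Proof.
move=> hu hv hu' hv' h.
have h1 := to0D (parseval hu hv) (parseval hu' hv').
apply/eqP; rewrite -subr_eq0 -normr_le0; apply: to0_const.
apply: to0_le h1 => n.
rewrite /dot !Re_sum (eq_bigr _ (fun k _ => h k)).
set q := _ * \sum_(i <- _) _.
rewrite -[X in `|X|](subrKA q) (distrC (complex.Re (innerL2 u' v'))).
by rewrite (le_trans (ler_normD _ _))// lexx.
Qed.

End parseval.

(** * Weak derivatives and products *)

Section weak_derivative.
Context {R : realType} {d : nat}.
Local Notation mu := (torus_measure R d).
Local Notation point := 'rV[R]_d.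
Local Notation Z := 'rV[int]_d.
Local Notation C := R[i].
Local Notation tp := (@torus_point R d).
Local Notation dd := (@dd R d).
Implicit Types (u v w : point -> C) (f g phi : point -> R) (k : Z).

Lemma toC_reE u : toC (re u) = (fun x => (2^-1%:C)%C * (u x + (u x)^*%C)).
Proof.
apply/funext => x; rewrite /toC /re; case: (u x) => a b; simpc.
by congr (_ +i* _)%C => /=; field.
Qed.

Lemma L2_re u : L2 u -> L2 (toC (re u)).
Proof. by move=> hu; rewrite toC_reE; apply: L2Z; apply: L2D => //; exact: L2J. Qed.

Lemma fourier_re u k : L2 u ->
  fourier (toC (re u)) k = (2^-1%:C)%C * (fourier u k + (fourier u (- k))^*%C).
Proof.
move=> hu; rewrite toC_reE fourierZ; last by apply: L2D => //; exact: L2J.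
by rewrite fourierD ?fourierJ//; exact: L2J.
Qed.

Lemma fourier_toCN f k : L2 (toC f) -> fourier (toC f) (- k) = (fourier (toC f) k)^*%C.
Proof.
move=> hf; rewrite -[in RHS](opprK k) -fourierJ ?opprK//.
by apply: eq_fourier => x; rewrite /toC /= oppr0.
Qed.

Lemma Re_inner_toC f g : complex.Re (innerL2 (toC f) (toC g)) = torus_int (fun x => f x * g x).
Proof.
rewrite innerE /torus_intC /= /torus_int; apply: eq_Rintegral => t _.
by rewrite /re /toC /=; simpc.
Qed.

Lemma L2_toC_bdd f : continuous f -> torus_periodic f -> L2 (toC f).
Proof.
move=> cf pf; have [B hB] := continuous_periodic_bounded cf pf.
apply: (@L2_bdd _ _ _ B).
- by move=> x j; rewrite /toC pf.
- by apply: mfC_toC; exact: continuous_torus_measurable.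
- by move=> x; rewrite /toC nc_real.
Qed.

Lemma fourier_partial f j k : C1 j f ->
  fourier (toC (partial j f)) k = 'i%C * ((k 0 j)%:~R%:C)%C * fourier (toC f) k.
Proof.
move=> hf; have [p c cp _] := hf.
exact: (@fourier_parts R d f (partial j f) j (L2_toC_bdd c p)
  (L2_toC_bdd cp (periodic_partial j p))
  (fun l a => torus_parts hf (smooth_C1 j (@csf_per R d 1 l a) (@csf_smooth R d 1 l a))) k).
Qed.

(** The witness has coefficients i k_j f^(k). Riesz-Fischer yields a complex function; since [f] is
    real, these coefficients are those of its real part as well. *)
Lemma weak_partial_exists j f B : L2 (toC f) -> Hb 1 (fourier (toC f)) B ->
  exists g, is_weak_partial j f g.
Proof.
move=> hf hB.
pose h k : C := 'i%C * ((k 0 j)%:~R%:C)%C * fourier (toC f) k.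
have hh : Hb 0 h B.
  apply: Hb_dom hB => k; rewrite wt0 wt1 mul1r /h !ncM nc_i mul1r nc_real.
  by apply: ler_wpM2r; [exact: nc_ge0|exact: coord_le_bracket].
have [w [hw fw _]] := riesz_fischer hh.
have hg := L2_re hw.
exists (re w); split => // phi pp sp.
have c1 := smooth_C1 j pp sp; have [_ cphi cpphi _] := c1.
have Lp := L2_toC_bdd cphi pp; have Lpp := L2_toC_bdd cpphi (periodic_partial j pp).
rewrite -!Re_inner_toC.
rewrite (_ : - complex.Re _ = complex.Re (innerL2 (toC (re w)) (fun x => - toC phi x))); last first.
  by rewrite innerN// raddfN.
apply: eq_Re_inner => //; first exact: L2N.
move=> k; congr (complex.Re _).
rewrite fourier_partial// fourier_re// !fw /h fourier_toCN//.
have -> : fourier (fun x => - toC phi x) k = - fourier (toC phi) k.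
  by rewrite -mulN1r -fourierZ//; apply: eq_fourier => x; rewrite mulN1r.
rewrite mxE mulrNz.
case: (fourier (toC f) k) => a b; case: (fourier (toC phi) k) => a' b'.
by simpc; congr (_ +i* _)%C; field.
Qed.

(** Whichever weak derivative is picked, testing against cosines forces its coefficients. *)
Lemma weak_partial_fourier j f B : L2 (toC f) -> Hb 1 (fourier (toC f)) B ->
  L2 (toC (weak_partial j f)) /\
  forall k, fourier (toC (weak_partial j f)) k = 'i%C * ((k 0 j)%:~R%:C)%C * fourier (toC f) k.
Proof.
move=> hf /(weak_partial_exists j hf) hex.
have [hg h] : is_weak_partial j f (weak_partial j f) by have [g hg] := hex; exact: (xgetPex _ hex).
split => //; apply: fourier_parts => // k a.
by apply: h; [exact: csf_per|exact: csf_smooth].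
Qed.

End weak_derivative.

Section product.
Context {R : realType} {d : nat}.
Local Notation mu := (torus_measure R d).
Local Notation point := 'rV[R]_d.
Local Notation Z := 'rV[int]_d.
Local Notation C := R[i].
Local Notation tp := (@torus_point R d).
Local Notation dd := (@dd R d).
Implicit Types (u v w : point -> C) (k : Z).

Lemma nc_trigp_le A g (x : point) : nc (trigp A g x) <= (dd)^-1 * \sum_(k <- A) nc (g k).
Proof.
rewrite mulr_sumr; apply: (le_trans (nc_sum _ _)); apply: ler_sum => k _.
by rewrite !ncM nc_expi mulr1 nc_real ger0_norm// invr_ge0 ltW// dd_gt0.
Qed.

(** The partial Fourier sums obey the bound everywhere, so the excess of |u| over it is at most the
    distance to these sums, which tends to 0 in L2. *)
Lemma ae_nc_le u S : L2 u -> summ (fun k => nc (fourier u k)) S ->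
  {ae mu, forall t, nc (u (tp t)) <= dd^-1 * S}.
Proof.
move=> hu hS; set B := dd^-1 * S; have [S0 _ _] := hS.
pose h t := Num.max 0 (nc (u (tp t)) - B) ^+ 2.
have dge0 : 0 <= dd^-1 by rewrite invr_ge0 ltW// dd_gt0.
have hle n t : h t <= nc (u (tp t) - trigp (box n) (fourier u) (tp t)) ^+ 2.
  rewrite /h ler_sqr ?nnegrE ?nc_ge0 ?le_max ?lexx//.
  rewrite ge_max nc_ge0/=.
  have h1 := nc_tri_sub (u (tp t)) (trigp (box n) (fourier u) (tp t)).
  have h2 : nc (trigp (box n) (fourier u) (tp t)) <= B.
    apply: (le_trans (nc_trigp_le _ _ _)); apply: ler_wpM2l => //.
    by apply: summ_seq hS _; exact: uniq_box.
  by move: h1; rewrite ler_norml => /andP[_]; lra.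
have mu' := L2_mfC hu.
have mnc : measurable_fun setT (fun t => nc (u (tp t))) by exact: rint_mf (rint_nc hu).
have mh : measurable_fun setT h.
  by apply: measurable_funX; apply: measurable_maxr => //; exact: measurable_funB.
have h0 t : 0 <= h t by exact: sqr_ge0.
have ih : rint mu h.
  have /L2P[_ _ i0] := L2B hu (L2_trigp (box 0) (fourier u)).
  by apply: (rint_dom mh _ i0) => t; rewrite ger0_norm.
have : ae_eq mu setT (EFin \o h) (cst 0%E).
  apply/(ae_eq_integral_abs mu measurableT); first exact/measurable_EFinP.
  under eq_integral do rewrite /= ger0_norm//.
  rewrite Rint_EFin//; congr (_%:E); apply/eqP; rewrite eq_le Rint_ge0// andbT.
  apply: to0_const; apply: to0_le (N2_trigp_to0 hu) => n.
  apply: Rint_le => //.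
  by have /L2P[_ _ i0] := L2B hu (L2_trigp (box n) (fourier u)).
apply: filterS => t /(_ Logic.I) /= [].
move=> /eqP; rewrite sqrf_eq0 => /eqP hm.
have : nc (u (tp t)) - B <= Num.max 0 (nc (u (tp t)) - B) by rewrite le_max lexx orbT.
by rewrite hm subr_le0.
Qed.

(** The convolution formula is exact when [w] is replaced by a partial Fourier sum. The remainder of
    [w] is almost everywhere bounded by the tail of its coefficients, so its product with [u] is
    small in L2. *)
Lemma product_fourier w u S : L2 w -> L2 u -> summ (fun k => nc (fourier w k)) S ->
  L2 (fun x => w x * u x) /\
  forall k, to0 (fun n => nc ((dd^-1%:C)%C *
      \sum_(p <- box n) fourier w p * fourier u (k - p) - fourier (fun x => w x * u x) k)).
Proof.
move=> hw hu hS.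
have dge0 : 0 <= dd^-1 by rewrite invr_ge0 ltW// dd_gt0.
have key (w' : point -> C) S' : L2 w' -> summ (fun k => nc (fourier w' k)) S' ->
    L2 (fun x => w' x * u x) /\ N2 (fun x => w' x * u x) <= (dd^-1 * S') ^+ 2 * N2 u.
  move=> hw' hS'; have hae := ae_nc_le hw' hS'.
  have S0 : 0 <= dd^-1 * S' by case: hS' => S0 _ _; rewrite mulr_ge0.
  have /L2P[pw mw iw] := hw'; have /L2P[pu mu' iu] := hu.
  (* The bound on [w'] holds almost everywhere only; the minimum obeys it everywhere and has the
     same integral. *)
  pose f t := Num.min (nc (w' (tp t) * u (tp t)) ^+ 2) ((dd^-1 * S') ^+ 2 * nc (u (tp t)) ^+ 2).
  have mwu := mf_nc2 (mfCM mw mu').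
  have mf : measurable_fun setT f.
    apply: measurable_minr => //.
    by apply: measurable_funM => //; exact: (mf_nc2 mu').
  have fE : {ae mu, forall t, f t = nc (w' (tp t) * u (tp t)) ^+ 2}.
    apply: filterS hae => t ht; apply/min_idPl.
    by rewrite ncM exprMn; apply: ler_wpM2r; rewrite ?sqr_ge0// ler_sqr ?nnegrE ?nc_ge0.
  have fle t : f t <= (dd^-1 * S') ^+ 2 * nc (u (tp t)) ^+ 2 by rewrite ge_min lexx orbT.
  have ff : rint mu f.
    apply: (rint_dom mf _ (rintZ ((dd^-1 * S') ^+ 2) iu)) => t.
    by rewrite ger0_norm// le_min sqr_ge0/= mulr_ge0// sqr_ge0.
  have i1 : rint mu (fun t => nc (w' (tp t) * u (tp t)) ^+ 2) by exact: rint_ae ff mwu fE.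
  split; first by apply/L2P; split; [exact: perM|exact: mfCM|].
  rewrite /N2 -(Rint_ae mf mwu fE) -RintZ//.
  by apply: Rint_le => //; exact: rintZ.
have [hwu _] := key _ _ hw hS; split => // k.
have [e [e0 ge0 he]] := summ_tail hS.
have hn n : N2 (fun x => (w x - trigp (box n) (fourier w) x) * u x) <= (dd^-1 * e n) ^+ 2 * N2 u /\
    L2 (fun x => (w x - trigp (box n) (fourier w) x) * u x).
  have [|h1 h2] := key (fun x => w x - trigp (box n) (fourier w) x) (e n) (L2B hw (L2_trigp _ _)); last by split.
  split=> [//|l|m]; first exact: nc_ge0.
  apply: (le_trans _ (he n [seq k <- box m | k \notin box n] (filter_uniq _ (uniq_box _)) _)); last first.
    by move=> l; rewrite mem_filter => /andP[].
  under eq_bigr do rewrite (fourierB _ hw (L2_trigp _ _)) fourier_trigp ?uniq_box//.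
  rewrite big_filter (bigID (fun k => k \notin box n)) -[leRHS]addr0 lerD//.
    by apply: ler_sum => l /negbTE ->; rewrite subr0.
  by rewrite big1// => l; rewrite negbK => /andP[_ ->]; rewrite subrr nc0.
have h3 : to0 (fun n => Num.sqrt (dd * ((dd^-1 * e n) ^+ 2 * N2 u))).
  have -> : (fun n => Num.sqrt (dd * ((dd^-1 * e n) ^+ 2 * N2 u))) =
     (fun n => Num.sqrt (dd * N2 u) * dd^-1 * e n).
    apply/funext => n; rewrite mulrCA mulrC sqrtrM ?mulr_ge0 ?N2_ge0// ?ltW ?dd_gt0//.
    by rewrite sqrtr_sqr ger0_norm ?mulr_ge0// mulrA.
  by apply: to0Z => //; rewrite mulr_ge0// sqrtr_ge0.
apply: to0_le h3 => n; have [h4 h5] := hn n.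
have h6 := Hb_pt k (bessel h5); rewrite wt0 mul1r in h6.
apply: (le_trans _ (le_trans h6 _)); last first.
  by rewrite ler_sqrt ?mulr_ge0 ?N2_ge0 ?sqr_ge0 ?(ltW dd_gt0)//; apply: ler_wpM2l => //; exact: ltW dd_gt0.
rewrite nc_distC.
have Lt : L2 (fun x => trigp (box n) (fourier w) x * u x).
  have -> : (fun x => trigp (box n) (fourier w) x * u x) =
     (fun x => w x * u x - (w x - trigp (box n) (fourier w) x) * u x).
    by apply/funext => x; ring.
  exact: L2B.
have -> : fourier (fun x => (w x - trigp (box n) (fourier w) x) * u x) k =
   fourier (fun x => w x * u x) k - fourier (fun x => trigp (box n) (fourier w) x * u x) k.
  by rewrite -fourierB//; apply: eq_fourier => x; ring.
have -> : fourier (fun x => trigp (box n) (fourier w) x * u x) k =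
   fourier (fun x => \sum_(p <- box n) (dd^-1%:C)%C * fourier w p * (ek p x * u x)) k.
  apply: eq_fourier => x; rewrite /trigp mulr_suml; apply: eq_bigr => p _; ring.
have Le p : L2 (fun x => ek p x * u x).
  by apply: (@L2_bddM _ _ _ 1) => //; [exact: ek_per|exact: mfC_ek|move=> x; rewrite nc_expi].
rewrite fourier_sum; last by move=> p; exact: L2Z.
rewrite mulr_sumr.
under [in leRHS]eq_bigr => p _ do rewrite (fourierZ _ _ (Le p)) fourier_ekM -mulrA.
exact: lexx.
Qed.

End product.

(** * Sobolev norms and Lie derivatives *)

Section sobolev_norms.
Context {R : realType} {d : nat}.
Local Notation point := 'rV[R]_d.
Local Notation Z := 'rV[int]_d.
Local Notation C := R[i].
Local Notation dd := (@dd R d).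
Implicit Types (u v w : point -> C) (k : Z).

Lemma sobolev_norm_ge0 sigma u : (0 <= sobolev_norm sigma u)%E.
Proof. exact: sqrte_ge0. Qed.

Lemma sobolev_Hb sigma u : (sobolev_norm sigma u < +oo)%E ->
  Hb sigma (fourier u) (fine (sobolev_norm sigma u)).
Proof.
move=> h; have h0 := sobolev_norm_ge0 sigma u.
split; first exact: fine_ge0.
move=> A uA; rewrite -lee_fin EFin_expe fineK ?ge0_fin_numE//.
rewrite /sobolev_norm sqr_sqrte; last first.
  by apply: esum_ge0 => k _; rewrite lee_fin mulr_ge0 ?powR_ge0 ?sqr_ge0.
apply: esum_ge; exists [set` A]; first by split; first exact: finite_seq.
rewrite -fsbig_seq// -sumEFin; apply: lee_sum => k _.
by rewrite lee_fin exprMn wt_sqr.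
Qed.

Lemma vsobolev_comp sigma (X : point -> point) j :
  (sobolev_norm sigma (toC (vcomp X j)) <= vsobolev_norm sigma X)%E.
Proof.
rewrite -[leLHS]gee0_abs ?sobolev_norm_ge0// -sqrte_sqr /vsobolev_norm.
have h i : (0 <= sobolev_norm sigma (toC (vcomp X i)) ^+ 2)%E by rewrite expe2 mule_ge0// sobolev_norm_ge0.
rewrite lee_sqrt; last exact: sume_ge0.
rewrite (bigD1 j)//=; apply: leeDl; apply: sume_ge0 => i _; exact: h.
Qed.

(** Cauchy-Schwarz against <p>^-d, which is square summable; this is the price of [d] extra
    derivatives. *)
Lemma summ_sobolev (m : nat) : exists2 K : R, 0 <= K & forall (g : Z -> C) B,
  Hb (m + d)%:R g B -> summ (fun p => nc (g p) * om p ^+ m) (K * B).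
Proof.
have [S hS] := @summ_inv_bracket R d; have [S0 _ hS'] := hS.
exists ((d.+1%:R) ^+ m * Num.sqrt S); first by rewrite mulr_ge0 ?exprn_ge0 ?sqrtr_ge0.
move=> g B [B0 hB]; split.
- by rewrite !mulr_ge0 ?exprn_ge0 ?sqrtr_ge0.
- by move=> k; rewrite mulr_ge0 ?nc_ge0// exprn_ge0// ltW// om_gt0.
move=> n; rewrite -mulrA.
apply: (@le_trans _ _ (\sum_(p <- box n) d.+1%:R ^+ m * (bracket p ^- d * (wt (m + d)%:R p * nc (g p))))).
  apply: ler_sum => p _.
  have b0 := @bracket_gt0 R d p.
  have -> : bracket p ^- d * (wt (m + d)%:R p * nc (g p)) = bracket p ^+ m * nc (g p) :> R.
    by rewrite wt_nat exprD mulrA (mulrC _ (_ * _)) mulfK// expf_neq0// gt_eqF.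
  rewrite mulrA -exprMn mulrC ler_wpM2r ?nc_ge0//.
  by rewrite lerXn2r ?nnegrE ?om_le_bracket// ?(ltW (om_gt0 _)) ?mulr_ge0// ltW.
rewrite -mulr_sumr ler_wpM2l ?exprn_ge0//.
apply: sum_cs_le => //; last exact: hB (uniq_box n).
rewrite sqr_sqrtr//; apply: le_trans (hS' n); apply: ler_sum => p _.
by rewrite -exprVn -exprM mulnC exprVn.
Qed.

End sobolev_norms.

Section lie_derivative.
Context {R : realType} {d : nat}.
Local Notation point := 'rV[R]_d.
Local Notation Z := 'rV[int]_d.
Local Notation C := R[i].
Local Notation dd := (@dd R d).
Implicit Types (k p : Z) (X : point -> point) (f : point -> R).

Definition vhat X p j : C := (dd^-1%:C)%C * fourier (toC (vcomp X j)) p.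

Lemma vhatN X p j : L2 (toC (vcomp X j)) -> vhat X (- p) j = (vhat X p j)^*%C.
Proof. by move=> hX; rewrite /vhat fourier_toCN// rmorphM /= oppr0. Qed.

Lemma toC_sum (I : Type) (r : seq I) (F : I -> point -> R) :
  toC (fun x => \sum_(i <- r) F i x) = (fun x => \sum_(i <- r) toC (F i) x).
Proof. by apply/funext => x; rewrite /toC raddf_sum. Qed.

Lemma vhat_summ (m : nat) : exists2 K : R, 0 < K & forall X B,
  (forall j, Hb (m + d)%:R (fourier (toC (vcomp X j))) B) -> 0 <= B ->
  summ (fun p => vn (vhat X) p * om p ^+ m) (K * B).
Proof.
have [K K0 hK] := @summ_sobolev R d m.
exists (d%:R * dd^-1 * K + 1).
  by rewrite ltr_wpDl// !mulr_ge0// invr_ge0 ltW// dd_gt0.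
move=> X B hX B0.
have dge0 : 0 <= dd^-1 by rewrite invr_ge0 ltW// dd_gt0.
split=> [|p|n].
- by rewrite mulr_ge0// addr_ge0// !mulr_ge0.
- by rewrite mulr_ge0 ?vn_ge0// exprn_ge0// ltW// om_gt0.
rewrite mulrDl mul1r; apply: ler_wpDr => //.
have -> : d%:R * dd^-1 * K * B = \sum_(j < d) dd^-1 * (K * B).
  by rewrite sumr_const card_ord -[RHS]mulr_natl !mulrA.
under eq_bigr do rewrite mulr_suml.
rewrite exchange_big; apply: ler_sum => j _.
have [_ _ /(_ n)] := hK _ _ (hX j).
move=> /(ler_wpM2l dge0); apply: le_trans.
rewrite mulr_sumr; apply: ler_sum => p _.
by rewrite /vhat ncM nc_real ger0_norm// mulrA.
Qed.

(** With v = [vhat X], the products X.grad f and (div X) f have coefficients i l.v(p) and i p.v(p),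
    which add up to [bL]. Summability of [vn] with one power of [om] makes the coefficients of both
    X and div X absolutely summable, as [product_fourier] requires. *)
Lemma lie_fourier X f B V : (forall j, L2 (toC (vcomp X j))) ->
  (forall j, exists B', Hb 1 (fourier (toC (vcomp X j))) B') ->
  summ (fun p => vn (vhat X) p * om p ^+ 1) V ->
  L2 (toC f) -> Hb 1 (fourier (toC f)) B ->
  L2 (toC (lie X f)) /\ oplim (bL (vhat X)) (fourier (toC f)) (fourier (toC (lie X f))).
Proof.
move=> hX hX1 hV hf hB.
have dge0 : 0 <= dd^-1 by rewrite invr_ge0 ltW// dd_gt0.
have dne0 : dd != 0 by rewrite gt_eqF// dd_gt0.
have [V0 Vge0 hVn] := hV.
have vhE p j : fourier (toC (vcomp X j)) p = (dd%:C)%C * vhat X p j.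
  by rewrite /vhat mulrA -rmorphM /= mulfV// mul1r.
have nv p j : nc (vhat X p j) <= vn (vhat X) p.
  by rewrite /vn (bigD1 j)//= lerDl sumr_ge0// => i _; exact: nc_ge0.
have hdf j := weak_partial_fourier j hf hB.
have hdX i j : L2 (toC (weak_partial j (vcomp X i))) /\
   forall k, fourier (toC (weak_partial j (vcomp X i))) k = 'i%C * ((k 0 j)%:~R%:C)%C * fourier (toC (vcomp X i)) k.
  by have [B' hB'] := hX1 i; exact: weak_partial_fourier (hX i) hB'.
have Ldiv : L2 (toC (divergence X)).
  by rewrite /divergence toC_sum; apply: L2_sum => j; case: (hdX j j).
have fdiv k : fourier (toC (divergence X)) k = (dd%:C)%C * ('i%C * dotv (vhat X) k k).
  rewrite /divergence toC_sum fourier_sum => [|j]; last by case: (hdX j j).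
  rewrite /dotv !mulr_sumr; apply: eq_bigr => j _; have [_ ->] := hdX j j.
  rewrite vhE (_ : ((k 0 j)%:~R%:C)%C = (k 0 j)%:~R :> C); first ring.
  exact: (rmorph_int (@real_complex R)).
have sX j : summ (fun p => nc (fourier (toC (vcomp X j)) p)) (dd * V).
  split=> [|p|n]; [by rewrite mulr_ge0// ltW// dd_gt0|exact: nc_ge0|].
  apply: (le_trans _ (ler_wpM2l (ltW dd_gt0) (hVn n))); rewrite mulr_sumr; apply: ler_sum => p _.
  rewrite vhE ncM nc_real gtr0_norm ?dd_gt0// ler_wpM2l ?(ltW dd_gt0)//.
  by apply: (le_trans (nv p j)); rewrite expr1 ler_peMr ?vn_ge0 ?om_ge1.
have sdiv : summ (fun p => nc (fourier (toC (divergence X)) p)) (dd * V).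
  split=> [|p|n]; [by rewrite mulr_ge0// ltW// dd_gt0|exact: nc_ge0|].
  apply: (le_trans _ (ler_wpM2l (ltW dd_gt0) (hVn n))); rewrite mulr_sumr; apply: ler_sum => p _.
  rewrite fdiv !ncM nc_i mul1r nc_real gtr0_norm ?dd_gt0// ler_wpM2l ?(ltW dd_gt0)// expr1.
  exact: nc_dotv_om.
have prodX j := product_fourier (hX j) (proj1 (hdf j)) (sX j).
have proddiv := product_fourier Ldiv hf sdiv.
have lieE : toC (lie X f) = (fun x => (\sum_j toC (vcomp X j) x * toC (weak_partial j f) x) +
     toC (divergence X) x * toC f x).
  apply/funext => x; rewrite /toC /lie rmorphD rmorphM /= rmorph_sum; congr (_ + _).
  by apply: eq_bigr => j _; rewrite rmorphM.
have L1 : L2 (fun x => \sum_j toC (vcomp X j) x * toC (weak_partial j f) x).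
  by apply: L2_sum => j; case: (prodX j).
have [Ldf hdivf] := proddiv.
split; first by rewrite lieE; exact: L2D.
move=> k; rewrite lieE fourierD// fourier_sum; last by move=> j; case: (prodX j).
have hj j := (proj2 (prodX j)) k.
apply: to0_le (to0D (to0_sum (index_enum 'I_d) hj) (hdivf k)) => n.
set G := fun j => fourier (fun x => toC (vcomp X j) x * toC (weak_partial j f) x) k.
set H := fourier (fun x => toC (divergence X) x * toC f x) k.
have -> : op (bL (vhat X)) n (fourier (toC f)) k =
  (\sum_j (dd^-1%:C)%C * \sum_(p <- box n) fourier (toC (vcomp X j)) p * fourier (toC (weak_partial j f)) (k - p)) +
  (dd^-1%:C)%C * \sum_(p <- box n) fourier (toC (divergence X)) p * fourier (toC f) (k - p).
  under [in RHS]eq_bigr do rewrite mulr_sumr.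
  rewrite exchange_big mulr_sumr -big_split /op /opI; apply: eq_bigr => p _.
  rewrite fdiv /bL subrK.
  have ddK (z : C) : (dd^-1%:C)%C * ((dd%:C)%C * z) = z by rewrite mulrA ddC_unit mul1r.
  rewrite -[(dd%:C)%C * _ * _]mulrA ddK.
  have -> : \sum_j (dd^-1%:C)%C * (fourier (toC (vcomp X j)) p * fourier (toC (weak_partial j f)) (k - p)) =
     'i%C * dotv (vhat X) (k - p) p * fourier (toC f) (k - p).
    rewrite /dotv mulr_sumr mulr_suml; apply: eq_bigr => j _.
    rewrite vhE (proj2 (hdf j)) -[(dd%:C)%C * _ * _]mulrA ddK.
    rewrite (_ : (((k - p) 0 j)%:~R%:C)%C = ((k - p) 0 j)%:~R :> C); first ring.
    exact: (rmorph_int (@real_complex R)).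
  by rewrite /= -mulrDl -mulrDr -dotvD subrK.
rewrite -/G opprD addrACA -sumrB.
by apply: (le_trans (ncD _ _)); rewrite lerD2r; exact: nc_sum.
Qed.

End lie_derivative.

(** * Pseudodifferential operators *)

Section l2_limits.
Context {R : realType} {d : nat}.
Local Notation mu := (torus_measure R d).
Local Notation point := 'rV[R]_d.
Local Notation Z := 'rV[int]_d.
Local Notation C := R[i].
Local Notation tp := (@torus_point R d).
Local Notation dd := (@dd R d).
Implicit Types (u v w : point -> C) (k : Z).

Lemma is_L2limP {I : Type} (F : set_system I) {FF : Filter F} (w : I -> point -> C) v :
  (forall i, L2 (w i)) -> is_L2lim F w v <->
  L2 v /\ forall eps, 0 < eps -> \forall i \near F, N2 (fun x => w i x - v x) <= eps.
Proof.
move=> hw; split=> [[hv h]|[hv h]]; split => //.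
  move=> eps e0; move/fine_cvgP: h => [_ /cvgrPdist_le /(_ eps e0)].
  apply: filterS => i; rewrite /comp (L2_int (L2B (hw i) hv)) /= sub0r normrN.
  exact/le_trans/ler_norm.
have -> : (fun i => \int[mu]_t (nc (w i (tp t) - v (tp t)) ^+ 2)%:E)%E =
   (fun i => (N2 (fun x => w i x - v x))%:E).
  by apply/funext => i; rewrite (L2_int (L2B (hw i) hv)).
apply/fine_cvgP; split; first by apply: filterE.
apply/cvgrPdist_le => eps e0; apply: filterS (h _ e0) => i /=.
by rewrite sub0r normrN ger0_norm// N2_ge0.
Qed.

(** Riesz-Fischer provides a limit, so [L2lim] is not its default value; Bessel's inequality forces
    the coefficients of any limit to be [y]. *)
Lemma L2lim_fourier {I : Type} (F : set_system I) {FF : ProperFilter F}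
    (w : I -> point -> C) (y : Z -> C) Y : (forall i, L2 (w i)) -> Hb 0 y Y ->
  (forall eps, 0 < eps -> \forall i \near F, Hb 0 (fun k => fourier (w i) k - y k) eps) ->
  L2 (L2lim F w) /\ forall k, fourier (L2lim F w) k = y k.
Proof.
move=> hw hy h; have [v [hv fv _]] := riesz_fischer hy.
have d0 := @dd_gt0 R d.
have hex : exists v, is_L2lim F w v.
  exists v; apply/is_L2limP => //; split => // eps e0.
  have s0 : 0 < Num.sqrt (dd * eps) by rewrite sqrtr_gt0 mulr_gt0.
  apply: filterS (h _ s0) => i hi.
  have := @N2_le _ _ _ (Num.sqrt (dd * eps)) (L2B (hw i) hv).
  rewrite sqr_sqrtr ?mulr_ge0 ?(ltW d0) ?(ltW e0)// mulrA mulVf ?gt_eqF// mul1r; apply.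
  by apply: Hb_eq hi => k; rewrite fourierB// fv.
have /is_L2limP : is_L2lim F w (L2lim F w) by exact: (xgetPex _ hex).
move=> /(_ hw)[hL hN]; split => // k.
apply/eqP; rewrite -subr_eq0; apply/eqP; apply: nc_eq0; apply/eqP; rewrite eq_le nc_ge0 andbT.
apply: to0_const => eps2 e20; exists 0%N => _ _; pose eps := eps2 / 2; have e0 : 0 < eps by rewrite divr_gt0.
have eE : eps2 = eps + eps by rewrite /eps -splitr.
have s0 : 0 < eps ^+ 2 / dd by rewrite divr_gt0// exprn_gt0.
have [i [h1 h2]] : exists i, Hb 0 (fun k => fourier (w i) k - y k) eps /\ N2 (fun x => w i x - L2lim F w x) <= eps ^+ 2 / dd.
  by apply: (@filter_ex _ F); apply: filterI; [exact: h|exact: hN].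
have := Hb_pt k h1; rewrite wt0 mul1r => h3.
have := Hb_pt k (bessel (L2B (hw i) hL)); rewrite wt0 mul1r fourierB// => h4.
have h5 : Num.sqrt (dd * N2 (fun x => w i x - L2lim F w x)) <= eps.
  have -> : eps = Num.sqrt (eps ^+ 2) by rewrite sqrtr_sqr ger0_norm ?ltW.
  rewrite ler_sqrt ?sqr_ge0//.
  by rewrite mulrC -ler_pdivlMr.
have := ncB (fourier (w i) k - y k) (fourier (w i) k - fourier (L2lim F w) k).
set z1 := fourier (w i) k; set z2 := fourier (L2lim F w) k.
have -> : z1 - y k - (z1 - z2) = z2 - y k by ring.
move: h3 h4 h5; rewrite -/z1 -/z2 eE; move=> h3 h4 h5 h6; lra.
Qed.

End l2_limits.

Section pseudodifferential.
Context {R : realType} {d : nat}.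
Local Notation mu := (torus_measure R d).
Local Notation point := 'rV[R]_d.
Local Notation Z := 'rV[int]_d.
Local Notation C := R[i].
Local Notation tp := (@torus_point R d).
Local Notation dd := (@dd R d).
Implicit Types (u v w : point -> C) (k : Z) (A : seq Z).

(** Summing over the source l = k - q instead of the shift [q], the truncated sum is exact once the
    box contains all k - l with l in [A]. *)
Lemma op_finite (b : Z -> Z -> C) A (g : Z -> C) : uniq A -> (forall k, k \notin A -> g k = 0) ->
  oplim b g (fun k => \sum_(l <- A) b (k - l) l * g l).
Proof.
move=> uA gA k; have [a ha] := seq_sub_box (map (fun l => k - l) A).
move=> eps e0; exists a => n an; rewrite [X in nc X](_ : _ = 0) ?nc0 ?ltW//.
apply/eqP; rewrite subr_eq0; apply/eqP.
rewrite /op /opI.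
have -> : \sum_(q <- box n) b q (k - q) * g (k - q) =
   \sum_(l <- map (fun q => k - q) (box n)) b (k - l) l * g l.
  by rewrite [RHS]big_map; apply: eq_bigr => q _; rewrite subKr.
apply: sum_supp => //.
  by rewrite map_inj_uniq ?uniq_box//; apply: inv_inj; exact: subKr.
move=> l hl.
have lA : l \in A by apply: contraNT hl => /gA ->; rewrite mulr0.
split => //; apply/mapP; exists (k - l); last by rewrite subKr.
by apply: (box_le an); apply: ha; apply/mapP; exists l.
Qed.

(** The entry from [l] to [l + q] of the matrix of [pdo a]. *)
Definition bP (a : point -> Z -> C) (q l : Z) : C := (dd^-1%:C)%C * fourier (a^~ l) q.

(** A finite part of the series of [pdo] is the operator applied to a restriction of the
    coefficients of [u]; its distance to [y] is at most [S] times the H^s norm of the remaining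
    coefficients. *)
Lemma pdo_fourier (a : point -> Z -> C) s M c S u B :
  (forall k, torus_periodic (a^~ k)) -> (forall k, mfC (a^~ k)) ->
  (forall k, exists K, forall x, nc (a x k) <= K) ->
  fam s M (bP a) c S -> Hb s (fourier u) B ->
  L2 (pdo a u) /\ oplim (bP a) (fourier u) (fourier (pdo a u)).
Proof.
move=> pa ma ba hfam hB.
have r0 : `|0 : R| <= M%:R by rewrite normr0.
have [B0 hBs] := hB.
have S0 : 0 <= S by case: hfam => _ _ [].
have hB0 : Hb (0 + s) (fourier u) B by rewrite add0r.
have [y hy] := oplim_exists hfam r0 hB0.
have yH := Hb_oplim hfam r0 hB0 hy.
pose w k x : C := (((2 * pi) ^+ d)^-1%:C)%C * (a x k * expi (dotk k x) * fourier u k).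
have wE k : w k = (fun x => ((dd^-1%:C)%C * fourier u k) * (ek k x * a x k)).
  by apply/funext => x; rewrite /w /ek -/dd; ring.
have Lea k : L2 (fun x => ek k x * a x k).
  have [K hK] := ba k.
  apply: (@L2_bdd _ _ _ K); [exact: perM (ek_per k) (pa k)|exact: mfCM (mfC_ek k) (ma k)|].
  by move=> x; rewrite ncM nc_expi mul1r.
have Lw k : L2 (w k) by rewrite wE; exact: L2Z.
have fw k l : fourier (w k) l = bP a (l - k) k * fourier u k.
  by rewrite wE fourierZ// fourier_ekM /bP; ring.
have [e [e0 ge0 he]] := Hb_tail hB.
have FF : ProperFilter (filter_from [set: {fset Z}] (fun A : {fset Z} => [set B | (A `<=` B)%fset])).
  apply: filter_from_proper; last by move=> A _; exists A => /=.
  apply: filter_from_filter; first by exists fset0.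
  move=> A A' _ _; exists (A `|` A')%fset => // A'' /= h; split => /=.
    exact: fsubset_trans (fsubsetUl _ _) h.
  exact: fsubset_trans (fsubsetUr _ _) h.
suff hlim : forall eps, 0 < eps ->
    filter_from [set: {fset Z}] (fun A : {fset Z} => [set B | (A `<=` B)%fset])
      [set D : {fset Z} | Hb 0 (fun k => fourier (fun x => \sum_(k <- D) w k x) k - y k) eps].
  have [h1 h2] := @L2lim_fourier R d _ _ FF (fun (A : {fset Z}) x => \sum_(k <- A) w k x) y (S * B)
   (fun A : {fset Z} => L2_sum _ Lw) yH hlim.
  split; first exact: h1.
  by rewrite (_ : fourier (pdo a u) = y)//; apply/funext => k; exact: h2.
move=> eps eps0.
have del0 : 0 < eps / (S + 1) by rewrite divr_gt0// ltr_wpDl.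
have [n hn] := e0 _ del0.
(* Every finite set containing [box n] leaves a remainder that vanishes on the box, so the tail of
   [u] bounds it uniformly. *)
exists [fset k in box n]%fset => // A /= hA.
pose g k := if k \in A then fourier u k else 0.
have hg : oplim (bP a) g (fourier (fun x => \sum_(k <- A) w k x)).
  rewrite (_ : fourier _ = fun k => \sum_(l <- A) bP a (k - l) l * g l).
    by apply: op_finite; [exact: fset_uniq|move=> k; rewrite /g => /negbTE ->].
  apply/funext => k; rewrite fourier_sum// !big_seq; apply: eq_bigr => l lA.
  by rewrite fw /g lA.
have hdel : Hb (0 + s) (fun k => g k - fourier u k) (eps / (S + 1)).
  rewrite add0r; apply: Hb_le (hn n (leqnn n)); apply: he => k.
    move=> kn; have kA : k \in A by apply: (fsubsetP hA); rewrite !inE.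
    by rewrite /g kA subrr.
  by rewrite /g; case: ifP => _; [rewrite subrr nc0 nc_ge0|rewrite sub0r ncN].
have := Hb_oplim hfam r0 hdel (oplimB hg hy); move=> hfin.
apply: Hb_le hfin _.
by rewrite mulrA ler_pdivrMr ?ltr_wpDl// mulrC ler_wpM2l ?(ltW eps0)// lerDl.
Qed.

End pseudodifferential.

(** * Decay of the Fourier coefficients of a symbol *)

Section differences.
Context {R : realType} {d : nat}.
Local Notation Z := 'rV[int]_d.
Local Notation C := R[i].
Local Notation multi := (@multi d).
Implicit Types (h : Z -> C) (k : Z) (i j : 'I_d).

(** The multi-indices e_i + e_j, for second differences, and n e_j, for powers of one coordinate. *)
Definition mono2 i j : multi := [ffun m => ((m == i) + (m == j))%N].
Definition monoX (n : nat) j : multi := [ffun m => if m == j then n else 0%N].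

Lemma abs_monoX n j : abs_multi (monoX n j) = n.
Proof.
rewrite /abs_multi (bigD1 j)//= ffunE eqxx big1 ?addn0// => m mj.
by rewrite ffunE (negbTE mj).
Qed.

Lemma abs_mono2 i j : abs_multi (mono2 i j) = 2%N.
Proof.
rewrite /abs_multi; under eq_bigr do rewrite ffunE.
rewrite big_split (bigD1 i)//= eqxx big1 => [|m /negbTE -> //].
by rewrite (bigD1 j)//= eqxx big1 => [|m /negbTE -> //].
Qed.

Lemma mdiffZ (alpha : multi) c h k : mdiff alpha (fun l => c * h l) k = c * mdiff alpha h k.
Proof. by rewrite /mdiff mulr_sumr; apply: eq_bigr => g _; ring. Qed.

(** Trades the dependent functions gamma <= alpha for a plain index type: [unit], [bool], ['I_3] and
    [bool * bool] in the cases below. *)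
Lemma mdiff_reindex (J : finType) (alpha : multi) (F : J -> 'I_d -> nat) (G : ('I_d -> nat) -> J) h k :
  (forall b m, (F b m <= alpha m)%N) -> (forall b, G (F b) = b) ->
  (forall g : 'I_d -> nat, (forall m, (g m <= alpha m)%N) -> forall m, F (G g) m = g m) ->
  mdiff alpha h k = \sum_b (-1) ^+ (\sum_m (alpha m - F b m))%N * (\prod_m 'C(alpha m, F b m))%:R
    * h (k + \row_m (F b m)%:Z).
Proof.
move=> Fle GF FG.
pose dff := {dffun forall j : 'I_d, 'I_(alpha j).+1}.
pose mk (b : J) : dff := finfun (fun m => inord (F b m)).
have mkE b m : mk b m = F b m :> nat by rewrite /mk ffunE inordK// ltnS Fle.
rewrite /mdiff (reindex mk); last first.
  exists (fun g : dff => G (fun m => g m)) => [b _|g _].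
    by rewrite -[RHS]GF; congr G; apply/funext => m; exact: mkE.
  apply/ffunP => m; apply/val_inj; rewrite /= mkE FG// => m'.
  by rewrite -ltnS ltn_ord.
apply: eq_bigr => b _; congr (_ ^+ _ * _%:R * h (_ + _)).
- by apply: eq_bigr => m _; rewrite mkE.
- by apply: eq_bigr => m _; rewrite mkE.
- by apply/rowP => m; rewrite !mxE mkE.
Qed.

Lemma mdiff_monoX0 j h k : mdiff (monoX 0 j) h k = h k.
Proof.
have a0 m : monoX 0 j m = 0%N by rewrite ffunE; case: ifP.
rewrite (@mdiff_reindex unit _ (fun=> fun=> 0%N) (fun=> tt)) => [|//|[]//|g hg m]; last first.
  by apply/esym/eqP; rewrite -leqn0 -(a0 m).
rewrite (big_pred1 tt) => [|[]//].
rewrite big1 ?big1 => [|m _|m _]; rewrite ?a0//.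
rewrite expr0 !mul1r; congr h; rewrite -[RHS]addr0; congr (_ + _).
by apply/rowP => m; rewrite !mxE.
Qed.

Lemma mdiff_monoX1 j h k : mdiff (monoX 1 j) h k = dif h (uv j) k.
Proof.
pose F (b : bool) (m : 'I_d) : nat := if m == j then nat_of_bool b else 0%N.
rewrite (@mdiff_reindex bool _ F (fun g => g j != 0%N)) => [|b m|b|g hg m].
- rewrite big_bool /=.
  have hS b : (\sum_m (monoX 1 j m - F b m))%N = (1 - b)%N.
    rewrite (bigD1 j)//= big1 => [|m /negbTE mj]; first by rewrite addn0 ffunE /F eqxx.
    by rewrite ffunE /F mj.
  have hP b : (\prod_m 'C(monoX 1 j m, F b m))%N = 1%N.
    by rewrite big1// => m _; rewrite ffunE /F; case: ifP => // _; case: b.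
  have hR b : \row_m (F b m)%:Z = if b then uv j else 0.
    apply/rowP => m; rewrite /F mxE; case: b => /=; rewrite !mxE ?eqxx /=; by case: (m == j).
  by rewrite !hS !hP !hR /dif addr0 /= subnn expr0 subn0 expr1; ring.
- by rewrite ffunE /F; case: ifP => // _; case: b.
- by rewrite /F eqxx; case: b.
- have := hg m; rewrite ffunE /F; case: eqP => [->|_]; last by case: (g m).
  by case: (g j) => [|[]].
Qed.

Lemma mdiff_mono2 i j h k : mdiff (mono2 i j) h k = dif (dif h (uv i)) (uv j) k.
Proof.
case: (eqVneq i j) => [<-|ij].
  pose F (b : 'I_3) (m : 'I_d) : nat := if m == i then nat_of_ord b else 0%N.
  have al m : mono2 i i m = if m == i then 2%N else 0%N by rewrite ffunE; case: eqP.
  rewrite (@mdiff_reindex _ _ F (fun g => inord (g i))) => [|b m|b|g hg m].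
  - have hS b : (\sum_m (mono2 i i m - F b m))%N = (2 - b)%N.
      rewrite (bigD1 i)//= big1 => [|m /negbTE mj]; first by rewrite addn0 al /F eqxx.
      by rewrite al /F mj.
    have hP b : (\prod_m 'C(mono2 i i m, F b m))%N = 'C(2, b).
      rewrite (bigD1 i)//= big1 => [|m /negbTE mj]; first by rewrite muln1 al /F eqxx.
      by rewrite al /F mj.
    have hR b : \row_m (F b m)%:Z = uv i *+ b.
      apply/rowP => m; rewrite mulmxnE !mxE /F eqxx /=; case: (m == i) => /=; last by rewrite mul0rn.
      exact: esym (natz _).
    rewrite !big_ord_recl big_ord0 !hS !hP !hR /dif /= ?mulr0n ?mulr1n ?mulr2n addr0 !addrA.
    rewrite /bump /= subn0 expr2 expr1 subnn expr0.
    ring.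
  - by rewrite al /F; case: ifP => // _; rewrite -ltnS ltn_ord.
  - by apply/val_inj; rewrite /= /F eqxx inordK.
  - have := hg m; rewrite al /F; case: eqP => [->|_ h0].
      by move=> h2; rewrite inordK.
    by apply/esym/eqP; rewrite -leqn0.
pose F (b : bool * bool) (m : 'I_d) : nat :=
  if m == i then nat_of_bool b.1 else if m == j then nat_of_bool b.2 else 0%N.
have al m : mono2 i j m = if m == i then 1%N else if m == j then 1%N else 0%N.
  by rewrite ffunE; case: eqP => [->|_]; [rewrite (negbTE ij)|case: eqP].
have ji : (j == i) = false by rewrite eq_sym (negbTE ij).
rewrite (@mdiff_reindex _ _ F (fun g => (g i != 0%N, g j != 0%N))) => [|b m|b|g hg m].
- have hS b : (\sum_m (mono2 i j m - F b m))%N = ((1 - b.1) + (1 - b.2))%N.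
    rewrite (bigD1 i)//= (bigD1 j)/= ?ji// big1 => [|m /andP[/negbTE mi /negbTE mj]].
      by rewrite addn0 !al /F !eqxx ji.
    by rewrite al /F mi mj.
  have hP b : (\prod_m 'C(mono2 i j m, F b m))%N = 1%N.
    by rewrite big1// => m _; rewrite al /F; case: ifP => _; [case: b.1|case: ifP => // _; case: b.2].
  have hR b : \row_m (F b m)%:Z = uv i *+ b.1 + uv j *+ b.2.
    apply/rowP => m; rewrite !mxE !mulmxnE !mxE /F !eqxx /=.
    case: eqP => [->|_]; first by rewrite (negbTE ij) mul0rn addr0; case: b.1.
    by case: eqP => [_|_]; rewrite ?mul0rn ?add0r; case: b.2.
  rewrite -(pair_bigA _ (fun b c => (-1) ^+ (\sum_m (mono2 i j m - F (b, c) m))%N *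
     (\prod_m 'C(mono2 i j m, F (b, c) m))%:R * h (k + \row_m (F (b, c) m)%:Z))).
  rewrite !big_bool !hS !hP !hR /dif /= !mulr1n !mulr0n !addr0 !add0r.
  rewrite (addrC (uv i)) !addrA.
  ring.
- by rewrite al /F; case: ifP => _; [case: b.1|case: ifP => // _; case: b.2].
- by rewrite /F !eqxx ji; case: b => -[] [].
- have := hg m; rewrite al /F; case: eqP => [->|_]; first by case: (g i) => [|[]].
  case: eqP => [->|_]; first by case: (g j) => [|[]].
  by case: (g m).
Qed.

End differences.

(** * Iterated derivatives as powers of the frequency *)

Section iterated_partials.
Context {R : realType} {d : nat}.
Local Notation point := 'rV[R]_d.
Local Notation Z := 'rV[int]_d.
Local Notation C := R[i].
Local Notation dd := (@dd R d).
Implicit Types (u : point -> C) (f : point -> R) (k l q : Z).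

Lemma smooth_partials js f : smooth f -> smooth (partials js f).
Proof. by move=> sf js'; have := sf (js' ++ js); rewrite /partials foldr_cat. Qed.

Lemma periodic_partials js f : torus_periodic f -> torus_periodic (partials js f).
Proof. by move=> pf; elim: js => //= j js; exact: periodic_partial. Qed.

Lemma L2_smooth f : torus_periodic f -> smooth f -> L2 (toC f).
Proof. by move=> pf sf; apply: L2_toC_bdd => //; have [] := sf [::]. Qed.

Lemma fourier_partials_nseq f j n q : torus_periodic f -> smooth f ->
  fourier (toC (partials (nseq n j) f)) q = ('i%C * ((q 0 j)%:~R%:C)%C) ^+ n * fourier (toC f) q.
Proof.
move=> pf sf; elim: n => [|n ih]; first by rewrite mul1r.
rewrite /= fourier_partial; first by rewrite -/(partials _ _) ih exprS -!mulrA.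
by apply: smooth_C1; [exact: periodic_partials|exact: smooth_partials].
Qed.

Lemma flatten_monoX n j : flatten [seq nseq (monoX n j m) m | m <- enum 'I_d] = nseq n j.
Proof.
have h (s : seq 'I_d) : uniq s ->
    flatten [seq nseq (monoX n j m) m | m <- s] = if j \in s then nseq n j else [::].
  elim: s => //= m s ih /andP[ms us]; rewrite ih// inE ffunE eq_sym.
  by case: eqP => [->|_] //=; rewrite (negbTE ms) cats0.
by rewrite h ?enum_uniq// mem_enum.
Qed.

Lemma toC_split (u : point -> C) : u = (fun x => toC (re u) x + 'i%C * toC (im u) x).
Proof. by apply/funext => x; rewrite /toC /re /im; case: (u x) => a b; simpc. Qed.

Lemma L2_split f f' : L2 (toC f) -> L2 (toC f') -> L2 (fun x => (f x +i* f' x)%C).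
Proof.
move=> hf hf'; rewrite (toC_split (fun x => (f x +i* f' x)%C)).
by apply: L2D; [exact: hf|apply: L2Z; exact: hf'].
Qed.

Lemma fourier_split f f' q : L2 (toC f) -> L2 (toC f') ->
  fourier (fun x => (f x +i* f' x)%C) q = fourier (toC f) q + 'i%C * fourier (toC f') q.
Proof.
move=> hf hf'; rewrite (toC_split (fun x => (f x +i* f' x)%C)) fourierD ?fourierZ//.
exact: L2Z.
Qed.

Lemma L2_mpartial beta u : torus_periodic u -> smooth (re u) -> smooth (im u) -> L2 (mpartial beta u).
Proof.
move=> pu sr si; apply: L2_split; apply: L2_smooth; rewrite ?/(partials _ _);
  solve [exact: smooth_partials | apply: periodic_partials => x j; by rewrite /re /im pu].
Qed.

Lemma fourier_mpartial u n j q : torus_periodic u -> smooth (re u) -> smooth (im u) ->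
  fourier (mpartial (monoX n j) u) q = ('i%C * ((q 0 j)%:~R%:C)%C) ^+ n * fourier u q.
Proof.
move=> pu sr si; rewrite /mpartial flatten_monoX.
have pr : torus_periodic (re u) by move=> x m; rewrite /re pu.
have pi : torus_periodic (im u) by move=> x m; rewrite /im pu.
rewrite fourier_split; first last.
- by apply: L2_smooth; [exact: periodic_partials|exact: smooth_partials].
- by apply: L2_smooth; [exact: periodic_partials|exact: smooth_partials].
rewrite !fourier_partials_nseq// {3}(toC_split u) fourierD ?fourierZ; first ring.
- exact: L2_smooth.
- exact: L2_smooth.
- by apply: L2Z; exact: L2_smooth.
Qed.

Lemma fourier_bdd u q B : L2 u -> (forall x, nc (u x) <= B) -> nc (fourier u q) <= dd * B.
Proof.
move=> hu hB; have B0 : 0 <= B by exact: le_trans (nc_ge0 _) (hB 0).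
have d0 := @dd_gt0 R d.
have := Hb_pt q (bessel hu); rewrite wt0 mul1r => h; apply: (le_trans h).
have -> : dd * B = Num.sqrt ((dd * B) ^+ 2) by rewrite sqrtr_sqr ger0_norm// mulr_ge0// ltW.
rewrite ler_sqrt ?sqr_ge0// exprMn expr2 -mulrA ler_wpM2l ?(ltW d0)//.
have /L2P[_ _ i] := hu.
apply: (le_trans (Rint_le i (rint_cst _ (B ^+ 2)) _)).
  by move=> t; rewrite ler_sqr ?nnegrE ?nc_ge0.
have E : fine (torus_measure R d setT) = dd by rewrite (@torus_setT R d).
by rewrite Rintegral_cst// E mulrC.
Qed.

(** [om q] is at most d + 1 times the maximum of 1 and the |q_j|, and whichever of these attains the
    maximum, one of the hypotheses bounds its power times [y]. *)
Lemma om_pow_le (N : nat) q (x y : R) (X : 'I_d -> R) : 0 <= y ->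
  y <= x -> (forall j, `|(q 0 j)%:~R| ^+ N * y <= X j) ->
  om q ^+ N * y <= d.+1%:R ^+ N * (x + \sum_j X j).
Proof.
move=> y0 yx hX.
pose m : R := \big[Num.max/1]_j `|(q 0 j)%:~R|.
have m1 : 1 <= m by exact: bigmax_ge_id.
have omm : om q <= d.+1%:R * m.
  rewrite /om -natr1 l1E -[d.+1%:R]natr1 mulrDl mul1r lerD//.
  have -> : d%:R * m = \sum_(j < d) m by rewrite sumr_const card_ord -[RHS]mulr_natl.
  by apply: ler_sum => j _; exact: (@le_bigmax _ _ _ _ (fun j => `|(q 0 j)%:~R|)).
apply: (@le_trans _ _ ((d.+1%:R * m) ^+ N * y)).
  by rewrite ler_wpM2r// lerXn2r ?nnegrE ?mulr_ge0 ?(ltW (om_gt0 _))// (le_trans ler01).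
rewrite exprMn -mulrA ler_wpM2l ?exprn_ge0//.
have X0 j : 0 <= X j by apply: le_trans (hX j); rewrite mulr_ge0// exprn_ge0.
have x0 : 0 <= x by exact: le_trans yx.
rewrite /m; elim/big_ind: _ => [|a b ha hb|j _].
- by rewrite expr1n mul1r; apply: (le_trans yx); rewrite lerDl sumr_ge0.
- by rewrite /Num.max; case: ifP.
- apply: (le_trans (hX j)); rewrite (bigD1 j)//= addrCA lerDl addr_ge0// sumr_ge0//.
Qed.

End iterated_partials.

Section symbol_coefficients.
Context {R : realType} {d : nat}.
Local Notation point := 'rV[R]_d.
Local Notation Z := 'rV[int]_d.
Local Notation C := R[i].
Local Notation dd := (@dd R d).
Local Notation multi := (@multi d).
Variables (a : point -> Z -> C) (s : R).
Hypothesis dp : (0 < d)%N.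
Hypothesis ha : symbol_class s 1 0 a.
Implicit Types (k l q : Z) (alpha : multi).

Let pa k : torus_periodic (a^~ k). Proof. by have [/(_ k)[]] := ha. Qed.
Let sr k : smooth (re (a^~ k)). Proof. by have [/(_ k)[]] := ha. Qed.
Let si k : smooth (im (a^~ k)). Proof. by have [/(_ k)[]] := ha. Qed.

Lemma fourier_mdiff (h : Z -> point -> C) alpha k q : (forall l, L2 (h l)) ->
  L2 (fun x => mdiff alpha (fun l => h l x) k) /\
  fourier (fun x => mdiff alpha (fun l => h l x) k) q = mdiff alpha (fun l => fourier (h l) q) k.
Proof.
move=> hh; split; first by apply: L2_sum => g; exact: L2Z.
rewrite /mdiff fourier_sum => [|g]; last exact: L2Z.
by apply: eq_bigr => g _; rewrite fourierZ.
Qed.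

(* Derivatives of the symbol in the direction [j] are traded for powers of [q_j]. *)
Lemma mdiff_coef_bound (N : nat) alpha : exists2 K : R, 0 <= K & forall q l,
  om q ^+ N * nc (mdiff alpha (bP a q) l) <= K * wt (s - (abs_multi alpha)%:R) l.
Proof.
have d0 := @dd_gt0 R d.
have [_ hb] := ha.
have key n : exists X : 'I_d -> R, (forall j, 0 <= X j) /\ forall j q l,
    `|(q 0 j)%:~R| ^+ n * nc (mdiff alpha (bP a q) l) <= X j * wt (s - (abs_multi alpha)%:R) l.
  have h j : exists X : R, 0 <= X /\ forall q l,
      `|(q 0 j)%:~R| ^+ n * nc (mdiff alpha (bP a q) l) <= X * wt (s - (abs_multi alpha)%:R) l.
    have [X X0 hX] := hb alpha (monoX n j).
    exists X; split => [|q l]; first exact: ltW.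
    have hL m : L2 (mpartial (monoX n j) (a^~ m)) by exact: L2_mpartial.
    have [hL2 E] := fourier_mdiff alpha l q hL.
    have hle := fourier_bdd q hL2 (fun x => hX x l).
    rewrite E mul1r mul0r addr0 in hle.
    have E2 : mdiff alpha (fun m => fourier (mpartial (monoX n j) (a^~ m)) q) l =
       ('i%C * ((q 0 j)%:~R%:C)%C) ^+ n * mdiff alpha (fun m => fourier (a^~ m) q) l.
      by rewrite -mdiffZ; congr (mdiff _ _ _); apply/funext => m; rewrite fourier_mpartial.
    rewrite {}E2 ncM in hle.
    have ncX (z : C) : nc (z ^+ n) = nc z ^+ n.
      by elim: n {hX hL hL2 E hle} => [|n' ih]; rewrite ?expr0 ?exprS ?ncM ?ih// (nc_nat 1).
    rewrite ncX ncM nc_i mul1r nc_real in hle.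
    have -> : mdiff alpha (bP a q) l = (dd^-1%:C)%C * mdiff alpha (fun m => fourier (a^~ m) q) l.
      exact: mdiffZ.
    have dge0 : 0 <= dd^-1 by rewrite invr_ge0 ltW.
    rewrite ncM nc_real (ger0_norm dge0) mulrCA.
    by rewrite mulrC ler_pdivrMr// (mulrC (X * _)).
  have [X hX] := choice h; exists X; split => [j|j]; by have [] := hX j.
have [X [X0 hX]] := key N.
have [K0 [K00 hK0]] : exists K0 : R, 0 <= K0 /\ forall q l,
    nc (mdiff alpha (bP a q) l) <= K0 * wt (s - (abs_multi alpha)%:R) l.
  have [Y [Y0 hY]] := key 0%N; exists (Y (Ordinal dp)); split => // q l.
  by have := hY (Ordinal dp) q l; rewrite expr0 mul1r.
exists (d.+1%:R ^+ N * (K0 + \sum_j X j)).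
  by rewrite mulr_ge0 ?exprn_ge0// addr_ge0// sumr_ge0.
move=> q l.
rewrite -mulrA mulrDl mulr_suml.
by apply: om_pow_le => [||j]; [exact: nc_ge0|exact: hK0|exact: hX].
Qed.

Lemma symbol_symb (M : nat) : exists c S, [/\ forall q, 0 <= c q,
  forall q, symb s (c q) (bP a q) & summ (fun q => c q * om q ^+ M) S].
Proof.
(* The surplus 2 d leaves [om] to the power - 2 d, summable by [summ_inv_bracket]. *)
pose N := (M + 2 * d)%N.
have hE alpha : exists K : R, 0 <= K /\ forall q l,
    om q ^+ N * nc (mdiff alpha (bP a q) l) <= K * wt (s - (abs_multi alpha)%:R) l.
  by have [K K0 hK] := mdiff_coef_bound N alpha; exists K.
have [X hX] := choice hE.
have X0 alpha : 0 <= X alpha by have [] := hX alpha.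
pose K := X (monoX 0 (Ordinal dp)) + (\sum_i X (monoX 1 i) + \sum_i \sum_j X (mono2 i j)).
have K0 : X (monoX 0 (Ordinal dp)) <= K by rewrite lerDl addr_ge0 ?sumr_ge0// => i _; rewrite sumr_ge0.
have K1 i : X (monoX 1 i) <= K.
  rewrite /K (bigD1 i)//= addrCA -!addrA lerDl !addr_ge0 ?sumr_ge0// => m _; by rewrite ?sumr_ge0.
have K2 i j : X (mono2 i j) <= K.
  have h1 : X (mono2 i j) <= \sum_j X (mono2 i j) by rewrite (bigD1 j)//= lerDl sumr_ge0.
  have h2 : \sum_j X (mono2 i j) <= \sum_i \sum_j X (mono2 i j).
    by rewrite [leRHS](bigD1 i)//= lerDl sumr_ge0// => m _; exact: sumr_ge0.
  apply: (le_trans h1); apply: (le_trans h2).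
  by rewrite /K addrA lerDr addr_ge0// sumr_ge0.
have Kge0 : 0 <= K by exact: le_trans (X0 _) K0.
pose c q : R := K * om q ^- N.
have c0 q : 0 <= c q by rewrite mulr_ge0// invr_ge0 exprn_ge0// ltW// om_gt0.
have bnd alpha q l : X alpha <= K -> nc (mdiff alpha (bP a q) l) <= c q * wt (s - (abs_multi alpha)%:R) l.
  move=> XK; have [_ /(_ q l) h] := hX alpha.
  rewrite /c mulrAC ler_pdivlMr ?exprn_gt0 ?om_gt0// mulrC.
  by apply: (le_trans h); rewrite ler_wpM2r ?wt_ge0.
have [S [S0 S1 hS]] := @summ_inv_bracket R d.
exists c, (K * S); split => // [q|].
  split=> [l|j l|i j l].
  - by have := bnd _ q l K0; rewrite mdiff_monoX0 abs_monoX subr0.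
  - by have := bnd _ q l (K1 j); rewrite mdiff_monoX1 abs_monoX.
  - by have := bnd _ q l (K2 i j); rewrite mdiff_mono2 abs_mono2.
split=> [|q|n]; [exact: mulr_ge0|by rewrite mulr_ge0// exprn_ge0// ltW// om_gt0|].
apply: (le_trans _ (ler_wpM2l Kge0 (hS n))); rewrite mulr_sumr; apply: ler_sum => q _.
have o0 := @om_gt0 R d q.
rewrite /c -mulrA ler_wpM2l// /N exprD invfM mulrAC mulVf ?mul1r ?expf_neq0 ?gt_eqF//.
rewrite lef_pV2 ?posrE ?exprn_gt0 ?bracket_gt0//.
by rewrite lerXn2r ?nnegrE ?bracket_le_om// ltW// bracket_gt0.
Qed.

End symbol_coefficients.

(** * Passage to the limit *)

Section truncation.
Context {R : realType} {d : nat}.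
Local Notation Z := 'rV[int]_d.
Local Notation C := R[i].
Implicit Types (k : Z) (x y : Z -> C) (X Y : nat -> Z -> C).

Definition Hcvg (r : R) X x := exists e, to0 e /\ forall n, Hb r (fun k => X n k - x k) (e n).

Definition cutoff n x : Z -> C := fun k => if k \in box n then x k else 0.

Lemma cutoff_supp n x k : cutoff n x k != 0 -> k \in box n.
Proof. by rewrite /cutoff; case: ifP; rewrite ?eqxx. Qed.

Lemma Hb_cutoff r n x B : Hb r x B -> Hb r (cutoff n x) B.
Proof.
apply: Hb_dom => k; rewrite /cutoff; case: ifP => // _.
by rewrite nc0 mulr0 mulr_ge0 ?wt_ge0 ?nc_ge0.
Qed.

Lemma Hcvg_cutoff r x B : Hb r x B -> Hcvg r (cutoff ^~ x) x.
Proof.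
move=> hx; have [e [e0 ge0 he]] := Hb_tail hx.
exists e; split=> // n; apply: he => k; rewrite /cutoff; first by move=> ->; rewrite subrr.
by case: ifP => _; [rewrite subrr nc0 nc_ge0|rewrite sub0r ncN].
Qed.

(** The error splits into the truncated operator applied to X n - x, bounded uniformly in [n], and
    its truncation error at the fixed [x]. *)
Lemma Hcvg_op s M (b : Z -> Z -> C) c S r X x B y : fam s M b c S -> `|r| <= M%:R ->
  Hb (r + s) x B -> oplim b x y -> Hcvg (r + s) X x -> Hcvg r (fun n => op b n (X n)) y.
Proof.
move=> hfam rM hx hy [e [e0 he]].
have [e' [e'0 _ he']] := oplim_tail hfam.
have S0 : 0 <= S by case: hfam => _ _ [].
have B0 := Hb_ge0 hx.
exists (fun n => S * e n + B * e' n); split; first by apply: to0D; exact: to0Z.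
move=> n; have h1 := Hb_op n hfam rM (he n); have h2 := he' _ _ _ _ n rM hx hy.
rewrite mulrC in h2.
move: (HbD h1 h2); rewrite [B * _]mulrC [e' n * B]mulrC; apply: Hb_eq => k.
by rewrite /op opIB subrKA.
Qed.

Lemma Hcvg_mono r r' X x : r <= r' -> Hcvg r' X x -> Hcvg r X x.
Proof. by move=> rr [e [e0 he]]; exists e; split => // n; exact: Hb_mono rr (he n). Qed.

(** The estimates hold for every finite box, so the size [phi n] is free and can be adapted to the
    supports. *)
Lemma Hcvg_dot X Y x y B B' (phi : nat -> nat) : Hcvg 0 X x -> Hcvg 0 Y y ->
  Hb 0 x B -> Hb 0 y B' ->
  to0 (fun n => `|complex.Re (dot (box (phi n)) (X n) (Y n)) - complex.Re (dot (box (phi n)) x y)|).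
Proof.
move=> [e [e0 he]] [e' [e'0 he']] hx hy.
have [B0 B'0] := (Hb_ge0 hx, Hb_ge0 hy).
have ge0 n : 0 <= e n := Hb_ge0 (he n).
have ge'0 n : 0 <= e' n := Hb_ge0 (he' n).
have h : to0 (fun n => e n * e' n + (B' * e n + B * e' n)).
  apply: to0D; last by apply: to0D; exact: to0Z.
  move=> eps eps0; have [N hN] := e0 _ ltr01; have [N' hN'] := e'0 _ eps0.
  exists (maxn N N') => n; rewrite geq_max => /andP[n1 n2].
  by rewrite -[eps]mul1r; apply: ler_pM => //; [exact: hN|exact: hN'].
apply: to0_le h => n; set A := box _.
have uA : uniq A := uniq_box _.
have -> : complex.Re (dot A (X n) (Y n)) - complex.Re (dot A x y) =
   complex.Re (dot A (fun k => X n k - x k) (fun k => Y n k - y k)) +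
   (complex.Re (dot A (fun k => X n k - x k) y) + complex.Re (dot A x (fun k => Y n k - y k))).
  rewrite -!raddfD -raddfB /dot -!big_split -sumrB; congr (complex.Re _); apply: eq_bigr => k _ /=.
  rewrite !rmorphB /=; ring.
apply: (le_trans (ler_normD _ _)); apply: lerD; first exact: Re_dot_le.
apply: (le_trans (ler_normD _ _)); apply: lerD; last exact: Re_dot_le.
by rewrite mulrC; exact: Re_dot_le.
Qed.

Lemma oplim_sum (b : Z -> Z -> C) (I : Type) (r : seq I) (g y : I -> Z -> C) :
  (forall i, oplim b (g i) (y i)) ->
  oplim b (fun k => \sum_(i <- r) g i k) (fun k => \sum_(i <- r) y i k).
Proof.
move=> h; elim: r => [|i r ih].
  have E (z : I -> Z -> C) : (fun k => \sum_(i <- [::]) z i k) = fun=> 0.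
    by apply/funext => k; rewrite big_nil.
  by rewrite !E; exact: oplim0.
have E (z : I -> Z -> C) : (fun k => \sum_(i <- i :: r) z i k) = fun k => z i k + \sum_(i <- r) z i k.
  by apply/funext => k; rewrite big_cons.
by rewrite !E; exact: oplimD.
Qed.

End truncation.

Lemma limit_le_scaled (R : realType) (v r1 r2 bnd : R) (E1 E2 D1 D2 : nat -> R) : 0 <= v ->
  to0 (fun n => `|r1 - v * E1 n|) -> to0 (fun n => `|r2 - v * E2 n|) ->
  to0 (fun n => `|D1 n - E1 n|) -> to0 (fun n => `|D2 n - E2 n|) ->
  (forall n, D1 n + D2 n <= bnd) -> r1 + r2 <= v * bnd.
Proof.
move=> v0 t3 t4 t1 t2 h.
rewrite -subr_le0; apply: to0_const.
apply: to0_le (to0D (to0D t3 t4) (to0Z v0 (to0D t1 t2))) => n.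
have g1 := ler_norm (r1 - v * E1 n); have g2 := ler_norm (r2 - v * E2 n).
have g3 := ler_wpM2l v0 (ler_norm (- (D1 n - E1 n))).
have g4 := ler_wpM2l v0 (ler_norm (- (D2 n - E2 n))).
have g5 := ler_wpM2l v0 (h n).
rewrite !normrN !mulrN !mulrBr in g3 g4; rewrite mulrDr in g5; rewrite mulrDr.
lra.
Qed.

Section lie_energy.
Context {R : realType} {d : nat}.
Local Notation point := 'rV[R]_d.
Local Notation Z := 'rV[int]_d.
Local Notation C := R[i].
Local Notation dd := (@dd R d).
Variables (s : R) (M : nat) (a : point -> Z -> C) (c : Z -> R) (S : R).
Hypotheses (s1 : 1 <= s) (sM : s + 2 <= M%:R).
Hypotheses (pa : forall k, torus_periodic (a^~ k)) (ma : forall k, mfC (a^~ k)).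
Hypothesis (ba : forall k, exists K, forall x, nc (a x k) <= K).
Hypotheses (c0 : forall q, 0 <= c q) (hb : forall q, symb s (c q) (bP a q)).
Hypothesis hS : summ (fun q => c q * om q ^+ M.+3) S.

Lemma pdo_fourier0 u B : Hb s (fourier u) B -> [/\ L2 (pdo a u),
  oplim (bP a) (fourier u) (fourier (pdo a u)) & Hb 0 (fourier (pdo a u)) (S * B)].
Proof.
move=> hu; have hfam := famP_le c0 hb hS (leqnn _).
have [h1 h2] := pdo_fourier pa ma ba hfam hu; split => //.
by apply: Hb_oplim hfam _ _ h2; rewrite ?normr0// add0r.
Qed.

Variables (X : point -> point) (V : R) (f : point -> R) (B B2 : R).
Hypotheses (hX : forall j, L2 (toC (vcomp X j))).
Hypothesis (hX1 : forall j, exists B', Hb 1 (fourier (toC (vcomp X j))) B').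
Hypothesis hV : summ (fun p => vn (vhat X) p * om p ^+ M.+3) V.
Hypotheses (hf : L2 (toC f)) (hB2 : Hb (s + 2) (fourier (toC f)) B2) (hB : Hb s (fourier (toC f)) B).

Let hV1 : summ (fun p => vn (vhat X) p * om p ^+ 1) V.
Proof. by apply: summ_le_exp hV => // k; exact: vn_ge0. Qed.

Let F := fourier (toC f).

Let hB2' : Hb (s + 1 + 1) F B2.
Proof. by rewrite -addrA. Qed.

Let sMa r : 0 <= r -> r <= s + 2 -> `|r| <= (M.+1)%:R.
Proof. by move=> r0 rs; rewrite ger0_norm// (le_trans rs)// (le_trans sM)// ler_nat. Qed.

(** Each application of [lie] costs one derivative, and its argument is in H^1, where the weak
    derivatives exist. *)
Lemma lie_regularity : [/\ L2 (toC (lie X f)), L2 (toC (lie X (lie X f))),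
  oplim (bL (vhat X)) F (fourier (toC (lie X f))) /\ Hb (s + 1) (fourier (toC (lie X f))) (V * B2) &
  oplim (bL (vhat X)) (fourier (toC (lie X f))) (fourier (toC (lie X (lie X f)))) /\
  Hb s (fourier (toC (lie X (lie X f)))) (V * (V * B2))].
Proof.
have famL' : fam 1 M.+1 (bL (vhat X)) (fun p => vn (vhat X) p * om p) V := famL_le hV (leqnSn _).
have h1 : Hb 1 F B2 by apply: Hb_mono hB2; have := s1; lra.
have [L1 o1] := lie_fourier hX hX1 hV1 hf h1.
have H1 : Hb (s + 1) (fourier (toC (lie X f))) (V * B2).
  by apply: Hb_oplim famL' _ hB2' o1; apply: sMa; have := s1; lra.
have h1' : Hb 1 (fourier (toC (lie X f))) (V * B2) by apply: Hb_mono H1; have := s1; lra.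
have [L2' o2] := lie_fourier hX hX1 hV1 L1 h1'.
split => //; split => //.
by apply: Hb_oplim famL' _ H1 o2; apply: sMa; have := s1; lra.
Qed.

(** [f] is cut off to [box n] and all operators to shifts in [box n]; the truncated bound does not
    depend on [n]. The norm [B2] serves the convergence of the truncations, while the bound keeps
    only the H^s norm [B]. *)
Lemma lie_energy :
  complex.Re (innerL2 (pdo a (toC (lie X (lie X f)))) (pdo a (toC f))) +
  complex.Re (innerL2 (pdo a (toC (lie X f))) (pdo a (toC (lie X f)))) <=
  dd^-1 * (14 * (S * V * B) ^+ 2).
Proof.
have [L1 L2' [ol1 H1] [ol2 H2]] := lie_regularity.
have famL' : fam 1 M.+1 (bL (vhat X)) (fun p => vn (vhat X) p * om p) V := famL_le hV (leqnSn _).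
have famP : fam s M.+3 (bP a) c S := famP_le c0 hb hS (leqnn _).
have H1s : Hb s (fourier (toC (lie X f))) (V * B2) by apply: Hb_mono H1; have := s1; lra.
have [P0 p0 Q0] := pdo_fourier0 hB.
have [P1 p1 Q1] := pdo_fourier0 H1s.
have [P2 p2 Q2] := pdo_fourier0 H2.
have z0 : `|0 : R| <= (M.+3)%:R by rewrite normr0.
have c0' : Hcvg (s + 2) (cutoff ^~ F) F := Hcvg_cutoff hB2.
have c1 : Hcvg (s + 1) (fun n => op (bL (vhat X)) n (cutoff n F)) (fourier (toC (lie X f))).
  apply: (Hcvg_op famL' _ hB2' ol1); first by apply: sMa; have := s1; lra.
  by rewrite -addrA.
have c2 : Hcvg s (fun n => op (bL (vhat X)) n (op (bL (vhat X)) n (cutoff n F)))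
    (fourier (toC (lie X (lie X f)))).
  by apply: (Hcvg_op famL' _ H1 ol2 c1); apply: sMa; have := s1; lra.
have toP g G B' y : Hb s G B' -> oplim (bP a) G y -> Hcvg s g G -> Hcvg 0 (fun n => op (bP a) n (g n)) y.
  by move=> h1 h2 h3; apply: (@Hcvg_op _ _ s _ _ _ _ 0 g G B' y famP z0 _ h2); rewrite add0r.
have q0 : Hcvg 0 (fun n => op (bP a) n (cutoff n F)) (fourier (pdo a (toC f))).
  by apply: toP hB p0 _; apply: Hcvg_mono c0'; have := s1; lra.
have q1 := toP _ _ _ _ H1s p1 (Hcvg_mono _ c1).
have {}q1 := q1 ltac:(have := s1; lra).
have q2 := toP _ _ _ _ H2 p2 c2.
(* The size that [energy_bound] requires for a function supported in [box n]. *)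
pose phi n : nat := (n + n *+ 5)%N.
have phile n : (n <= phi n)%N by exact: leq_addr.
have t1 := Hcvg_dot phi q2 q0 Q2 Q0.
have t2 := Hcvg_dot phi q1 q1 Q1 Q1.
have t3 := to0_comp phile (parseval P2 P0).
have t4 := to0_comp phile (parseval P1 P1).
have dge0 : 0 <= dd^-1 by rewrite invr_ge0 ltW// dd_gt0.
apply: (limit_le_scaled dge0 t3 t4 t1 t2) => n.
exact: (@energy_bound R d s M (bP a) c S (le_trans ler01 s1) sM c0 hb hS (vhat X) V
  (fun p j => vhatN p (hX j)) hV n n (phi n) (cutoff n F) B
  (@cutoff_supp _ _ n F) (leqnn _) (Hb_cutoff n hB)).
Qed.

End lie_energy.

(** * Series in weighted spaces *)

Section series.
Context {R : realType} {d : nat}.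
Local Notation point := 'rV[R]_d.
Local Notation Z := 'rV[int]_d.
Local Notation C := R[i].
Local Notation dd := (@dd R d).
Implicit Types (u v : point -> C) (k : Z).

Lemma Re_inner_bound u v B B' : L2 u -> L2 v -> Hb 0 (fourier u) B -> Hb 0 (fourier v) B' ->
  `|complex.Re (innerL2 u v)| <= dd^-1 * (B * B').
Proof.
move=> hu hv hB hB'.
have dge0 : 0 <= dd^-1 by rewrite invr_ge0 ltW// dd_gt0.
rewrite -subr_le0; apply: to0_const; apply: to0_le (parseval hu hv) => n.
have h := ler_wpM2l dge0 (Re_dot_le (uniq_box n) hB hB').
move: (complex.Re (innerL2 u v)) (complex.Re (dot _ _ _)) h => r q h.
rewrite lerBlDr -[X in `|X| <= _](subrK (dd^-1 * q)).
apply: (le_trans (ler_normD _ _)); rewrite lerD2l.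
by rewrite normrM (ger0_norm dge0).
Qed.

Lemma Re_inner_sumB u (w : nat -> point -> C) v n : L2 u -> (forall i, L2 (w i)) -> L2 v ->
  complex.Re (innerL2 (fun x => u x - \sum_(0 <= i < n) w i x) v) =
  complex.Re (innerL2 u v) - \sum_(0 <= i < n) complex.Re (innerL2 (w i) v).
Proof.
move=> hu hw hv; rewrite -Re_sum -raddfB; congr (complex.Re _).
have hvJ := L2J hv.
rewrite innerE.
rewrite (@eq_IC _ _ _ (fun x => u x * (v x)^*%C + - (\sum_(0 <= i < n) w i x * (v x)^*%C))); last first.
  by move=> x; rewrite mulrBl mulr_suml.
have ci i : cint (fun x => w i x * (v x)^*%C) by exact: L2_mul.
have cs := cint_sum (index_iota 0 n) ci.
by rewrite (ICD (L2_mul hu hvJ) (cintN cs)) (ICN cs) (IC_sum _ ci).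
Qed.

Lemma bounded_series_tail (v : nat -> R) T : (forall i, 0 <= v i) ->
  (forall n, \sum_(0 <= i < n) v i <= T) ->
  exists e, [/\ to0 e, forall n, 0 <= e n &
    forall m n, (m <= n)%N -> \sum_(m <= i < n) v i <= e m].
Proof.
move=> v0 vT; pose u n := \sum_(0 <= i < n) v i.
have nu : nondecreasing_seq u.
  by move=> m n mn; rewrite /u (big_cat_nat (leq0n m) mn)//= lerDl sumr_ge0.
have cu : cvgn u by apply: nondecreasing_is_cvgn => //; exists T => _ [n _ <-]; exact: vT.
have ul n : u n <= limn u by exact: nondecreasing_cvgn_le.
exists (fun n => limn u - u n); split=> [|n|m n mn].
- by apply: to0_le (cvg_to0 cu) => n; rewrite distrC ler_norm.
- by rewrite subr_ge0.
- by have := ul n; rewrite lerBrDl {1}/u (big_cat_nat (leq0n m) mn).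
Qed.

(** The terms [t] being nonnegative, their sum up to [n] is at most the sum up to any later [m],
    where the sum of [r] is already close to [A]. *)
Lemma partial_sums_le (A bnd : R) (r t : nat -> R) : (forall i, 0 <= t i) ->
  to0 (fun n => `|A - \sum_(0 <= i < n) r i|) ->
  (forall n, \sum_(0 <= i < n) (r i + t i) <= bnd) ->
  forall n, \sum_(0 <= i < n) t i <= bnd - A.
Proof.
move=> t0 Ar sums n.
rewrite -subr_le0; apply: to0_const.
apply: (@to0_eventually _ _ (fun m => `|A - \sum_(0 <= i < m) r i|) n) Ar => m nm.
have h1 : \sum_(0 <= i < n) t i <= \sum_(0 <= i < m) t i.
  by rewrite [leRHS](big_cat_nat (leq0n n) nm)//= lerDl sumr_ge0.
have := sums m; rewrite big_split /= => h2.
have := ler_norm (A - \sum_(0 <= i < m) r i); lra.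
Qed.

Lemma Hb_series r (y : nat -> Z -> C) (v : nat -> R) T : 0 <= r -> (forall i, Hb r (y i) (v i)) ->
  (forall n, \sum_(0 <= i < n) v i <= T) ->
  exists Y e, [/\ Hb r Y T, to0 e & forall n, Hb r (fun k => Y k - \sum_(0 <= i < n) y i k) (e n)].
Proof.
move=> r0 hy vT; have v0 i : 0 <= v i := Hb_ge0 (hy i).
have [e [e0 ge0 he]] := bounded_series_tail v0 vT.
have T0 : 0 <= T by have := vT 0%N; rewrite big_geq.
have hd m n : (m <= n)%N ->
    Hb r (fun k => \sum_(0 <= i < n) y i k - \sum_(0 <= i < m) y i k) (e m).
  move=> mn; apply: Hb_le (he m n mn).
  apply: Hb_eq (Hb_sum (index_iota m n) hy) => k.
  by rewrite [X in _ = X - _](big_cat_nat (leq0n m) mn)//= addrAC subrr add0r.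
have hp k : exists z, forall m, nc (\sum_(0 <= i < m) y i k - z) <= e m.
  apply: to0_complete e0 _ => m n mn.
  (* For r >= 0 the weights are at least 1, so the H^r rate also controls each coefficient. *)
  apply: le_trans (Hb_pt k (hd m n mn)); rewrite ler_peMl ?nc_ge0//.
  exact: wt_ge1.
have [Y hY] := choice hp.
have hYc k m : to0 (fun n => nc (\sum_(0 <= i < (m + n)%N) y i k - \sum_(0 <= i < m) y i k - (Y k - \sum_(0 <= i < m) y i k))).
  apply: to0_le (to0_comp (fun n => leq_addl m n) e0) => n.
  by rewrite opprB addrA subrK; exact: hY.
exists Y, e; split => //.
  apply: (@Hb_fatou _ _ r (fun n k => \sum_(0 <= i < n) y i k) Y (fun=> T)) => //.
  - by move=> k; apply: to0_le e0 => n; exact: hY.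
  - by move=> n; apply: Hb_le (Hb_sum (index_iota 0 n) hy) (vT n).
  - by under eq_fun do rewrite subrr; exact: to0_cst.
move=> m; apply: (@Hb_fatou _ _ r (fun n k => \sum_(0 <= i < (m + n)%N) y i k - \sum_(0 <= i < m) y i k)
  _ (fun=> e m) (e m)) => //.
- by move=> n; apply: hd; exact: leq_addr.
- by under eq_fun do rewrite subrr; exact: to0_cst.
Qed.

Lemma mfC_smooth (u : point -> C) : smooth (re u) -> smooth (im u) -> mfC u.
Proof.
move=> sr si; split; apply: continuous_torus_measurable.
  by have [] := sr [::].
by have [] := si [::].
Qed.

Lemma nc_bounded_smooth (u : point -> C) : torus_periodic u -> smooth (re u) -> smooth (im u) ->
  exists K, forall x, nc (u x) <= K.
Proof.
move=> pu sr si.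
have pr : torus_periodic (re u) by move=> x j; rewrite /re pu.
have pi : torus_periodic (im u) by move=> x j; rewrite /im pu.
have [K1 h1] := continuous_periodic_bounded (proj1 (sr [::])) pr.
have [K2 h2] := continuous_periodic_bounded (proj1 (si [::])) pi.
by exists (K1 + K2) => x; apply: (le_trans (nc_le_ReIm _)); apply: lerD; [exact: h1|exact: h2].
Qed.

End series.

Theorem lemmaA5 (R : realType) (d : nat) (s : R)
    (xi : nat -> 'rV[R]_d -> 'rV[R]_d)
    (P : ('rV[R]_d -> R[i]) -> 'rV[R]_d -> R[i]) :
  (1 <= d)%N -> d%:R / 2 + 1 < s ->
  (forall sigma k, 0 <= sigma -> vsobolev sigma (xi k)) ->
  (forall sigma, 0 <= sigma ->
    (\sum_(0 <= k <oo) vsobolev_norm sigma (xi k) < +oo)%E) ->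
  OPS s 1 0 P ->
  exists2 C : R, 0 < C & forall f : 'rV[R]_d -> R, sobolev (s + 2) (toC f) ->
    ((complex.Re (innerL2 (P (L2series (fun k => toC (lie (xi k) (lie (xi k) f)))))
                  (P (toC f))))%:E
     + \sum_(0 <= k <oo)
         (complex.Re (innerL2 (P (toC (lie (xi k) f))) (P (toC (lie (xi k) f)))))%:E
     <= C%:E * sobolev_norm s (toC f) ^+ 2)%E.
Proof.
move=> d1 hs hxi hxis [a ha ->].
have s1 : 1 <= s by apply/ltW; apply: le_lt_trans hs; rewrite lerDr divr_ge0.
have s0 : 0 <= s by exact: le_trans s1.
pose M := (Num.truncn (s + 2)).+1.
have sM : s + 2 <= M%:R by apply/ltW; exact: truncnS_gt.
have [hap _] := ha.
have pa k : torus_periodic (a^~ k) by have [] := hap k.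
have ma k : mfC (a^~ k) by have [_ h1 h2] := hap k; exact: mfC_smooth.
have ba k : exists K, forall x, nc (a x k) <= K.
  by have [h1 h2 h3] := hap k; exact: (nc_bounded_smooth h1 h2 h3).
have [c [S [c0 hb hS]]] := symbol_symb d1 ha M.+3.
have S0 : 0 <= S by case: hS.
have [K K0 hK] := @vhat_summ R d M.+3.
(* The single Sobolev exponent of the fields that enters: [M.+3] powers of [om] for the double
   commutator, and [d] derivatives for absolute summability. *)
pose sigma : R := (M.+3 + d)%:R.
have sg0 : 0 <= sigma by exact: ler0n.
have vs0 k : (0 <= vsobolev_norm sigma (xi k))%E by exact: sqrte_ge0.
have fin_sum := hxis _ sg0.
pose W k := fine (vsobolev_norm sigma (xi k)).
have vfin k : (vsobolev_norm sigma (xi k))%E = (W k)%:E.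
  rewrite fineK// ge0_fin_numE//; apply: le_lt_trans fin_sum.
  apply: le_trans (nneseries_lim_ge k.+1 (fun i _ _ => vs0 i)).
  by rewrite big_nat_recr//= leeDr// sume_ge0.
have W0 k : 0 <= W k by exact: fine_ge0.
pose T := fine (\sum_(0 <= k <oo) vsobolev_norm sigma (xi k)).
have WT n : \sum_(0 <= k < n) W k <= T.
  rewrite -lee_fin /T fineK; last first.
    by rewrite ge0_fin_numE// nneseries_ge0.
  apply: le_trans (nneseries_lim_ge n (fun i _ _ => vs0 i)).
  by rewrite -sumEFin; apply: lee_sum => k _; rewrite vfin.
have T0 : 0 <= T by have := WT 0%N; rewrite big_geq.
pose V k := K * W k.
have V0 k : 0 <= V k by rewrite mulr_ge0// ltW.
have VT n : \sum_(0 <= k < n) V k ^+ 2 <= (K * T) ^+ 2.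
  have h : \sum_(0 <= k < n) V k <= K * T by rewrite -mulr_sumr ler_wpM2l// ltW.
  have h2 : \sum_(0 <= k < n) V k ^+ 2 <= (\sum_(0 <= k < n) V k) ^+ 2.
    rewrite expr2 mulr_suml; apply: ler_sum_nat => k kn; rewrite expr2 ler_wpM2l//.
    by rewrite (bigD1_seq k)//= ?lerDl ?sumr_ge0 ?iota_uniq// mem_index_iota.
  by apply: (le_trans h2); rewrite lerXn2r ?nnegrE ?sumr_ge0// mulr_ge0// ltW.
have compL k j : L2 (toC (vcomp (xi k) j)) by have [] := hxi sigma k sg0 j.
have compH k j : Hb sigma (fourier (toC (vcomp (xi k) j))) (W k).
  have [_ hfin] := hxi sigma k sg0 j.
  apply: (Hb_le (sobolev_Hb hfin)); rewrite -lee_fin fineK.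
    by rewrite -vfin; exact: vsobolev_comp.
  by rewrite ge0_fin_numE// sobolev_norm_ge0.
have comp1 k j : exists B', Hb 1 (fourier (toC (vcomp (xi k) j))) B'.
  by exists (W k); apply: Hb_mono (compH k j); rewrite /sigma (ler_nat _ 1).
have hV k : summ (fun p => vn (vhat (xi k)) p * om p ^+ M.+3) (V k) by exact: hK.
have d0 := @dd_gt0 R d.
pose C0 := (@dd R d)^-1 * (14 * (S * (K * T)) ^+ 2).
have C00 : 0 <= C0 by rewrite mulr_ge0 ?invr_ge0 ?(ltW d0)// mulr_ge0// sqr_ge0.
exists (C0 + 1); first by rewrite ltr_wpDl.
move=> f [hf hfin2].
(* The constant is positive, so an infinite norm makes the right side infinite. *)
have [foo|fnoo] := eqVneq (sobolev_norm s (toC f)) +oo%E.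
  by rewrite foo expe2 mulyy gt0_muley ?leey// lte_fin ltr_wpDl.
have hfin : (sobolev_norm s (toC f) < +oo)%E by rewrite ltey.
have hB2 := sobolev_Hb hfin2; have hB := sobolev_Hb hfin.
set B2 := fine _ in hB2; set B := fine _ in hB.
have BE : sobolev_norm s (toC f) = B%:E by rewrite fineK// ge0_fin_numE// sobolev_norm_ge0.
have B20 := Hb_ge0 hB2; have B0 := Hb_ge0 hB.
have reg k := @lie_regularity R d s M s1 sM (xi k) (V k) f B2 (compL k) (comp1 k) (hV k) hf hB2.
have en k := @lie_energy R d s M a c S s1 sM pa ma ba c0 hb hS (xi k) (V k) f B B2
  (compL k) (comp1 k) (hV k) hf hB2 hB.
pose w k := toC (lie (xi k) (lie (xi k) f)).
have Lw k : L2 (w k) by have [] := reg k.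
have Hw k : Hb s (fourier (w k)) (V k ^+ 2 * B2) by have [_ _ _ [_]] := reg k; rewrite mulrA -expr2.
have VB n : \sum_(0 <= k < n) V k ^+ 2 * B2 <= (K * T) ^+ 2 * B2.
  by rewrite -mulr_suml ler_wpM2r.
(* The series of second Lie derivatives converges in H^s and not merely in L2, which is what allows
   [P] to be applied to its sum. *)
have [Y [e [HY e0 hYe]]] := Hb_series s0 Hw VB.
have HY0 : Hb 0 Y ((K * T) ^+ 2 * B2) by exact: Hb_mono HY.
have Ls n : L2 (fun x => \sum_(0 <= k < n) w k x) by exact: L2_sum.
have near_Y eps : 0 < eps ->
    \forall n \near \oo, Hb 0 (fun k => fourier (fun x => \sum_(0 <= i < n) w i x) k - Y k) eps.
  move=> eps0; have [N hN] := e0 _ eps0; exists N => // n /= Nn.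
  apply: (Hb_le _ (hN n Nn)); apply: Hb_mono s0 _.
  apply: Hb_eq (HbN (hYe n)) => k.
  by rewrite opprB fourier_sum.
have [LW fW] := L2lim_fourier Ls HY0 near_Y.
have fWE : fourier (L2series w) = Y by exact/funext.
have HW : Hb s (fourier (L2series w)) ((K * T) ^+ 2 * B2) by rewrite fWE.
have pdoH u B' (h : Hb s (fourier u) B') := pdo_fourier0 pa ma ba c0 hb hS h.
have [PW pW _] := pdoH _ _ HW.
have [P0 p0 Q0] := pdoH _ _ hB.
have Pw k : L2 (pdo a (w k)) by have [] := pdoH _ _ (Hw k).
have pw k : oplim (bP a) (fourier (w k)) (fourier (pdo a (w k))) by have [] := pdoH _ _ (Hw k).
pose A := complex.Re (innerL2 (pdo a (L2series w)) (pdo a (toC f))).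
pose r k := complex.Re (innerL2 (pdo a (w k)) (pdo a (toC f))).
pose t k := complex.Re (innerL2 (pdo a (toC (lie (xi k) f))) (pdo a (toC (lie (xi k) f)))).
have t0 k : 0 <= t k by rewrite /t -N2_inner N2_ge0.
(* [P] is bounded from H^s to L2, so the H^s rate [e] of the series becomes a rate for the inner
   products. *)
have Ar : to0 (fun n => `|A - \sum_(0 <= k < n) r k|).
  pose E := (@dd R d)^-1 * (S * (S * B)).
  have E0 : 0 <= E by rewrite mulr_ge0 ?invr_ge0 ?(ltW d0)// !mulr_ge0.
  apply: to0_le (to0Z E0 e0) => n.
  rewrite /A /r -Re_inner_sumB//.
  have L' : L2 (fun x => pdo a (L2series w) x - \sum_(0 <= i < n) pdo a (w i) x).
    by apply: L2B => //; exact: L2_sum.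
  have ol : oplim (bP a) (fun k => Y k - \sum_(0 <= i < n) fourier (w i) k)
      (fourier (fun x => pdo a (L2series w) x - \sum_(0 <= i < n) pdo a (w i) x)).
    have h := oplimB pW (oplim_sum (index_iota 0 n) pw).
    rewrite fWE in h.
    rewrite (_ : fourier (fun x => _ - _) = fun k => fourier (pdo a (L2series w)) k - \sum_(0 <= i < n) fourier (pdo a (w i)) k)//.
    apply/funext => k; rewrite fourierB//; last exact: L2_sum.
    by congr (_ - _); exact: fourier_sum.
  have Hn : Hb 0 (fourier (fun x => pdo a (L2series w) x - \sum_(0 <= i < n) pdo a (w i) x)) (S * e n).
    apply: Hb_oplim (famP_le c0 hb hS (leqnn _)) _ _ ol; first by rewrite normr0.
    by rewrite add0r; exact: hYe.
  apply: (le_trans (Re_inner_bound L' P0 Hn Q0)).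
  by rewrite le_eqVlt; apply/orP; left; apply/eqP; rewrite /E; ring.
have sums n : \sum_(0 <= k < n) (r k + t k) <= C0 * B ^+ 2.
  have dge0 : 0 <= (@dd R d)^-1 by rewrite invr_ge0 ltW.
  apply: (@le_trans _ _ (\sum_(0 <= k < n) (@dd R d)^-1 * (14 * (S * V k * B) ^+ 2))).
    by apply: ler_sum => k _; exact: en.
  have -> : \sum_(0 <= k < n) (@dd R d)^-1 * (14 * (S * V k * B) ^+ 2) =
     (@dd R d)^-1 * 14 * S ^+ 2 * B ^+ 2 * \sum_(0 <= k < n) V k ^+ 2.
    rewrite mulr_sumr; apply: eq_bigr => k _; rewrite !exprMn; ring.
  have -> : C0 * B ^+ 2 = (@dd R d)^-1 * 14 * S ^+ 2 * B ^+ 2 * (K * T) ^+ 2.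
    by rewrite /C0 [(S * (K * T)) ^+ 2]exprMn; ring.
  by rewrite ler_wpM2l// !mulr_ge0// ?sqr_ge0.
have part := partial_sums_le t0 Ar sums.
rewrite BE -EFin_expe -EFinM.
change (A%:E + \sum_(0 <= k <oo) (t k)%:E <= ((C0 + 1) * B ^+ 2)%:E)%E.
(* [part] bounds all partial sums of the nonnegative series by C0 B^2 - A, hence also its sum. *)
apply: (@le_trans _ _ (A%:E + (C0 * B ^+ 2 - A)%:E)%E).
  apply: leeD2l; apply: lime_le; first by apply: is_cvg_nneseries => n _ _; rewrite lee_fin.
  by apply: nearW => n; rewrite sumEFin lee_fin.
by rewrite -EFinD lee_fin addrC subrK ler_wpM2r ?sqr_ge0// lerDl.
Qed.
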